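(* Let $\mathcal{T}$ be a triangular planar mesh. Consider the ordered lists of 1-forms $$V_x:=\{dx,\ dy,\ y\,dx,\ xy\,dx,\ y^2\,dx\},\qquad V_y:=\{dx,\ dy,\ x\,dy,\ x^2\,dy,\ xy\,dy\}.$$ Then for sufficiently smooth $\phi\colon S^1\to\mathbb{R}^2$ in general position and for $\mathcal{T}$ sufficiently fine, for each $k$ with $2\le k\le5$, the integrals of the first $k$ 1-forms in $V_x$ and of the first $k$ 1-forms in $V_y$ over $\phi(S^1)\cap T$ for each $T\in\mathcal{T}$ determine an $\mathcal{O}((\Delta x)^k)$-accurate approximation of $\phi(S^1)$.
   Context: The mesh consists of triangles of maximum diameter $\Delta x$. The setting is that of simple closed planar curves, i.e. $\phi$ is a (sufficiently smooth) embedding of $S^1$ in the plane, and $\phi(S^1)$ is oriented by the parameterization; all integrals are assumed known exactly. General position is meant relative to the mesh. ''Determine'' means that the approximation can be constructed from the mesh and the listed integrals alone. An approximation of $\phi(S^1)$ is $\mathcal{O}((\Delta x)^k)$-accurate if its pointwise distance from $\phi(S^1)$ is $\mathcal{O}((\Delta x)^k)$ as $\Delta x\to0$: e.g. for an approximating curve $\hat\phi$, $\max_s\min_{t\in S^1}\|\phi(t)-\hat\phi(s)\|=\mathcal{O}((\Delta x)^k)$. *)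

(* Defs.v *)
From HB Require Import structures.
From mathcomp Require Import all_boot all_order all_algebra finmap.
From mathcomp Require Import all_classical all_reals all_analysis.

Set Implicit Arguments.
Unset Strict Implicit.
Unset Printing Implicit Defensive.

Import Order.TTheory GRing.Theory Num.Theory.
Import numFieldNormedType.Exports.

Local Open Scope ring_scope.
Local Open Scope classical_set_scope.

Notation plane R := (R * R)%type (only parsing).

Section Plane.
Variable R : realType.
Implicit Types (p q u v : plane R) (A : {fset plane R}) (S : set (plane R)).

(* The canonical norm of R * R is the sup norm, hence an explicit definition. *)
Definition eucl_dist p q : R :=
  Num.sqrt ((p.1 - q.1) ^+ 2 + (p.2 - q.2) ^+ 2).

Definition det2 u v : R := u.1 * v.2 - u.2 * v.1.

Definition diam S : R := sup [set eucl_dist pq.1 pq.2 | pq in S `*` S].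

(* Convex hull of a finite set of points; the hull of fset0 is empty. *)
Definition hull A : set (plane R) :=
  [set p | exists a : plane R -> R,
    [/\ forall v, v \in A -> 0 <= a v,
        \sum_(v <- A) a v = 1
      & p = (\sum_(v <- A) a v * v.1, \sum_(v <- A) a v * v.2)]].

End Plane.

Section Mesh.
Variable R : realType.
Implicit Types (T : {fset plane R}) (M : {fset {fset plane R}}).

(* A triangle is given by its set of vertices; as a region it is [hull T]. *)
Definition is_triangle T : Prop :=
  exists p q r : plane R,
    T = [fset p; q; r]%fset /\ det2 (q - p) (r - p) != 0.

(* Two triangles of a (conforming) mesh meet exactly in the hull of their common
   vertices: nothing, a common vertex or a common edge. *)
Definition is_mesh M : Prop :=
  (forall T, T \in M -> is_triangle T) /\
  (forall T T', T \in M -> T' \in M ->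
     hull T `&` hull T' = hull (T `&` T')%fset).

Definition mesh_size M : R := \big[Num.max/0]_(T <- M) diam (hull T).

End Mesh.

Section Curve.
Variable R : realType.
Implicit Types (phi psi : R -> plane R) (M : {fset {fset plane R}}).

(* Maps from the circle are encoded as maps of period 1 on the line. *)
Definition periodic1 phi : Prop := forall t, phi (t + 1) = phi t.

Definition closed_curve phi : Prop := continuous phi /\ periodic1 phi.

Definition class_C (m : nat) (f : R -> R) : Prop :=
  (forall i t, (i < m)%N -> derivable (f^`(i)) t 1) /\ continuous (f^`(m)).

Definition velocity phi (t : R) : plane R :=
  ((fst \o phi)^`() t, (snd \o phi)^`() t).

Definition smooth_embedding (m : nat) phi : Prop :=
  [/\ periodic1 phi,
      class_C m (fst \o phi) /\ class_C m (snd \o phi),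
      {in `[0, 1[%R &, injective phi}
    & forall t, velocity phi t != 0].

Definition covers_curve M phi : Prop :=
  forall t, exists2 T, T \in M & hull T (phi t).

(* The curve avoids the vertices and is transverse to the edges of the mesh. *)
Definition general_position phi M : Prop :=
  (forall T v t, T \in M -> v \in T -> phi t != v) /\
  (forall T p q t, T \in M -> p \in T -> q \in T -> p != q ->
     hull [fset p; q]%fset (phi t) -> det2 (q - p) (velocity phi t) != 0).

(* Both curves are within e of each other. The first clause is
   max_s min_t |phi t - psi s| <= e; the second one rules out curves psi tracing
   only part of the image of phi, for instance a single point. *)
Definition approximates (e : R) psi phi : Prop :=
  (forall s, exists t, eucl_dist (phi t) (psi s) <= e) /\
  (forall t, exists s, eucl_dist (phi t) (psi s) <= e).

End Curve.

Section Forms.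
Variable R : realType.

(* (P, Q) stands for the 1-form P dx + Q dy. *)
Definition oneform : Type := ((plane R -> R) * (plane R -> R))%type.

Definition fdx (f : plane R -> R) : oneform := (f, fun=> 0).
Definition fdy (f : plane R -> R) : oneform := (fun=> 0, f).

Definition Vx : seq oneform :=
  [:: fdx (fun=> 1); fdy (fun=> 1); fdx (fun p => p.2);
      fdx (fun p => p.1 * p.2); fdx (fun p => p.2 ^+ 2)].

Definition Vy : seq oneform :=
  [:: fdx (fun=> 1); fdy (fun=> 1); fdy (fun p => p.1);
      fdy (fun p => p.1 ^+ 2); fdy (fun p => p.1 * p.2)].

(* Integral of w over the part of the curve phi lying in T. *)
Definition curve_integral (phi : R -> plane R) (T : {fset plane R})
    (w : oneform) : R :=
  \int[@lebesgue_measure R]_(t in [set t | 0 <= t < 1 /\ hull T (phi t)])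
    (w.1 (phi t) * (velocity phi t).1 + w.2 (phi t) * (velocity phi t).2).

(* The data attached to the triangles of M only. *)
Definition mesh_data (k : nat) (phi : R -> plane R) (M : {fset {fset plane R}})
    : M -> seq R * seq R :=
  fun T => ([seq curve_integral phi (val T) w | w <- take k Vx],
            [seq curve_integral phi (val T) w | w <- take k Vy]).

End Forms.

(* Main.v *)
Require Import Defs.
From HB Require Import structures.
From mathcomp Require Import all_boot all_order all_algebra finmap.
From mathcomp Require Import all_classical all_reals all_analysis.
From mathcomp Require Import measurable_realfun ring lra zify.

Set Implicit Arguments.
Unset Strict Implicit.
Unset Printing Implicit Defensive.

Import Order.TTheory GRing.Theory Num.Theory.
Import numFieldNormedType.Exports.

Local Open Scope classical_set_scope.
Local Open Scope ring_scope.

(* The data of the forms dx and dy already determine the curve up to O(h^5), h being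
   the mesh size, among the embeddings whose derivatives, speed and injectivity are
   controlled by a fixed constant N ("tame" below): the reconstruction picks any curve in
   general position with the given data and the smallest possible N. What has to be
   shown is that two tame curves phi, psi with the same data are O(h^5)-close.
   Near a point of phi, both curves are graphs over a coordinate axis. In every window of
   width O(h) the two graphs meet: otherwise one of them lies strictly above the other
   there, and Stokes' formula, applied to a triangle T in two different frames, shows that
   equality of the data forces the strip between the graphs to cover the same fraction
   of each of the three edges of T. If T meets one of the curves, the curve leaves T
   transversally through an edge, so this fraction is neither 0 nor 1; hence every edge of
   T is crossed by one of the curves, and T has a neighbour across every edge, which
   again meets a curve. Among the edges of such triangles that cross a fixed vertical line,
   the highest crossing then yields a higher one, a contradiction.
   Five such meeting points in a window of width O(h) give a polynomial of degree at most
   4 interpolating both graphs, and both are within O(h^5) of it. *)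

(** When [dot w] increases along an arc, its integral over the part of the arc inside [T] is the
    length of a projection, hence a signed sum over the edges of [T] of their portions above the
    arc. Shearing the frame [(u, v)] to [(u + k v, v)] does not change these portions, so the data
    give two linear equations for the same three edge fractions. The edge vectors sum to zero and
    span the plane, so the solutions are the multiples of [(1, 1, 1)]. Two obstacles shape the
    estimates. The data of [T] collect every passage of the curve through [T]: the quantitative
    injectivity in [tame] confines all of them to one short arc. And nothing ties [psi] to [phi]
    beforehand: the forms [2 u + v] and [2 u - v] have positive integrals along [phi], hence along
    [psi], which gives a nearby point of [psi] whose velocity lies in almost the same cone. The
    shear [1 / 4] is small against the slope [2] allowed by that cone. Powers of [N] arise from
    passing between distances in the plane and parameters; every constant depends on [N] alone. *)

Section IncreasingInverse.
Variable R : realType.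
Implicit Types (F G f : R -> R) (a b c t : R).

(** Precomposing the inverse with the clamping [cl] onto [[F a, F b]] makes [G] total and continuous
    on the whole line, hence measurable without restriction to a subspace. *)
Lemma increasing_inverse F a b : a <= b -> continuous F ->
  {in `[a, b] &, {homo F : x y / x < y}} ->
  exists G, [/\ continuous G, forall c, G c \in `[a, b],
    {in `[a, b], cancel F G} & {in `[F a, F b], cancel G F}].
Proof.
move=> ab cF iF.
have mF : {in `[a, b] &, {homo F : x y / x <= y}}.
  by move=> x y xab yab; rewrite le_eqVlt => /predU1P[->//|xy]; exact/ltW/iF.
have aab : a \in `[a, b] by rewrite in_itv/= lexx.
have bab : b \in `[a, b] by rewrite in_itv/= lexx ab.
have FaFb : F a <= F b by exact: mF.
pose cl c := Num.max (F a) (Num.min c (F b)).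
have clP c : cl c \in `[F a, F b].
  by rewrite in_itv/= le_max lexx/= ge_max FaFb/= ge_min lexx orbT.
have clE c : c \in `[F a, F b] -> cl c = c.
  by rewrite in_itv/= => /andP[h1 h2]; rewrite /cl (min_idPl h2) (max_idPr h1).
have ivt c : exists t, t \in `[a, b] /\ F t = cl c.
  have [||t tab Ft] := @IVT R F a b (cl c) ab.
  - exact: continuous_subspaceT.
  - by rewrite (min_idPl FaFb) (max_idPr FaFb); exact: clP.
  by exists t.
have [G GP] := choice ivt.
have FG : {in `[a, b], cancel F G}.
  move=> t tab; have [Gab] := GP (F t).
  rewrite clE; last by move: (tab); rewrite !in_itv/= => /andP[h1 h2]; rewrite !mF.
  move=> e; case: (ltgtP (G (F t)) t) => // h.
    by have := iF _ _ Gab tab h; rewrite e ltxx.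
  by have := iF _ _ tab Gab h; rewrite e ltxx.
exists G; split => //.
- have cG : {within `[F a, F b], continuous G}.
    by apply: segment_can_le_continuous => //; exact: continuous_subspaceT.
  have -> : G = G \o cl.
    apply/funext => c /=; have [Gab FGc] := GP c.
    by rewrite -FGc FG.
  move=> c.
  have ccl : {for c, continuous cl}.
    apply: (@continuous_max _ _ (cst (F a)) (fun c => Num.min c (F b))).
      exact: cvg_cst.
    apply: (@continuous_min _ _ id (cst (F b))); first exact: cvg_id.
    exact: cvg_cst.
  move/subspace_continuousP : cG => /(_ (cl c) (clP c)) h.
  apply: (cvg_comp cl G _ h) => A; rewrite /within/= => nA.
  have : \forall z \near c, (cl z \in `[F a, F b] -> A (cl z)) by exact: ccl _ nA.
  by apply: (@filterS _ (nbhs c)) => z; apply; exact: clP.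
- by move=> c; case: (GP c).
- by move=> c cF'; have [_] := GP c; rewrite clE.
Qed.

End IncreasingInverse.

(** * Change of variables over measurable sets *)

Section Substitution.
Variable R : realType.
Local Notation mu := (@lebesgue_measure R).
Variables (F f G : R -> R) (a b : R).
Hypotheses (ab : a < b) (dF : forall t : R, is_derive t 1 F (f t))
  (cf : continuous f) (f_gt0 : forall t, t \in `[a, b] -> 0 < f t).

Let f_ge0 t : [set` `[a, b]] t -> (0 <= (f t)%:E)%E.
Proof. by move=> tab; rewrite lee_fin ltW// f_gt0. Qed.

Let cF : continuous F.
Proof. by move=> t; apply/differentiable_continuous/derivable1_diffP; have [] := dF t. Qed.

Let mf : measurable_fun [set: R] (fun t => (f t)%:E).
Proof. by apply/measurable_EFinP; exact: continuous_measurable_fun. Qed.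

(** This and [preimage_length] are the two sides of the substitution formula, packaged as measures
    so that uniqueness of measures applies. *)
Definition weighted_length (A : set (measurableTypeR R)) : \bar R :=
  \int[mu]_(t in A `&` `[a, b]) (f t)%:E.

Let wl0 : weighted_length set0 = 0%E.
Proof. by rewrite /weighted_length set0I integral_set0. Qed.

Let wl_ge0 A : (0 <= weighted_length A)%E.
Proof. by apply: integral_ge0 => t [_]; exact: f_ge0. Qed.

Let wl_sigma : semi_sigma_additive weighted_length.
Proof.
move=> A mA tA mUA; rewrite /weighted_length setI_bigcupl ge0_integral_bigcup//=.
- by apply: is_cvg_ereal_nneg_natsum => // n _; exact: wl_ge0.
- by move=> n; apply: measurableI.
- exact: measurable_funTS.
- by move=> t [n _ [_]]; exact: f_ge0.
- by apply/trivIset_setIr.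
Qed.

HB.instance Definition _ := isMeasure.Build _ _ _ weighted_length
  wl0 wl_ge0 wl_sigma.

Lemma derive_gt0_increasing : {in `[a, b] &, {homo F : x y / x < y}}.
Proof.
move=> x y xab yab xy.
have [c cxy] := MVT xy (fun c _ => dF c) (continuous_subspaceT cF).
rewrite -subr_gt0 => ->; rewrite mulr_gt0 ?subr_gt0//; apply: f_gt0.
move: xab yab cxy; rewrite !in_itv/= => /andP[h1 _] /andP[_ h2] /andP[h3 h4].
by rewrite (le_trans h1 (ltW h3)) (le_trans (ltW h4) h2).
Qed.

Lemma integral_derive_itv x y : x <= y -> x \in `[a, b] -> y \in `[a, b] ->
  (\int[mu]_(t in `[x, y]) (f t)%:E = (F y - F x)%:E)%E.
Proof.
rewrite le_eqVlt => /predU1P[->|xy] xab yab.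
  by rewrite set_itv1 integral_set1 subrr.
rewrite (@continuous_FTC2 _ f F)//.
- exact: continuous_subspaceT.
- split=> [z _||].
  + by have [] := dF z.
  + by apply: cvg_at_right_filter; exact: cF.
  + by apply: cvg_at_left_filter; exact: cF.
- by move=> z _; rewrite derive1E; have [] := dF z.
Qed.

Hypotheses (cG : continuous G) (Gab : forall c, G c \in `[a, b])
  (FG : {in `[a, b], cancel F G}) (GF : {in `[F a, F b], cancel G F}).

Let mG : measurable_fun setT G.
Proof. exact: continuous_measurable_fun. Qed.

Definition preimage_length (A : set (measurableTypeR R)) : \bar R :=
  mu (G @^-1` A `&` `[F a, F b]).

Let pl0 : preimage_length set0 = 0%E.
Proof. by rewrite /preimage_length preimage_set0 set0I measure0. Qed.

Let pl_ge0 A : (0 <= preimage_length A)%E.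
Proof. exact: measure_ge0. Qed.

Let pl_sigma : semi_sigma_additive preimage_length.
Proof.
have mGA A : measurable A -> measurable (G @^-1` A `&` `[F a, F b]).
  by move=> mA; apply: measurableI => //; rewrite -[X in measurable X]setTI; exact: mG.
move=> A mA tA mUA; rewrite /preimage_length preimage_bigcup setI_bigcupl.
apply: measure_semi_sigma_additive.
- by move=> n; exact: (mGA (A n) (mA n)).
- apply/trivIset_setIr/trivIsetP => /= i j _ _ ij; rewrite -preimage_setI.
  by move/trivIsetP : tA => /(_ _ _ _ _ ij) ->//; rewrite preimage_set0.
- by rewrite -setI_bigcupl -preimage_bigcup; exact: mGA.
Qed.

HB.instance Definition _ := isMeasure.Build _ _ _ preimage_length
  pl0 pl_ge0 pl_sigma.

(** The parameters at which a curve lies in a triangle are only known to form a measurable set, so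
    the rule for intervals is not enough. Both sides are measures in [A], and they agree on
    half-lines by the fundamental theorem of calculus. *)
Lemma substitution_measurable A : measurable A ->
  (\int[mu]_(t in A `&` `[a, b]) (f t)%:E = mu (G @^-1` A `&` `[F a, F b]))%E.
Proof.
have iF := derive_gt0_increasing.
have aab : a \in `[a, b] by rewrite in_itv/= lexx ltW.
have bab : b \in `[a, b] by rewrite in_itv/= lexx ltW.
(* The half-lines []x, +oo[] generate the Borel sets. Three cases: [x] to the right of [[a, b]], to
   its left, or inside. *)
have m12 B : RGenOInfty.G B -> weighted_length B = preimage_length B.
  move=> [x ->]; rewrite /weighted_length /preimage_length.
  have [bx|xb] := leP b x.
    have -> : `]x, +oo[%classic `&` `[a, b]%classic = set0 :> set R.
      apply/seteqP; split=> t//=; rewrite !in_itv/= andbT => -[xt /andP[_ tb]].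
      by move: (le_lt_trans bx xt); rewrite ltNge tb.
    rewrite integral_set0.
    rewrite (_ : _ `&` _ = set0) ?measure0//.
    apply/seteqP; split=> c//=; rewrite !in_itv/= andbT => -[xt _].
    by have := Gab c; rewrite in_itv/= => /andP[_]; rewrite leNgt (le_lt_trans bx xt).
  have [xa|ax] := ltP x a.
    have -> : `]x, +oo[%classic `&` `[a, b]%classic = `[a, b]%classic :> set R.
      apply/seteqP; split=> t/=; rewrite !in_itv/= andbT; first by case.
      by move=> /andP[h1 h2]; rewrite h1 h2 (lt_le_trans xa h1).
    rewrite integral_derive_itv// ?ltW//.
    rewrite (_ : _ `&` _ = `[F a, F b]%classic).
      by rewrite lebesgue_measure_itv/= lte_fin iF//.
    apply/seteqP; split=> c/=; first by case.
    move=> cab; split => //; rewrite in_itv/= andbT (lt_le_trans xa)//.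
    by have := Gab c; rewrite in_itv/= => /andP[].
  have xab : x \in `[a, b] by rewrite in_itv/= ax ltW.
  have -> : `]x, +oo[%classic `&` `[a, b]%classic = `]x, b]%classic :> set R.
    apply/seteqP; split=> t/=; rewrite !in_itv/= andbT.
      by move=> [-> /andP[_ ->]].
    by move=> /andP[h1 h2]; rewrite h1 h2 (le_trans ax (ltW h1)).
  rewrite integral_itv_obnd_cbnd; last exact: measurable_funTS.
  rewrite integral_derive_itv// ?ltW//.
  rewrite (_ : _ `&` _ = `]F x, F b]%classic).
    by rewrite lebesgue_measure_itv/= lte_fin iF.
  apply/seteqP; split=> c/=; rewrite !in_itv/= andbT.
    move=> [xG /andP[h1 h2]]; rewrite h2 andbT -[ltRHS]GF ?in_itv/= ?h1//.
    exact: iF.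
  move=> /andP[h1 h2]; have Fax : F a <= F x.
    by move: ax; rewrite le_eqVlt => /predU1P[->//|ax]; apply/ltW/iF.
  have cF' : c \in `[F a, F b] by rewrite in_itv/= h2 (le_trans Fax (ltW h1)).
  split; last by rewrite (le_trans Fax (ltW h1)).
  rewrite ltNge; apply/negP; rewrite le_eqVlt => /predU1P[e|Gx].
    by move: h1; rewrite -e GF// ltxx.
  by move: (iF _ _ (Gab c) xab Gx); rewrite GF// ltNge (ltW h1).
move=> mA; rewrite -[LHS]/(weighted_length A) -[RHS]/(preimage_length A).
apply: (@measure_unique _ R (measurableTypeR R) (@RGenOInfty.G R)
  (fun n : nat => `]- n%:R, +oo[%classic)) => //.
- exact: RGenOInfty.measurableE.
- move=> _ _ [x ->] [y ->]; exists (Num.max x y).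
  by apply/seteqP; split=> t/=; rewrite !in_itv/= !andbT gt_max => /andP.
- by move=> n; exists (- n%:R).
- apply/seteqP; split=> // t _; exists (Num.truncn `|t|).+1 => //=.
  rewrite in_itv/= andbT ltrNl (le_lt_trans (ler_norm _))// normrN.
  exact: truncnS_gt.
(* Finiteness on the exhausting half-lines: the total mass is [F b - F a]. *)
- move=> n; pose J : set R := `]- n%:R, +oo[%classic.
  have /le_lt_trans : (weighted_length J <=
    \int[mu]_(t in `[a, b]) (f t)%:E)%E.
    apply: (@ge0_subset_integral _ (measurableTypeR R) R mu) => //.
    + exact: (measurableI _ _ (measurable_itv _) (measurable_itv _)).
    + exact: measurable_funTS.
  by apply; rewrite integral_derive_itv ?ltW// ltry.
Qed.
End Substitution.

(** * Lengths of sets of reals and affine maps *)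

Section Length.
Variable R : realType.
Local Notation mu := (@lebesgue_measure R).
Implicit Types (A B : set R) (f g : R -> R) (x y : R).

(** [fine] sends an infinite measure to [0], whence the boundedness required for additivity and
    monotonicity. *)
Definition length_of A : R := fine (mu A).

Definition bounded_measurable A :=
  measurable A /\ exists x y, A `<=` `[x, y]%classic.

Lemma bounded_measurable_fin A : bounded_measurable A -> mu A \is a fin_num.
Proof.
move=> [mA [x [y Axy]]]; rewrite ge0_fin_numE//.
apply: (@le_lt_trans _ _ (mu `[x, y]%classic)).
  by apply: le_measure => //; rewrite inE.
by rewrite lebesgue_measure_itv/=; case: ifP => _; rewrite ltry.
Qed.

Lemma length_ofU A B : bounded_measurable A -> bounded_measurable B ->
  A `&` B = set0 -> length_of (A `|` B) = length_of A + length_of B.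
Proof.
move=> bA bB AB0; have [mA _] := bA; have [mB _] := bB.
by rewrite /length_of measureU// fineD// bounded_measurable_fin.
Qed.

Lemma le_length_of A B : measurable A -> bounded_measurable B -> A `<=` B ->
  length_of A <= length_of B.
Proof.
move=> mA [mB [x [y Bxy]]] AB; rewrite fine_le ?bounded_measurable_fin//.
- by split=> //; exists x, y; apply: subset_trans AB Bxy.
- by split=> //; exists x, y.
- by apply: le_measure => //; rewrite inE.
Qed.

Lemma sub_bounded_measurable A B : measurable A -> bounded_measurable B ->
  A `<=` B -> bounded_measurable A.
Proof.
by move=> mA [_ [x [y Bxy]]] AB; split => //; exists x, y; apply: subset_trans Bxy.
Qed.

Lemma length_ofD A B : measurable A -> bounded_measurable B -> A `<=` B ->
  length_of (B `\` A) = length_of B - length_of A.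
Proof.
move=> mA bB AB; have [mB [x [y Bxy]]] := bB.
have bA : bounded_measurable A by exact: sub_bounded_measurable bB AB.
have bD : bounded_measurable (B `\` A).
  by apply: sub_bounded_measurable bB _; [exact: measurableD|move=> ? []].
rewrite -[in RHS](setDUK AB) length_ofU//; last by rewrite setIC setDKI.
by rewrite addrC addKr.
Qed.

Lemma length_of_itv x y b1 b2 : x <= y ->
  length_of [set` Interval (BSide b1 x) (BSide b2 y)] = y - x.
Proof.
rewrite /length_of lebesgue_measure_itv/= lte_fin.
by case: ltgtP => //= ->; rewrite subrr.
Qed.

Lemma bounded_measurable_itv x y b1 b2 :
  bounded_measurable [set` Interval (BSide b1 x) (BSide b2 y)].
Proof.
split=> //; exists x, y => z/=; rewrite !itv_boundlr.
case: b1; case: b2; rewrite /= !bnd_simp => /andP[h1 h2]; rewrite ?h1 ?h2 ?(ltW h1) ?(ltW h2)//.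
Qed.

Lemma bounded_measurableI A B : bounded_measurable A -> measurable B ->
  bounded_measurable (A `&` B).
Proof.
move=> bA mB; have [mA _] := bA.
by apply: (sub_bounded_measurable _ bA); [exact: measurableI|move=> ? []].
Qed.

Lemma length_of_null A N : mu N = 0%E -> measurable N -> measurable A ->
  length_of (A `\` N) = length_of A.
Proof.
move=> N0 mN mA; rewrite /length_of; congr fine.
have N1 : mu (A `&` N) = 0%E.
  by apply: (subset_measure0 _ mN _ N0) => //; exact: measurableI.
have e : mu A = (mu (A `&` N) + mu (A `\` N))%E.
  rewrite -[in LHS](setUIDK A N); apply: measureU.
  - exact: measurableI.
  - exact: measurableD.
  - by rewrite setDE setIACA setICr !setI0.
by rewrite e N1 add0e.
Qed.

Lemma length_of_eqnull A B N : mu N = 0%E -> measurable N -> measurable A ->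
  measurable B -> A `\` N = B `\` N -> length_of A = length_of B.
Proof.
by move=> N0 mN mA mB AB; rewrite -(length_of_null N0 mN mA) AB length_of_null.
Qed.

Lemma measurable_lt f g : continuous f -> continuous g ->
  measurable [set c | f c < g c].
Proof.
move=> cf cg; apply: open_measurable.
rewrite (_ : [set _ | _] = (g \- f) @^-1` [set x | 0 < x]).
  by apply: open_comp => [c _|]; [apply: continuousB; [exact: cg|exact: cf]|exact: open_gt].
by apply/seteqP; split=> c /=; rewrite subr_gt0.
Qed.

Lemma measurable_le f g : continuous f -> continuous g ->
  measurable [set c | f c <= g c].
Proof.
move=> cf cg; rewrite (_ : [set _ | _] = ~` [set c | g c < f c]).
  by apply: measurableC; exact: measurable_lt.
by apply/seteqP; split=> c /=; rewrite leNgt => /negP.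
Qed.

Lemma measurable_affine (e k : R) :
  measurable_fun [set: measurableTypeR R]
    (fun t : measurableTypeR R => e * t + k : measurableTypeR R).
Proof.
apply: continuous_measurable_fun => t; apply: cvgD; last exact: cvg_cst.
by apply: cvgM; [exact: cvg_cst|exact: cvg_id].
Qed.

Lemma measurable_affine_preimage (e k : R) A : measurable A ->
  measurable [set t | A (e * t + k)].
Proof. by move=> mA; rewrite -[X in measurable X]setTI; exact: measurable_affine. Qed.

(** By uniqueness of Lebesgue measure: [|e|] times the image measure under the affine map gives each
    half-open interval its length. *)
Lemma lebesgue_affine (e k : R) A : e != 0 -> measurable A ->
  mu [set t | A (e * t + k)] = ((`|e|^-1)%:E * mu A)%E.
Proof.
move=> e0 mA; have E0 : 0 < `|e| by rewrite normr_gt0.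
have -> : mu A = (`|e|%:E * mu [set t | A (e * t + k)%R])%E; last first.
  by rewrite muleA -EFinM mulVf ?gt_eqF// mul1e.
have mF := measurable_affine e k.
pose push : {measure set (measurableTypeR R) -> \bar R} :=
  pushforward mu (fun t : measurableTypeR R => e * t + k : measurableTypeR R).
pose nu : {measure set (measurableTypeR R) -> \bar R} :=
  mscale (NngNum (normr_ge0 e)) (push mF).
rewrite -[RHS]/(nu A); apply: lebesgue_measure_unique => // _ [[x y] _ <-].
rewrite -[RHS]/(`|e|%:E * mu [set t | `]x, y]%classic (e * t + k)%R])%E.
have [eL|eG] := ltP e 0.
  rewrite [X in (_ * mu X)%E](_ : _ = `[(y - k) / e, (x - k) / e[%classic); last first.
    apply/seteqP; split=> t /=; rewrite !in_itv/= ler_ndivrMr// ltr_ndivlMr// => /andP[h1 h2];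
      apply/andP; split; lra.
  rewrite !lebesgue_measure_itv/= !lte_fin ltr_ndivrMr// divfK// ltrD2r.
  case: ifP => _; rewrite ?mule0// -EFinB -EFinM (ltr0_norm eL).
  by congr EFin; field.
have {}eG : 0 < e by rewrite lt_neqAle eq_sym e0.
rewrite [X in (_ * mu X)%E](_ : _ = `](x - k) / e, (y - k) / e]%classic); last first.
  apply/seteqP; split=> t /=; rewrite !in_itv/= ltr_pdivrMr// ler_pdivlMr// => /andP[h1 h2];
    apply/andP; split; lra.
rewrite !lebesgue_measure_itv/= !lte_fin ltr_pdivrMr// divfK// ltrD2r.
case: ifP => _; rewrite ?mule0// -EFinB -EFinM (gtr0_norm eG).
by congr EFin; field.
Qed.

Lemma length_of_affine x y A : x < y -> measurable A ->
  length_of (`]x, y[%classic `&` [set c | A ((c - x) / (y - x))]) =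
  (y - x) * length_of (`[0, 1]%classic `&` A).
Proof.
move=> xy mA; have yx0 : 0 < y - x by rewrite subr_gt0.
have m01 b1 b2 : bounded_measurable ([set` Interval (BSide b1 (0 : R)) (BSide b2 1)] `&` A).
  by apply: bounded_measurableI => //; exact: bounded_measurable_itv.
have -> : length_of (`[0, 1]%classic `&` A) = length_of (`]0, 1[%classic `&` A).
  apply: (length_of_eqnull (N := [set 0; 1])).
  - exact/countable_lebesgue_measure0/finite_set_countable/finite_set2.
  - exact: measurableU.
  - exact: (m01 _ _).1.
  - exact: (m01 _ _).1.
  apply/seteqP; split=> c /=; rewrite !in_itv/=.
    move=> [[/andP[h1 h2] Ac] /not_orP[/eqP c0 /eqP c1]]; split;
      last by move=> [/eqP|/eqP]; exact/negP.
    by rewrite !lt_neqAle h1 h2 c1 eq_sym c0.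
  by move=> [[/andP[/ltW -> /ltW ->]]].
rewrite /length_of -[RHS]/(fine (y - x)%:E * _) -fineM ?bounded_measurable_fin//.
have d0 : (y - x)^-1 != 0 by rewrite invr_eq0 gt_eqF.
have := lebesgue_affine (- x / (y - x)) d0 (m01 false true).1.
rewrite ger0_norm ?invr_ge0 ?(ltW yx0)// invrK => <-; congr (fine (mu _)).
have E c : (c - x) / (y - x) = (y - x)^-1 * c + - x / (y - x) by ring.
apply/seteqP; split => c /=; rewrite !in_itv/= -E => -[/andP[h1 h2] Ac]; split => //.
  by rewrite divr_gt0 ?subr_gt0// ltr_pdivrMr// mul1r ltrD2r.
move: h1 h2; rewrite pmulr_lgt0 ?invr_gt0// subr_gt0 => ->.
by rewrite ltr_pdivrMr// mul1r ltrD2r.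
Qed.

Lemma length_of_reflect A : measurable A ->
  length_of (`[0, 1]%classic `&` [set c | A (1 - c)]) =
  length_of (`[0, 1]%classic `&` A).
Proof.
move=> mA; have N0 : (-1 : R) != 0 by rewrite oppr_eq0 oner_neq0.
have := lebesgue_affine 1 N0 (measurableI _ _ (measurable_itv `[0, 1]) mA).
rewrite normrN1 invr1 mul1e /length_of => <-; congr (fine (mu _)).
apply/seteqP; split=> c /=; rewrite (_ : -1 * c + 1 = 1 - c) ?[_ + 1]addrC ?mulN1r//;
  rewrite !in_itv/= => -[/andP[h1 h2] Ac]; split => //; apply/andP; split; lra.
Qed.

End Length.

(** * Triangles, edges and Stokes' formula for a graph *)

Section Triangle.
Variable R : realType.
Implicit Types (p q r z : plane R) (f : R -> R) (c l : R).

Definition tri p q r : set (plane R) := [set z | exists a b c : R,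
  [/\ 0 <= a, 0 <= b, 0 <= c, a + b + c = 1 &
    z = (a * p.1 + b * q.1 + c * r.1, a * p.2 + b * q.2 + c * r.2)]].

Definition seg p q l : plane R :=
  (p.1 + l * (q.1 - p.1), p.2 + l * (q.2 - p.2)).

Lemma det2E p q r z : det2 (q - p) (z - r) =
  (q.1 - p.1) * (z.2 - r.2) - (q.2 - p.2) * (z.1 - r.1).
Proof. by []. Qed.

(** Twice the signed area of the triangle; for fixed [p] and [q], an affine function of [r]
    vanishing on the line [p q]. *)
Definition orient p q r : R := det2 (q - p) (r - p).

(** Divided by [orient p q r], the three determinants are the barycentric coordinates of [z].
    Multiplying instead of dividing gives the same signs for either orientation. *)
Lemma tri_det p q r z : orient p q r != 0 -> tri p q r z <->
  [/\ 0 <= orient p q r * orient p q z, 0 <= orient p q r * orient q r z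
    & 0 <= orient p q r * orient r p z].
Proof.
rewrite /orient !det2E => D0; split.
  move=> [a [b [c [a0 b0 c0 abc ->]]]] /=.
  have -> : a = 1 - b - c by lra.
  set D := (X in X != 0) in D0; have D2 : 0 <= D ^+ 2 by exact: sqr_ge0.
  split.
  - rewrite (_ : _ * _ = D ^+ 2 * c); first exact: mulr_ge0.
    by rewrite /D; ring.
  - rewrite (_ : _ * _ = D ^+ 2 * (1 - b - c)); first by apply: mulr_ge0 => //; lra.
    by rewrite /D; ring.
  - rewrite (_ : _ * _ = D ^+ 2 * b); first exact: mulr_ge0.
    by rewrite /D; ring.
set D := (X in X != 0) in D0 *.
move=> [hA hB hC].
have D2 : 0 < D ^+ 2 by rewrite exprn_even_gt0.
have pos X : 0 <= D * X -> 0 <= X / D.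
  move=> h; rewrite (_ : X / D = (D * X) / D ^+ 2); last by field.
  by rewrite divr_ge0 // ltW.
have {}hA := pos _ hA; have {}hB := pos _ hB; have {}hC := pos _ hC.
eexists; eexists; eexists; split; [exact: hB|exact: hC|exact: hA| |].
  by rewrite /D; field.
by rewrite [z in LHS]surjective_pairing; congr pair; rewrite /D; field.
Qed.

(** The line [p q] as a graph over the first coordinate; for a vertical line, division by zero makes
    it the constant [p.2]. *)
Definition line p q c := p.2 + (c - p.1) / (q.1 - p.1) * (q.2 - p.2).

Lemma seg_line p q c : p.1 != q.1 ->
  seg p q ((c - p.1) / (q.1 - p.1)) = (c, line p q c).
Proof. by move=> pq; congr pair => //=; field; rewrite subr_eq0 eq_sym. Qed.

Lemma orient_line p q z : p.1 != q.1 ->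
  orient p q z = (q.1 - p.1) * (z.2 - line p q z.1).
Proof.
by move=> pq; rewrite /orient det2E /line; field; rewrite subr_eq0 eq_sym.
Qed.

Lemma continuous_line p q : continuous (line p q).
Proof.
move=> c; apply: cvgD; first exact: cvg_cst.
apply: cvgM; last exact: cvg_cst.
by apply: cvgM; [apply: cvgB; [exact: cvg_id|exact: cvg_cst]|exact: cvg_cst].
Qed.

(** The proportion is measured in the edge parameter [l], which linear maps preserve and which also
    handles vertical edges. *)
Definition above f p q : R :=
  length_of (`[0, 1]%classic `&` [set l | f (seg p q l).1 < (seg p q l).2]).

Definition crossing f p q : set R :=
  [set c | exists2 l, 0 <= l <= 1 & seg p q l = (c, f c)].

Lemma seg_sym p q l : seg p q (1 - l) = seg q p l.
Proof. by congr pair => /=; ring. Qed.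

Lemma crossing_sym f p q : crossing f p q = crossing f q p.
Proof.
apply/seteqP; split => c [l l01 e]; exists (1 - l); rewrite ?seg_sym//; lra.
Qed.

Lemma continuous_seg1 p q : continuous (fun l => (seg p q l).1).
Proof.
move=> c; apply: cvgD; first exact: cvg_cst.
by apply: cvgM; [exact: cvg_id|exact: cvg_cst].
Qed.

Lemma continuous_seg2 p q : continuous (fun l => (seg p q l).2).
Proof.
move=> c; apply: cvgD; first exact: cvg_cst.
by apply: cvgM; [exact: cvg_id|exact: cvg_cst].
Qed.

Lemma measurable_above f p q : continuous f ->
  measurable [set l | f (seg p q l).1 < (seg p q l).2].
Proof.
move=> cf; apply: measurable_lt; last exact: continuous_seg2.
by move=> c; apply: continuous_comp; [exact: continuous_seg1|exact: cf].
Qed.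

Lemma above_sym f p q : continuous f -> above f p q = above f q p.
Proof.
move=> cf; rewrite /above -length_of_reflect; last exact: measurable_above.
by congr (length_of (_ `&` _)); apply/funext => l /=; congr (is_true (f _ < _)); ring.
Qed.

(** Affine change of variable from the edge parameter to the abscissa; for a vertical edge both
    sides are [0]. *)
Lemma length_below_line f p q : continuous f -> p.1 <= q.1 ->
  length_of (`]p.1, q.1[%classic `&` [set c | f c < line p q c]) =
  (q.1 - p.1) * above f p q.
Proof.
move=> cf; rewrite le_eqVlt => /predU1P[->|pq].
  by rewrite set_itvoo0 set0I subrr mul0r /length_of measure0.
rewrite /above -length_of_affine//; last exact: measurable_above.
congr (length_of (_ `&` _)); apply/funext => c.
by have := seg_line c (negbT (lt_eqF pq)); rewrite /mkset => ->.
Qed.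

(** The set on the left is the difference of [f <= hi] and [f < lo]; the countable set where
    [f = hi] is negligible, so [<=] may become [<]. *)
Lemma length_between f lo hi x y : continuous f -> continuous lo ->
  continuous hi -> (forall c, x < c < y -> lo c <= hi c) ->
  countable [set c | x < c < y /\ f c = hi c] ->
  length_of (`]x, y[%classic `&` [set c | lo c <= f c <= hi c]) =
  length_of (`]x, y[%classic `&` [set c | f c < hi c]) -
  length_of (`]x, y[%classic `&` [set c | f c < lo c]).
Proof.
move=> cf clo chi lohi cN.
have mlt := measurable_lt cf; have mle := measurable_le cf.
have bI : bounded_measurable `]x, y[%classic by exact: bounded_measurable_itv.
have eqN : [set c | x < c < y /\ f c = hi c] =
    `]x, y[%classic `&` ([set c | f c <= hi c] `\` [set c | f c < hi c]).
  apply/seteqP; split => c /=; rewrite in_itv/=.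
    by move=> [h e]; rewrite e ltxx; split.
  move=> [h [h1 h2]]; split => //; apply/eqP; rewrite eq_le h1/= leNgt.
  exact/negP.
rewrite -length_ofD; last 3 first.
- by apply: measurableI => //; exact: mlt.
- by apply: bounded_measurableI => //; exact: mlt.
- move=> c [] /=; rewrite in_itv/= => h fl; split => //.
  exact: lt_le_trans fl (lohi _ h).
apply: (@length_of_eqnull _ _ _ [set c | x < c < y /\ f c = hi c]).
- exact: countable_lebesgue_measure0.
- rewrite eqN; apply: measurableI => //.
  by apply: measurableD; [exact: mle|exact: mlt].
- apply: measurableI => //.
  rewrite (_ : [set c | _] = [set c | lo c <= f c] `&` [set c | f c <= hi c]).
    by apply: measurableI; apply: measurable_le.
  by apply/seteqP; split => c /=; [move/andP|move=> [-> ->]].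
- by apply: measurableD; apply: measurableI => //; exact: mlt.
apply/seteqP; split => c /=; rewrite !in_itv/=.
- move=> [[h /andP[h1 h2]] h3]; split=> //; split.
    by split=> //; rewrite lt_neqAle h2 andbT; apply/eqP => e; exact: h3.
  by move=> [_]; rewrite ltNge h1.
- move=> [[[h h1] h2] h3]; split => //; split => //.
  by rewrite (ltW h1) andbT leNgt; apply/negP => h4; exact: h2.
Qed.

Lemma line_sym p q c : p.1 != q.1 -> line p q c = line q p c.
Proof.
move=> pq; rewrite /line; field.
by rewrite !subr_eq0 pq eq_sym pq.
Qed.

Lemma line_diff_left p q r c : p.1 < q.1 -> p.1 < r.1 ->
  line p q c - line p r c =
  - orient p q r * ((c - p.1) / ((q.1 - p.1) * (r.1 - p.1))).
Proof.
move=> pq pr; rewrite /line /orient det2E; field.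
by rewrite !subr_eq0 !(gt_eqF pq) !(gt_eqF pr).
Qed.

Lemma line_diff_right p q r c : q.1 < r.1 -> p.1 < r.1 ->
  line q r c - line p r c =
  - orient p q r * ((r.1 - c) / ((r.1 - q.1) * (r.1 - p.1))).
Proof.
move=> qr pr; rewrite /line /orient det2E; field.
by rewrite !subr_eq0 !(gt_eqF qr) !(gt_eqF pr).
Qed.

(** To the left of the middle vertex the edge [q r] adds no constraint: a linear relation between
    the determinants deduces its inequality from the other two. The sign of [- orient p q r] tells
    whether [q] is above or below the edge [p r]. *)
Lemma tri_left p q r z : p.1 <= q.1 -> q.1 <= r.1 -> orient p q r != 0 ->
  p.1 < z.1 < q.1 -> tri p q r z <->
  0 <= - orient p q r * (line p q z.1 - z.2) /\
  0 <= - orient p q r * (z.2 - line p r z.1).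
Proof.
move=> pq qr D0 /andP[pz zq]; have {}pq := lt_trans pz zq.
have pr := lt_le_trans pq qr.
rewrite tri_det//.
have e1 : orient p q z = - (q.1 - p.1) * (line p q z.1 - z.2).
  by rewrite orient_line ?lt_eqF//; ring.
have e2 : orient r p z = - (r.1 - p.1) * (z.2 - line p r z.1).
  by rewrite orient_line ?gt_eqF// (@line_sym r p) ?gt_eqF//; ring.
have e3 : orient p q r * (q.1 - z.1) =
    orient q r z * (q.1 - p.1) + orient p q z * (q.1 - r.1).
  by rewrite /orient !det2E; ring.
have qp0 : 0 < q.1 - p.1 by rewrite subr_gt0.
have rp0 : 0 < r.1 - p.1 by rewrite subr_gt0.
have E1 : (0 <= orient p q r * orient p q z) =
    (0 <= - orient p q r * (line p q z.1 - z.2)).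
  rewrite e1 (_ : _ * _ = (q.1 - p.1) * (- orient p q r * (line p q z.1 - z.2))).
    by rewrite pmulr_rge0.
  by ring.
have E2 : (0 <= orient p q r * orient r p z) =
    (0 <= - orient p q r * (z.2 - line p r z.1)).
  rewrite e2 (_ : _ * _ = (r.1 - p.1) * (- orient p q r * (z.2 - line p r z.1))).
    by rewrite pmulr_rge0.
  by ring.
rewrite E1 E2; split => [[? _ ?]//|[h1 h2]]; split => //.
have h3 : 0 <= orient p q r * orient q r z * (q.1 - p.1).
  rewrite (_ : _ * _ * _ = orient p q r * (orient p q r * (q.1 - z.1))
    + orient p q r * orient p q z * (r.1 - q.1)); last by rewrite e3; ring.
  rewrite addr_ge0//; last by rewrite mulr_ge0 ?E1// subr_ge0.
  by rewrite mulrA mulr_ge0 ?subr_ge0 ?(ltW zq)// -expr2 sqr_ge0.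
by rewrite pmulr_lge0 in h3.
Qed.

Lemma tri_right p q r z : p.1 <= q.1 -> q.1 <= r.1 -> orient p q r != 0 ->
  q.1 < z.1 < r.1 -> tri p q r z <->
  0 <= - orient p q r * (line q r z.1 - z.2) /\
  0 <= - orient p q r * (z.2 - line p r z.1).
Proof.
move=> pq qr D0 /andP[qz zr]; have {}qr := lt_trans qz zr.
have pr := le_lt_trans pq qr.
rewrite tri_det//.
have e1 : orient q r z = - (r.1 - q.1) * (line q r z.1 - z.2).
  by rewrite orient_line ?lt_eqF//; ring.
have e2 : orient r p z = - (r.1 - p.1) * (z.2 - line p r z.1).
  by rewrite orient_line ?gt_eqF// (@line_sym r p) ?gt_eqF//; ring.
have e3 : orient p q r * (z.1 - q.1) =
    orient q r z * (p.1 - q.1) + orient p q z * (r.1 - q.1).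
  by rewrite /orient !det2E; ring.
have rq0 : 0 < r.1 - q.1 by rewrite subr_gt0.
have rp0 : 0 < r.1 - p.1 by rewrite subr_gt0.
have E1 : (0 <= orient p q r * orient q r z) =
    (0 <= - orient p q r * (line q r z.1 - z.2)).
  rewrite e1 (_ : _ * _ = (r.1 - q.1) * (- orient p q r * (line q r z.1 - z.2))).
    by rewrite pmulr_rge0.
  by ring.
have E2 : (0 <= orient p q r * orient r p z) =
    (0 <= - orient p q r * (z.2 - line p r z.1)).
  rewrite e2 (_ : _ * _ = (r.1 - p.1) * (- orient p q r * (z.2 - line p r z.1))).
    by rewrite pmulr_rge0.
  by ring.
rewrite E1 E2; split => [[_ ? ?]//|[h1 h2]]; split => //.
have h3 : 0 <= orient p q r * orient p q z * (r.1 - q.1).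
  rewrite (_ : _ * _ * _ = orient p q r * (orient p q r * (z.1 - q.1))
    + orient p q r * orient q r z * (q.1 - p.1)); last by rewrite e3; ring.
  rewrite addr_ge0//; last by rewrite mulr_ge0 ?E1// subr_ge0.
  by rewrite mulrA mulr_ge0 ?subr_ge0 ?(ltW qz)// -expr2 sqr_ge0.
by rewrite pmulr_lge0 in h3.
Qed.

(** Common to both halves of a sorted triangle, with [L] the short edge. The orientation decides
    which of [L] and [line p r] is the upper bound, so both coincidence sets have to be
    countable. *)
Lemma length_piece f p q r x y (L : R -> R) (S : set R) :
  continuous f -> continuous L -> p.1 != r.1 -> orient p q r != 0 ->
  (forall c, x < c < y -> S c <-> 0 <= - orient p q r * (L c - f c) /\
    0 <= - orient p q r * (f c - line p r c)) ->
  (forall c, x < c < y -> 0 <= - orient p q r * (L c - line p r c)) ->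
  countable [set c | x < c < y /\ f c = L c] ->
  countable [set c | x < c < y /\ f c = line p r c] ->
  length_of (`]x, y[%classic `&` S) = - Num.sg (orient p q r) *
    (length_of (`]x, y[%classic `&` [set c | f c < L c])
     - length_of (`]x, y[%classic `&` [set c | f c < line p r c])).
Proof.
move=> cf cL pr D0 HS Hlohi N1 N2.
have pos X : (0 < X -> (forall Y : R, (0 <= X * Y) = (0 <= Y))).
  by move=> X0 Y; rewrite pmulr_rge0.
have [D_lt0|D_gt0|D_eq0] := ltgtP (orient p q r) 0; last by rewrite D_eq0 eqxx in D0.
  have ND : 0 < - orient p q r by rewrite oppr_gt0.
  rewrite ltr0_sg// opprK mul1r -length_between//.
  - congr length_of; apply/seteqP; split => c /= []; rewrite in_itv/= => xy.
      by move/(HS _ xy); rewrite !pos// !subr_ge0 => -[-> ->].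
    move=> /andP[h1 h2]; split => //; apply/(HS _ xy).
    by rewrite !pos// !subr_ge0.
  - exact: continuous_line.
  - by move=> c /Hlohi; rewrite pos// subr_ge0.
have Dp X Y : (0 <= - orient p q r * (X - Y)) = (0 <= Y - X).
  by rewrite mulNr -mulrN opprB pos.
rewrite gtr0_sg// mulN1r opprB -length_between//.
- congr length_of; apply/seteqP; split => c /= []; rewrite in_itv/= => xy.
    by move/(HS _ xy); rewrite !Dp// !subr_ge0 => -[-> ->].
  move=> /andP[h1 h2]; split => //; apply/(HS _ xy).
  by rewrite !Dp// !subr_ge0.
- exact: continuous_line.
- by move=> c /Hlohi; rewrite Dp// subr_ge0.
Qed.

Lemma crossing_line f p q x y : p.1 < q.1 -> p.1 <= x -> y <= q.1 ->
  countable (crossing f p q) -> countable [set c | x < c < y /\ f c = line p q c].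
Proof.
move=> pq px yq; apply: sub_countable; apply: subset_card_le => c /= [/andP[xc cy] e].
exists ((c - p.1) / (q.1 - p.1)); last by rewrite seg_line ?lt_eqF// e.
have qp0 : 0 < q.1 - p.1 by rewrite subr_gt0.
rewrite divr_ge0 ?subr_ge0 ?(ltW pq) ?(le_trans px (ltW xc))//=.
by rewrite ler_pdivrMr// mul1r lerB// (le_trans (ltW cy) yq).
Qed.

Lemma bounded_measurable_tri f p q r : continuous f ->
  p.1 <= q.1 -> q.1 <= r.1 -> orient p q r != 0 ->
  bounded_measurable [set c | tri p q r (c, f c)].
Proof.
move=> cf pq qr D0; split; last first.
  exists p.1, r.1 => c /= [x [y [z [x0 y0 z0 xyz [-> _]]]]].
  have -> : x = 1 - y - z by lra.
  rewrite in_itv/=; apply/andP; split; nra.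
pose g p' q' c := orient p q r * orient p' q' (c, f c).
have cg p' q' : continuous (g p' q').
  move=> c; apply: cvgM; first exact: cvg_cst.
  rewrite /orient /det2 /=; apply: cvgB.
    by apply: cvgM; [exact: cvg_cst|apply: cvgB; [exact: cf|exact: cvg_cst]].
  by apply: cvgM; [exact: cvg_cst|apply: cvgB; [exact: cvg_id|exact: cvg_cst]].
rewrite (_ : [set c | _] = [set c | 0 <= g p q c] `&` [set c | 0 <= g q r c]
    `&` [set c | 0 <= g r p c]).
  have m p' q' : measurable [set c | 0 <= g p' q' c].
    by apply: (@measurable_le _ (cst 0)) => // c; exact: cvg_cst.
  by apply: measurableI => //; apply: measurableI.
apply/seteqP; split => c.
  by move/(tri_det _ D0) => -[h1 h2 h3]; split; [split|].
by move=> [[h1 h2] h3]; apply/(tri_det _ D0).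
Qed.

Lemma tri_length_sorted f p q r : continuous f ->
  p.1 <= q.1 -> q.1 <= r.1 -> orient p q r != 0 ->
  countable (crossing f p q) -> countable (crossing f q r) ->
  countable (crossing f p r) ->
  length_of [set c | tri p q r (c, f c)] = - Num.sg (orient p q r) *
    ((q.1 - p.1) * above f p q + (r.1 - q.1) * above f q r
     - (r.1 - p.1) * above f p r).
Proof.
move=> cf pq qr D0 Npq Nqr Npr.
have pr : p.1 < r.1.
  rewrite lt_neqAle (le_trans pq qr) andbT; apply: contra D0 => /eqP pr.
  rewrite /orient det2E; have -> : q.1 = p.1 by apply/eqP; rewrite eq_le pq pr qr.
  by rewrite pr !subrr mulr0 mul0r subrr.
set S := [set c | _].
have [mS _] := bounded_measurable_tri cf pq qr D0; rewrite -/S in mS.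
have bI x y : bounded_measurable `]x, y[%classic by exact: bounded_measurable_itv.
have disj A B : (`]p.1, q.1[%classic `&` A) `&` (`]q.1, r.1[%classic `&` B) = set0 :> set R.
  apply/seteqP; split => // c /= [[]]; rewrite !in_itv/= => /andP[_ cq] _ [/andP[qc _] _].
  by move: (lt_trans cq qc); rewrite ltxx.
(* The abscissas of the three vertices are negligible, so open intervals suffice. *)
pose N : set R := [set p.1; q.1; r.1].
have mN : measurable N by apply: measurableU => //; exact: measurableU.
have N0 : lebesgue_measure N = 0%E.
  by apply: countable_lebesgue_measure0; apply: finite_set_countable;
    rewrite !finite_setU; split; [split|]; exact: finite_set1.
have split_len A : measurable A -> A `<=` `[p.1, r.1]%classic ->
    length_of A = length_of (`]p.1, q.1[%classic `&` A) +
                  length_of (`]q.1, r.1[%classic `&` A).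
  move=> mA Apr; rewrite -length_ofU//; try exact: bounded_measurableI.
  apply: (@length_of_eqnull _ _ _ N) => //.
    by apply: measurableU; exact: measurableI.
  apply/seteqP; split => c /= [h cN]; split => //; last by case: h => -[].
  have := Apr _ h; rewrite /= !in_itv/= => /andP[pc cr].
  have [cp [cq cr']] : c != p.1 /\ c != q.1 /\ c != r.1.
    by split; [|split]; apply/eqP => e; apply: cN; rewrite e; [left; left|left; right|right].
  have [cltq|qltc|e] := ltgtP c q.1; last by rewrite e eqxx in cq.
    by left; rewrite lt_neqAle eq_sym cp pc.
  by right; rewrite (lt_neqAle c) cr' cr.
rewrite (split_len S)//; last first.
  have [_ _] := bounded_measurable_tri cf pq qr D0.
  move=> c [x [y [z [x0 y0 z0 xyz [-> _]]]]] /=.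
  have -> : x = 1 - y - z by lra.
  rewrite in_itv/=; apply/andP; split; nra.
have ND c : - orient p q r * (- orient p q r * c) = orient p q r ^+ 2 * c.
  by ring.
have r1 : length_of (`]p.1, q.1[%classic `&` S) = - Num.sg (orient p q r) *
    (length_of (`]p.1, q.1[%classic `&` [set c | f c < line p q c])
     - length_of (`]p.1, q.1[%classic `&` [set c | f c < line p r c])).
  move: pq; rewrite le_eqVlt => /predU1P[->|pq].
    by rewrite set_itvoo0 !set0I subrr mulr0 /length_of measure0.
  apply: length_piece => //.
  - exact: continuous_line.
  - by rewrite lt_eqF.
  - by move=> c h; exact: (@tri_left p q r (c, f c) (ltW pq) qr D0 h).
  - move=> c /andP[pc _]; rewrite line_diff_left// ND.
    by rewrite mulr_ge0 ?sqr_ge0// divr_ge0 ?mulr_ge0 ?subr_ge0// ?ltW.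
  - exact: crossing_line.
  - exact: crossing_line.
have r2 : length_of (`]q.1, r.1[%classic `&` S) = - Num.sg (orient p q r) *
    (length_of (`]q.1, r.1[%classic `&` [set c | f c < line q r c])
     - length_of (`]q.1, r.1[%classic `&` [set c | f c < line p r c])).
  move: qr; rewrite le_eqVlt => /predU1P[->|qr].
    by rewrite set_itvoo0 !set0I subrr mulr0 /length_of measure0.
  apply: length_piece => //.
  - exact: continuous_line.
  - by rewrite lt_eqF.
  - by move=> c h; exact: (@tri_right p q r (c, f c) pq (ltW qr) D0 h).
  - move=> c /andP[_ cr]; rewrite line_diff_right// ND.
    by rewrite mulr_ge0 ?sqr_ge0// divr_ge0 ?mulr_ge0 ?subr_ge0// ?ltW.
  - exact: crossing_line.
  - exact: crossing_line.
rewrite r1 r2 -!length_below_line// ?ltW//.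
set A := `]p.1, r.1[%classic `&` _.
have mA : measurable A.
  by apply: measurableI => //; apply: measurable_lt => //; exact: continuous_line.
rewrite (split_len A)//; last first.
  by move=> c [/=]; rewrite !in_itv/= => /andP[h1 h2] _; rewrite !ltW.
have -> : `]p.1, q.1[%classic `&` A =
    `]p.1, q.1[%classic `&` [set c | f c < line p r c].
  rewrite setIA; congr (_ `&` _); apply/seteqP; split => c /=; rewrite !in_itv/=.
    by case.
  by move=> /andP[-> h]; rewrite h (lt_le_trans h qr).
have -> : `]q.1, r.1[%classic `&` A =
    `]q.1, r.1[%classic `&` [set c | f c < line p r c].
  rewrite setIA; congr (_ `&` _); apply/seteqP; split => c /=; rewrite !in_itv/=.
    by case.
  by move=> /andP[h ->]; rewrite h (le_lt_trans pq h).
by ring.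
Qed.

Lemma tri_swap12 p q r : tri p q r = tri q p r.
Proof.
apply/seteqP; split => z [a [b [c [a0 b0 c0 abc ->]]]]; exists b, a, c;
  (split => //; [lra|congr pair; lra]).
Qed.

Lemma tri_swap23 p q r : tri p q r = tri p r q.
Proof.
apply/seteqP; split => z [a [b [c [a0 b0 c0 abc ->]]]]; exists a, c, b;
  (split => //; [lra|congr pair; lra]).
Qed.

Lemma orient_swap12 p q r : orient q p r = - orient p q r.
Proof. by rewrite /orient !det2E; ring. Qed.

Lemma orient_swap23 p q r : orient p r q = - orient p q r.
Proof. by rewrite /orient !det2E; ring. Qed.

(* Stokes' formula for the 1-form "first coordinate" on the part of the triangle
   above the graph of f. *)
Lemma tri_length f p q r : continuous f -> orient p q r != 0 ->
  countable (crossing f p q) -> countable (crossing f q r) ->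
  countable (crossing f r p) ->
  length_of [set c | tri p q r (c, f c)] = - Num.sg (orient p q r) *
    ((q.1 - p.1) * above f p q + (r.1 - q.1) * above f q r
     + (p.1 - r.1) * above f r p).
Proof.
move=> cf.
(* Exchanging two vertices changes the sign of both the orientation and the sum over the edges, so
   the vertices may be sorted by abscissa. *)
pose P p q r := orient p q r != 0 ->
  countable (crossing f p q) -> countable (crossing f q r) ->
  countable (crossing f r p) ->
  length_of [set c | tri p q r (c, f c)] = - Num.sg (orient p q r) *
    ((q.1 - p.1) * above f p q + (r.1 - q.1) * above f q r
     + (p.1 - r.1) * above f r p).
have sorted p' q' r' : p'.1 <= q'.1 -> q'.1 <= r'.1 -> P p' q' r'.
  move=> pq qr D0 Npq Nqr Nrp; rewrite tri_length_sorted// 1?crossing_sym//.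
  by rewrite (above_sym r')//; ring.
have swap12 p' q' r' : P q' p' r' -> P p' q' r'.
  move=> H D0 Npq Nqr Nrp; rewrite tri_swap12 H; last 4 first.
  - by rewrite orient_swap12 oppr_eq0.
  - by rewrite crossing_sym.
  - by rewrite crossing_sym.
  - by rewrite crossing_sym.
  rewrite orient_swap12 sgrN (above_sym q' p')// (above_sym p' r')//.
  by rewrite (above_sym r' q')//; ring.
have swap23 p' q' r' : P p' r' q' -> P p' q' r'.
  move=> H D0 Npq Nqr Nrp; rewrite tri_swap23 H; last 4 first.
  - by rewrite orient_swap23 oppr_eq0.
  - by rewrite crossing_sym.
  - by rewrite crossing_sym.
  - by rewrite crossing_sym.
  rewrite orient_swap23 sgrN (above_sym q' p')// (above_sym p' r')//.
  by rewrite (above_sym r' q')//; ring.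
have [pq|/ltW qp] := leP p.1 q.1; have [qr|/ltW rq] := leP q.1 r.1.
- exact: sorted.
- have [pr|/ltW rp] := leP p.1 r.1.
    by apply: (swap23); exact: sorted.
  by apply: (swap23); apply: (swap12); exact: sorted.
- have [pr|/ltW rp] := leP p.1 r.1.
    by apply: (swap12); exact: sorted.
  by apply: (swap12); apply: (swap23); exact: sorted.
- by apply: (swap12); apply: (swap23); apply: (swap12); exact: sorted.
Qed.

End Triangle.

(** * Simple zeros are isolated, hence countable *)

Section SimpleZeros.
Variable R : realType.
Implicit Types (L : R -> R) (t s e l : R) (Z : set R).

Lemma derive_gt0_sign L t l : is_derive t 1 L l -> 0 < l -> L t = 0 ->
  exists2 e, 0 < e & forall s, `|s - t| < e -> s != t -> 0 < L s * (s - t).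
Proof.
move=> [dL dLl] l0 Lt0.
have /cvgrPdist_lt /(_ _ l0) := dL.
rewrite -/(derive L t 1) dLl => -[e /= e0 He]; exists e => // s ste st.
have h0 : s - t != 0 by rewrite subr_eq0.
have := He (s - t); rewrite /ball_/= sub0r normrN => /(_ ste h0).
rewrite [_%:A]mulr1 subrK Lt0 subr0 => h.
have : 0 < (s - t)^-1 *: L s.
  by move: h; rewrite ltr_norml => /andP[_]; rewrite ltrBlDr -ltrBlDl subrr.
move=> h1; rewrite (_ : _ * _ = (s - t) ^+ 2 * ((s - t)^-1 *: L s)).
  by rewrite mulr_gt0// exprn_even_gt0.
by rewrite /GRing.scale/=; field.
Qed.

Lemma derive_neq0_sign L t l : is_derive t 1 L l -> l != 0 -> L t = 0 ->
  exists2 e, 0 < e & forall s, `|s - t| < e -> s != t -> 0 < l * (L s * (s - t)).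
Proof.
move=> dL l0 Lt0; have [l_lt0|l_gt0|/eqP] := ltgtP l 0; last by rewrite (negbTE l0).
- have [||e e0 He] := @derive_gt0_sign (\- L) t (- l).
  + by rewrite oppr_gt0.
  + by rewrite /= Lt0 oppr0.
  by exists e => // s se st; have := He _ se st; rewrite mulNr nmulr_rgt0// oppr_gt0.
- have [e e0 He] := derive_gt0_sign dL l_gt0 Lt0.
  by exists e => // s se st; rewrite mulr_gt0// He.
Qed.

(** Two rationals enclosing [t] inside its isolating interval determine [t], so [Z] injects into
    pairs of rationals. *)
Lemma countable_isolated Z :
  (forall t, Z t -> exists2 e : R, 0 < e & forall s, Z s -> `|s - t| < e -> s = t) ->
  countable Z.
Proof.
move=> H.
have /choice[e He] : forall t, exists x : R, Z t ->
    0 < x /\ forall s, Z s -> `|s - t| < x -> s = t.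
  move=> t; have [/H[x x0 Hx]|nZ] := pselect (Z t); first by exists x.
  by exists 0 => /nZ.
have rational_between (x y : R) : x < y -> exists q : rat, x < ratr q < y.
  by move=> xy; have [q] := rat_in_itvoo xy; rewrite in_itv/= => h; exists q.
have /choice[a Ha] : forall t, exists q : rat, Z t -> t - e t < ratr q < t.
  move=> t; have [/He[x0 _]|nZ] := pselect (Z t); last by exists 0 => /nZ.
  have [|q h] := rational_between (t - e t) t; first by rewrite ltrBlDr ltrDl.
  by exists q.
have /choice[b Hb] : forall t, exists q : rat, Z t -> t < ratr q < t + e t.
  move=> t; have [/He[x0 _]|nZ] := pselect (Z t); last by exists 0 => /nZ.
  have [|q h] := rational_between t (t + e t); first by rewrite ltrDl.
  by exists q.
apply/countable_injP.
have : {in Z &, injective (fun t => (a t, b t))}.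
  move=> s t /set_mem Zs /set_mem Zt [eab ebt].
  have /andP[h1 h2] := Ha _ Zs; have /andP[h3 h4] := Ha _ Zt.
  have /andP[h5 h6] := Hb _ Zs; have /andP[h7 h8] := Hb _ Zt.
  rewrite eab in h1 h2; rewrite ebt in h5 h6.
  apply: (proj2 (He _ Zt)) => //.
  by rewrite ltr_norml; apply/andP; split; lra.
move=> inj; exists (choice.pickle \o (fun t => (a t, b t))).
by move=> s t Zs Zt /= /(pcan_inj choice.pickleK) /(inj _ _ Zs Zt).
Qed.

Lemma countable_simple_zeros Z L (l : R -> R) : (forall t, Z t -> is_derive t 1 L (l t)) ->
  (forall t, Z t -> L t = 0) -> (forall t, Z t -> l t != 0) -> countable Z.
Proof.
move=> dL L0 l0; apply: countable_isolated => t Zt.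
have [e e0 He] := derive_neq0_sign (dL _ Zt) (l0 _ Zt) (L0 _ Zt).
exists e => // s Zs se; apply/eqP; apply: contraTT isT => st.
by have := He _ se st; rewrite L0// mul0r mulr0 ltxx.
Qed.

End SimpleZeros.

(** * Linear frames and arcs as graphs *)

Section Arcs.
Variable R : realType.
Implicit Types (u v w p q r z : plane R) (g h : R -> plane R) (a b t l k : R).

Definition dot u z : R := u.1 * z.1 + u.2 * z.2.
(** A linear change of coordinates of determinant [det2 u v], with [u] giving the abscissa and [v]
    the height. It need not be orthogonal: sheared frames [(u + k v, v)] occur too. *)
Definition frame u v z : plane R := (dot u z, dot v z).

Lemma frame_inj u v z w : det2 u v != 0 -> frame u v z = frame u v w -> z = w.
Proof.
rewrite /det2 /frame /dot => D0 [e1 e2].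
have cramer X Y : (u.1 * v.2 - u.2 * v.1) * (X - Y) = 0 -> X = Y.
  by move/eqP; rewrite mulf_eq0 (negbTE D0)/= subr_eq0 => /eqP.
rewrite [z]surjective_pairing [w]surjective_pairing; congr pair; apply: cramer.
  rewrite (_ : _ * _ = v.2 * (u.1 * z.1 + u.2 * z.2 - (u.1 * w.1 + u.2 * w.2))
    - u.2 * (v.1 * z.1 + v.2 * z.2 - (v.1 * w.1 + v.2 * w.2))); last by ring.
  by rewrite e1 e2; ring.
rewrite (_ : _ * _ = - v.1 * (u.1 * z.1 + u.2 * z.2 - (u.1 * w.1 + u.2 * w.2))
    + u.1 * (v.1 * z.1 + v.2 * z.2 - (v.1 * w.1 + v.2 * w.2))); last by ring.
by rewrite e1 e2; ring.
Qed.

Lemma tri_frame u v p q r z : det2 u v != 0 ->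
  tri (frame u v p) (frame u v q) (frame u v r) (frame u v z) <-> tri p q r z.
Proof.
move=> D0; split=> -[a [b [c [a0 b0 c0 abc e]]]]; exists a, b, c; split => //.
  apply: (frame_inj D0); rewrite e /frame /dot /=; congr pair; ring.
by rewrite e /frame /dot /=; congr pair; ring.
Qed.

Lemma seg_frame u v p q l :
  seg (frame u v p) (frame u v q) l = frame u v (seg p q l).
Proof. by rewrite /seg /frame /dot /=; congr pair; ring. Qed.

Lemma orient_frame u v p q r :
  orient (frame u v p) (frame u v q) (frame u v r) = det2 u v * orient p q r.
Proof. by rewrite /orient !det2E /frame /det2 /dot /=; ring. Qed.

Definition smooth1 g : Prop :=
  [/\ forall t, is_derive (t : R) 1 (fst \o g) (velocity g t).1,
      forall t, is_derive (t : R) 1 (snd \o g) (velocity g t).2,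
      continuous (fun t => (velocity g t).1)
    & continuous (fun t => (velocity g t).2)].

Lemma is_derive_dot g u t : smooth1 g ->
  is_derive t 1 (dot u \o g) (dot u (velocity g t)).
Proof.
move=> [d1 d2 _ _]; have := d1 t; have := d2 t => dt2 dt1.
have -> : dot u \o g = (u.1 *: (fst \o g) + u.2 *: (snd \o g)).
  by apply/funext.
exact: is_deriveD.
Qed.

Lemma continuous_dot_velocity g u : smooth1 g ->
  continuous (fun t => dot u (velocity g t)).
Proof.
move=> [_ _ c1 c2] t; apply: cvgD.
  by apply: cvgM; [exact: cvg_cst|exact: c1].
by apply: cvgM; [exact: cvg_cst|exact: c2].
Qed.

Lemma continuous_dot g u : smooth1 g -> continuous (dot u \o g).
Proof.
move=> sg t; apply/differentiable_continuous/derivable1_diffP.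
by have [] := is_derive_dot u t sg.
Qed.

Lemma continuous_orient g p q : smooth1 g -> continuous (fun t => orient p q (g t)).
Proof.
move=> sg t.
have -> : (fun t => orient p q (g t)) =
    (fun t => (dot (- (q.2 - p.2), q.1 - p.1) \o g) t - dot (- (q.2 - p.2), q.1 - p.1) p).
  by apply/funext => s; rewrite /orient det2E /dot/=; ring.
by apply: cvgB; [exact: continuous_dot|exact: cvg_cst].
Qed.

Lemma measurable_tri_preimage g p q r : smooth1 g -> orient p q r != 0 ->
  measurable [set t | tri p q r (g t)].
Proof.
move=> sg D0; pose G p' q' t := orient p q r * orient p' q' (g t).
have mG p' q' : measurable [set c | 0 <= G p' q' c].
  apply: (@measurable_le _ (cst 0)) => // c; first exact: cvg_cst.
  by apply: cvgM; [exact: cvg_cst|exact: continuous_orient].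
rewrite (_ : [set c | _] = [set c | 0 <= G p q c] `&` [set c | 0 <= G q r c]
    `&` [set c | 0 <= G r p c]).
  by apply: measurableI => //; apply: measurableI.
apply/seteqP; split => c.
  by move/(tri_det _ D0) => -[h1 h2 h3]; split; [split|].
by move=> [[h1 h2] h3]; apply/(tri_det _ D0).
Qed.

(** The arc is a graph over the direction [u], and is traversed in the increasing sense: the
    orientation is part of the notion. *)
Definition is_arc g a b u : Prop :=
  a < b /\ forall t, t \in `[a, b] -> 0 < dot u (velocity g t).

Definition in_range g a b u z : Prop :=
  dot u (g a) < dot u z < dot u (g b).

Lemma arc_increasing g a b u : smooth1 g -> is_arc g a b u ->
  {in `[a, b] &, {homo dot u \o g : s t / s < t}}.
Proof.
move=> sg [ab gu].
exact: (derive_gt0_increasing (fun t => is_derive_dot u t sg) gu).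
Qed.

Definition is_graph g a b u v (f : R -> R) : Prop :=
  continuous f /\ forall t, t \in `[a, b] -> f (dot u (g t)) = dot v (g t).

Lemma tri_range (p q r z : plane R) x y : tri p q r z -> x < p.1 < y -> x < q.1 < y ->
  x < r.1 < y -> x < z.1 < y.
Proof.
move=> [a [b [c [a0 b0 c0 abc ->]]]] /= /andP[p1 p2] /andP[q1 q2] /andP[r1 r2].
have pos (X Y Z : R) : 0 < X -> 0 < Y -> 0 < Z -> 0 < a * X + b * Y + c * Z.
  move=> X0 Y0 Z0; pose m := Num.min X (Num.min Y Z).
  have m0 : 0 < m by rewrite !lt_min X0 Y0.
  have [mX mY mZ] : [/\ m <= X, m <= Y & m <= Z].
    by split; rewrite /m !ge_min ?lexx ?orbT.
  apply: (lt_le_trans m0); have : 0 <= a * (X - m) + b * (Y - m) + c * (Z - m).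
    by rewrite !addr_ge0// mulr_ge0// subr_ge0.
  have -> : a = 1 - b - c by lra.
  by move=> h; lra.
have h (x' y' : R) : x' < y' -> 0 < y' - x' by rewrite subr_gt0.
have := pos _ _ _ (h _ _ p1) (h _ _ q1) (h _ _ r1).
have := pos _ _ _ (h _ _ p2) (h _ _ q2) (h _ _ r2).
have -> : a = 1 - b - c by lra.
by move=> h1 h2; apply/andP; split; lra.
Qed.

Lemma seg_range p q l x y : 0 <= l <= 1 -> x < p.1 < y -> x < q.1 < y ->
  x < (seg p q l).1 < y.
Proof.
move=> /andP[l0 l1] hp hq; apply: (@tri_range p q p) => //.
exists (1 - l), l, 0; split => //; [lra|lra|].
by rewrite /seg; congr pair; ring.
Qed.

(** Substitution [c = dot u (g t)]. As the vertices lie strictly within the range of the arc, every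
    point of the graph of [f] in the triangle comes from the arc. *)
Lemma arc_graph g a b u v : smooth1 g -> is_arc g a b u -> det2 u v != 0 ->
  exists2 f, is_graph g a b u v f & forall p q r, orient p q r != 0 ->
    in_range g a b u p -> in_range g a b u q -> in_range g a b u r ->
  \int[@lebesgue_measure R]_(t in [set t | tri p q r (g t)] `&` `[a, b]%classic)
     dot u (velocity g t) =
  length_of [set c | tri (frame u v p) (frame u v q) (frame u v r) (c, f c)].
Proof.
move=> sg ga D0; have [ab gu] := ga.
have dF t := is_derive_dot u t sg; have cF := continuous_dot (u := u) sg.
have iF := arc_increasing sg ga.
have [G [cG Gab FG GF]] := increasing_inverse (ltW ab) cF iF.
exists (dot v \o g \o G).
  split; last by move=> t tab /=; have := FG _ tab => /= ->.
  by move=> c; apply: continuous_comp; [exact: cG|exact: continuous_dot].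
move=> p q r T0 hp hq hr.
have mT := measurable_tri_preimage sg T0.
rewrite /Rintegral (substitution_measurable ab dF _ gu cG Gab GF)//; last first.
  exact: continuous_dot_velocity.
rewrite /length_of; congr (fine (lebesgue_measure _)).
have E c : c \in `[dot u (g a), dot u (g b)] ->
    (c, (dot v \o g \o G) c) = frame u v (g (G c)).
  by move=> cab; rewrite /frame; have := GF c cab => /= ->.
apply/seteqP; split => c /=.
  by move=> [Tc cab]; rewrite E//; apply/(tri_frame _ _ _ _ D0).
move=> Tc; have cab : c \in `[dot u (g a), dot u (g b)].
  have /andP[] := tri_range Tc hp hq hr.
  by move=> /= h1 h2; rewrite in_itv/= !ltW.
by split=> //; apply/(tri_frame _ _ _ _ D0); rewrite -E.
Qed.

Lemma graph_below g a b u v f z : smooth1 g -> is_arc g a b u ->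
  is_graph g a b u v f -> in_range g a b u z ->
  exists t, [/\ t \in `[a, b], dot u (g t) = dot u z & f (dot u z) = dot v (g t)].
Proof.
move=> sg [ab gu] [cf fg] /andP[az zb].
have [||t tab Ft] := @IVT R (dot u \o g) a b (dot u z) (ltW ab).
- by apply: continuous_subspaceT; exact: continuous_dot.
- by have h := lt_trans az zb; rewrite /= (min_idPl (ltW h)) (max_idPr (ltW h)) !ltW.
by exists t; split => //; rewrite -Ft; exact: fg.
Qed.

(** Let [t] and [s] be the parameters where the arc has the [u]-coordinate, respectively the
    [u + k v]-coordinate, of [z]. Both coordinates increase along the arc, and each side turns out
    to be equivalent to [t < s]. *)
Lemma above_shear g a b u v k f f' z : smooth1 g -> 0 < k ->
  is_arc g a b u -> is_arc g a b (u + k *: v) ->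
  is_graph g a b u v f -> is_graph g a b (u + k *: v) v f' ->
  in_range g a b u z -> in_range g a b (u + k *: v) z ->
  (f (dot u z) < dot v z) = (f' (dot (u + k *: v) z) < dot v z).
Proof.
move=> sg k0 ga ga' gf gf' hz hz'.
have [t [tab ut ft]] := graph_below sg ga gf hz.
have [s [sab us fs]] := graph_below sg ga' gf' hz'.
have iF := arc_increasing sg ga; have iF' := arc_increasing sg ga'.
have mono (h : R -> R) x y : x \in `[a, b] -> y \in `[a, b] ->
    {in `[a, b] &, {homo h : x y / x < y}} -> (h x < h y) = (x < y).
  move=> xab yab ih; have [xy|yx|->] := ltgtP x y; last by rewrite ltxx.
    by rewrite ih.
  by rewrite ltNge (ltW (ih _ _ yab xab yx)).
have dotE w : dot (u + k *: v) w = dot u w + k * dot v w.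
  by rewrite /dot /= /GRing.scale/=; ring.
rewrite ft fs; have := mono _ _ _ tab sab iF; have := mono _ _ _ tab sab iF'.
rewrite /= !dotE ut => e1 e2; rewrite !dotE in us.
have e3 : dot u (g s) = dot u z + k * dot v z - k * dot v (g s) by rewrite -us; ring.
have e4 : (dot u z + k * dot v (g t) < dot u (g s) + k * dot v (g s)) = (dot v (g t) < dot v z).
  by rewrite us ltrD2l ltr_pM2l.
have e5 : (dot u z < dot u (g s)) = (dot v (g s) < dot v z).
  by rewrite e3 -addrA ltrDl subr_gt0 ltr_pM2l.
by rewrite -e4 -e5 e1 e2.
Qed.

End Arcs.

(** * Stokes' formula in two frames *)

Section Stokes.
Variable R : realType.
Implicit Types (u v w p q r z : plane R) (g h : R -> plane R) (a b t l k : R).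
Implicit Types (f : R -> R).

Definition transverse g p q : Prop := forall t l, 0 <= l <= 1 ->
  g t = seg p q l -> det2 (q - p) (velocity g t) != 0.

Lemma is_derive_orient g p q t : smooth1 g ->
  is_derive t 1 (orient p q \o g) (det2 (q - p) (velocity g t)).
Proof.
move=> sg; pose n : plane R := (- (q.2 - p.2), q.1 - p.1).
have -> : orient p q \o g = (dot n \o g) - cst (dot n p).
  by apply/funext => s; rewrite /orient !fctE /= det2E /dot/=; ring.
have dn := is_derive_dot n t sg.
by apply: is_derive_eq; rewrite subr0 /det2 /dot/=; ring.
Qed.

Lemma orient_seg p q l : orient p q (seg p q l) = 0.
Proof. by rewrite /orient det2E /seg/=; ring. Qed.

(** By transversality, the crossing parameters are simple zeros of [orient p q] along the curve. *)
Lemma countable_crossing g a b u v f p q : smooth1 g -> is_arc g a b u ->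
  det2 u v != 0 -> is_graph g a b u v f -> in_range g a b u p ->
  in_range g a b u q -> transverse g p q ->
  countable (crossing f (frame u v p) (frame u v q)).
Proof.
move=> sg ga D0 gf hp hq T.
pose Z := [set t | exists2 l, 0 <= l <= 1 & g t = seg p q l].
have cZ : countable Z.
  apply: (countable_simple_zeros (fun t _ => is_derive_orient p q t sg)).
    by move=> t [l l01 e] /=; rewrite e orient_seg.
  by move=> t [l l01 e]; exact: T e.
apply: (@sub_countable _ _ _ ((dot u \o g) @` Z)); last exact: sub_countable (card_image_le _ _) cZ.
apply: subset_card_le => c [l l01]; rewrite seg_frame => -[e1 e2].
have hz : in_range g a b u (seg p q l).
  have := seg_range (p := frame u v p) (q := frame u v q) l01 hp hq.
  by rewrite seg_frame.
have [t [tab ut ft]] := graph_below sg ga gf hz.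
exists t; last by rewrite /= ut.
exists l => //; apply: (frame_inj D0); rewrite /frame ut -ft.
by rewrite e1 e2.
Qed.

(** A single [f] serves both directions [w]: by [above_shear] the fractions computed in the sheared
    frame are those of the frame [(u, v)]. The coefficients [A] therefore do not depend on [w]. *)
Lemma arc_stokes g a b u v k : smooth1 g -> det2 u v != 0 -> 0 < k ->
  is_arc g a b u -> is_arc g a b (u + k *: v) ->
  exists2 f, is_graph g a b u v f & forall p q r, orient p q r != 0 ->
    in_range g a b u p -> in_range g a b u q -> in_range g a b u r ->
    in_range g a b (u + k *: v) p -> in_range g a b (u + k *: v) q ->
    in_range g a b (u + k *: v) r ->
    transverse g p q -> transverse g q r -> transverse g r p ->
    let A x y := above f (frame u v x) (frame u v y) in
    forall w, w = u \/ w = u + k *: v ->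
    \int[@lebesgue_measure R]_(t in [set t | tri p q r (g t)] `&` `[a, b]%classic)
     dot w (velocity g t) =
    - Num.sg (det2 u v * orient p q r) *
    (dot w (q - p) * A p q + dot w (r - q) * A q r + dot w (p - r) * A r p).
Proof.
move=> sg D0 k0 ga ga'.
have D0' : det2 (u + k *: v) v != 0.
  by rewrite (_ : det2 _ _ = det2 u v)// /det2 /= /GRing.scale/=; ring.
have [f gf Hf] := arc_graph sg ga D0; have [f' gf' Hf'] := arc_graph sg ga' D0'.
exists f => // p q r T0 hp hq hr hp' hq' hr' Tpq Tqr Trp A w [->|->].
  rewrite Hf//; have [cf _] := gf; rewrite tri_length//.
  - rewrite orient_frame /A; congr (_ * _).
    by rewrite /frame/= /dot/=; ring.
  - by rewrite orient_frame mulf_neq0.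
  - exact: (countable_crossing sg ga D0 gf).
  - exact: (countable_crossing sg ga D0 gf).
  - exact: (countable_crossing sg ga D0 gf).
have AE x y : in_range g a b u x -> in_range g a b u y ->
    in_range g a b (u + k *: v) x -> in_range g a b (u + k *: v) y ->
    above f' (frame (u + k *: v) v x) (frame (u + k *: v) v y) = A x y.
  move=> hx hy hx' hy'; congr length_of.
  have E l : 0 <= l <= 1 -> (f' (dot (u + k *: v) (seg x y l)) < dot v (seg x y l)) =
      (f (dot u (seg x y l)) < dot v (seg x y l)).
    move=> l01; apply/esym/(above_shear sg k0 ga ga' gf gf').
      have := seg_range (p := frame u v x) (q := frame u v y) l01 hx hy.
      by rewrite seg_frame.
    have := seg_range (p := frame (u + k *: v) v x) (q := frame (u + k *: v) v y)
      l01 hx' hy'.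
    by rewrite seg_frame.
  apply/seteqP; split => l [l01 h]; split => //; move: h;
    by rewrite /mkset !seg_frame /= E// ; move: l01; rewrite /= in_itv.
rewrite Hf'//; have [cf _] := gf'; rewrite tri_length//.
- rewrite orient_frame !AE//.
  rewrite (_ : det2 (u + k *: v) v = det2 u v); last first.
    by rewrite /det2 /= /GRing.scale/=; ring.
  by congr (_ * _); rewrite /frame/= /dot/=; ring.
- by rewrite orient_frame mulf_neq0.
- exact: (countable_crossing sg ga' D0' gf').
- exact: (countable_crossing sg ga' D0' gf').
- exact: (countable_crossing sg ga' D0' gf').
Qed.

(** The equations say that the edge vectors weighted by [P], [Q], [S] sum to zero. The plain edge
    vectors also sum to zero and two of them are independent, so the three weights agree. *)
Lemma equal_fractions u v k (P Q S : R) p q r : det2 u v != 0 -> 0 < k ->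
  orient p q r != 0 ->
  dot u (q - p) * P + dot u (r - q) * Q + dot u (p - r) * S = 0 ->
  dot (u + k *: v) (q - p) * P + dot (u + k *: v) (r - q) * Q
    + dot (u + k *: v) (p - r) * S = 0 -> P = Q /\ Q = S.
Proof.
move=> D0 k0 T0 e1 e2.
have e3 : dot v (q - p) * P + dot v (r - q) * Q + dot v (p - r) * S = 0.
  have k0' : k != 0 by rewrite gt_eqF.
  apply: (mulfI k0'); rewrite mulr0 -e2 -[LHS]addr0 -[in LHS]e1.
  by rewrite /dot /= /GRing.scale/=; ring.
have h1 : det2 u v * orient p q r * (P - S) = 0.
  transitivity ((dot u (q - p) * P + dot u (r - q) * Q + dot u (p - r) * S) * dot v (r - q)
   - (dot v (q - p) * P + dot v (r - q) * Q + dot v (p - r) * S) * dot u (r - q)).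
    by rewrite /orient !det2E /det2 /dot /=; ring.
  by rewrite e1 e3 !mul0r subrr.
have h2 : det2 u v * orient p q r * (Q - S) = 0.
  transitivity ((dot v (q - p) * P + dot v (r - q) * Q + dot v (p - r) * S) * dot u (q - p)
   - (dot u (q - p) * P + dot u (r - q) * Q + dot u (p - r) * S) * dot v (q - p)).
    by rewrite /orient !det2E /det2 /dot /=; ring.
  by rewrite e1 e3 !mul0r subrr.
have DT : det2 u v * orient p q r != 0 by rewrite mulf_neq0.
move/eqP: h1; rewrite mulf_eq0 (negbTE DT)/= subr_eq0 => /eqP ->.
by move/eqP: h2; rewrite mulf_eq0 (negbTE DT)/= subr_eq0 => /eqP ->.
Qed.

(* Equality of the integrals over the two arcs forces the same proportion of each
   of the three edges to lie between them. *)
Lemma equal_edge_fractions g h a b a' b' u v k :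
  smooth1 g -> smooth1 h -> det2 u v != 0 -> 0 < k ->
  is_arc g a b u -> is_arc g a b (u + k *: v) ->
  is_arc h a' b' u -> is_arc h a' b' (u + k *: v) ->
  exists f f', [/\ is_graph g a b u v f, is_graph h a' b' u v f' &
  forall p q r, orient p q r != 0 ->
  (forall x w, x = p \/ x = q \/ x = r -> w = u \/ w = u + k *: v ->
     in_range g a b w x /\ in_range h a' b' w x) ->
  (forall i, i = g \/ i = h ->
     [/\ transverse i p q, transverse i q r & transverse i r p]) ->
  (forall w, w = u \/ w = u + k *: v ->
   \int[@lebesgue_measure R]_(t in [set t | tri p q r (g t)] `&` `[a, b]%classic)
     dot w (velocity g t) =
   \int[@lebesgue_measure R]_(t in [set t | tri p q r (h t)] `&` `[a', b']%classic)
     dot w (velocity h t)) ->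
  let fraction x y := above f (frame u v x) (frame u v y)
     - above f' (frame u v x) (frame u v y) in
  fraction p q = fraction q r /\ fraction q r = fraction r p].
Proof.
move=> sg sh D0 k0 ga ga' ha ha'.
have [f gf Hf] := arc_stokes sg D0 k0 ga ga'.
have [f' hf' Hf'] := arc_stokes sh D0 k0 ha ha'.
exists f, f'; split => // p q r T0 range tr e fraction.
have [gpq gqr grp] := tr _ (or_introl erefl).
have [hpq hqr hrp] := tr _ (or_intror erefl).
have wu : u = u \/ u = u + k *: v by left.
have wv : u + k *: v = u \/ u + k *: v = u + k *: v by right.
have xp : p = p \/ p = q \/ p = r by left.
have xq : q = p \/ q = q \/ q = r by right; left.
have xr : r = p \/ r = q \/ r = r by right; right.
have [] := (range _ _ xp wu, range _ _ xp wv).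
have [] := (range _ _ xq wu, range _ _ xq wv).
have [] := (range _ _ xr wu, range _ _ xr wv).
move=> [a1 a2] [a3 a4] [a5 a6] [a7 a8] [a9 a10] [a11 a12].
have key w : w = u \/ w = u + k *: v ->
    dot w (q - p) * fraction p q + dot w (r - q) * fraction q r
    + dot w (p - r) * fraction r p = 0.
  move=> hw; have := e _ hw; rewrite Hf// Hf'// => E.
  have sg0 : - Num.sg (det2 u v * orient p q r) != 0.
    by rewrite oppr_eq0 sgr_eq0 mulf_neq0.
  have := mulfI sg0 E; rewrite /fraction => E'.
  by rewrite -[RHS](subrr (dot w (q - p) * above f (frame u v p) (frame u v q) +
      dot w (r - q) * above f (frame u v q) (frame u v r) +
      dot w (p - r) * above f (frame u v r) (frame u v p))) {2}E'; ring.
exact: (equal_fractions D0 k0 T0 (key _ wu) (key _ wv)).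
Qed.

End Stokes.

(** * How an arc leaves a triangle and crosses an edge *)

Section EdgeCrossing.
Variable R : realType.
Implicit Types (u v w p q r z : plane R) (g h : R -> plane R) (a b t l k e : R).
Implicit Types (f : R -> R).

Lemma tri_boundary p q r z : orient p q r != 0 -> tri p q r z ->
  orient p q z = 0 -> exists2 l, 0 <= l <= 1 & z = seg p q l.
Proof.
move=> T0 [x [y [c [x0 y0 c0 xyc ->]]]] e.
have : c * orient p q r = 0.
  rewrite -[RHS]e /orient !det2E /=.
  have -> : x = 1 - y - c by lra.
  by ring.
move=> /eqP; rewrite mulf_eq0 (negbTE T0) orbF => /eqP c00.
exists y; first by apply/andP; split; lra.
have -> : x = 1 - y by lra.
by rewrite c00 /seg; congr pair; ring.
Qed.

Lemma orient_cyc p q r : orient q r p = orient p q r.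
Proof. by rewrite /orient !det2E; ring. Qed.

(** The minimum [m] of the three normalized determinants is continuous and is nonnegative exactly
    inside the triangle. At a zero of [m] the point is still in the triangle and one determinant
    vanishes, which puts it on the corresponding edge. *)
Lemma arc_exits g t b p q r : smooth1 g -> t <= b -> orient p q r != 0 ->
  tri p q r (g t) -> ~ tri p q r (g b) ->
  exists2 s, t <= s <= b & exists l, 0 <= l <= 1 /\
    [\/ g s = seg p q l, g s = seg q r l | g s = seg r p l].
Proof.
move=> sg tb T0 Tt Tb.
pose D := orient p q r.
pose m s := Num.min (D * orient p q (g s)) (Num.min (D * orient q r (g s))
  (D * orient r p (g s))).
have m_ge0 s : (0 <= m s) <-> tri p q r (g s).
  rewrite tri_det// /m !le_min; split.
    by move=> /and3P[h1 h2 h3].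
  by move=> [h1 h2 h3]; rewrite h1 h2.
have cm : continuous m.
  have cD p' q' : continuous (fun s => D * orient p' q' (g s)).
    by move=> s; apply: cvgM; [exact: cvg_cst|exact: continuous_orient].
  move=> s; apply: (@continuous_min _ _ (fun s => D * orient p q (g s))
    (fun s => Num.min (D * orient q r (g s)) (D * orient r p (g s)))).
    exact: cD.
  by apply: (@continuous_min _ _ (fun s => D * orient q r (g s))
    (fun s => D * orient r p (g s))); exact: cD.
have mt : 0 <= m t by apply/m_ge0.
have mb : m b < 0 by rewrite ltNge; apply/negP => /m_ge0.
have [||s sab ms] := @IVT R m t b 0 tb.
- exact: continuous_subspaceT.
- by rewrite ge_min le_max mt (ltW mb) orbT.
have Ts : tri p q r (g s) by apply/m_ge0; rewrite ms.
exists s; first by move: sab; rewrite in_itv.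
have D0 : D != 0 by [].
have z p' q' : D * orient p' q' (g s) = 0 -> orient p' q' (g s) = 0.
  by move/eqP; rewrite mulf_eq0 (negbTE D0) => /eqP.
have : [\/ D * orient p q (g s) = 0, D * orient q r (g s) = 0
    | D * orient r p (g s) = 0].
  move: ms; rewrite /m !minEle; case: ifP => _; first by constructor 1.
  by case: ifP => _; [constructor 2|constructor 3].
case=> /z e.
- by have [l l01 gs] := tri_boundary T0 Ts e; exists l; split => //; constructor 1.
- have [||l l01 gs] := @tri_boundary q r p (g s) _ _ e.
  + by rewrite orient_cyc.
  + by rewrite tri_swap23 tri_swap12.
  by exists l; split => //; constructor 2.
- have [||l l01 gs] := @tri_boundary r p q (g s) _ _ e.
  + by rewrite -orient_cyc.
  + by rewrite tri_swap12 tri_swap23.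
  by exists l; split => //; constructor 3.
Qed.

(** Since the zero of [orient p q] along the curve is simple, the curve changes sides of the edge at
    [t]; read vertically, the edge changes sides of the graph at [l]. *)
Lemma crossing_sides g a b u v f p q t l e : smooth1 g -> det2 u v != 0 ->
  is_graph g a b u v f -> a < t < b -> 0 < l < 1 -> g t = seg p q l ->
  transverse g p q -> 0 < e ->
  let z := seg p q in
  exists l1 l2, [/\ `|l1 - l| < e, `|l2 - l| < e,
    f (dot u (z l1)) < dot v (z l1) & dot v (z l2) < f (dot u (z l2))].
Proof.
move=> sg D0 [cf gf] /andP[at_ tb] /andP[l0 l1] gt T e0 z.
have tab : t \in `[a, b] by rewrite in_itv/= !ltW.
have l01 : 0 <= l <= 1 by rewrite !ltW.
have dn0 := T _ _ l01 gt.
have dotz w s : dot w (z s) = dot w p + s * (dot w q - dot w p).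
  by rewrite /z /seg /dot/=; ring.
(* An edge that is vertical in the frame keeps its abscissa, so moving along it changes only the
   height. *)
have [upq|upq] := eqVneq (dot u p) (dot u q).
  have vpq : dot v q - dot v p != 0.
    rewrite subr_eq0; apply: contra dn0 => /eqP vqp.
    have -> : p = q by apply: (frame_inj D0); rewrite /frame upq vqp.
    by rewrite /det2/= !subrr !mul0r subrr.
  have uz s : dot u (z s) = dot u (g t) by rewrite gt -/(z l) !dotz upq subrr !mulr0.
  have vz s : dot v (z s) = dot v (g t) + (s - l) * (dot v q - dot v p).
    by rewrite gt -/(z l) !dotz; ring.
  pose n := Num.sg (dot v q - dot v p) * (e / 2).
  have nn : `|n| < e.
    rewrite /n normrM normr_sg vpq mul1r gtr0_norm ?divr_gt0//.
    by rewrite ltr_pdivrMr// ltr_pMr// ltr1n.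
  have npos : 0 < n * (dot v q - dot v p).
    rewrite /n mulrAC -normrEsg mulr_gt0 ?normr_gt0// divr_gt0//.
  exists (l + n), (l - n); split.
  - by rewrite addrC addKr.
  - by rewrite addrC addKr normrN.
  - by rewrite uz vz gf// ltrDl (addrC l) addrK.
  - by rewrite uz vz gf// gtrDl (addrC l) addrK mulNr oppr_lt0.
have uqp0 : dot u q - dot u p != 0 by rewrite subr_eq0 eq_sym.
(* The parameter of the point of the line [p q] with the same [u]-coordinate as [g s]. *)
pose lam s := (dot u (g s) - dot u p) / (dot u q - dot u p).
have clam : continuous lam.
  move=> s; apply: cvgM; last exact: cvg_cst.
  by apply: cvgB; [exact: (continuous_dot (u := u) sg)|exact: cvg_cst].
have lamt : lam t = l by rewrite /lam gt -/(z l) dotz; field.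
have uzlam s : dot u (z (lam s)) = dot u (g s).
  by rewrite dotz /lam; field.
have Lt0 : orient p q (g t) = 0 by rewrite gt orient_seg.
have [e1 e10 H1] := derive_neq0_sign (is_derive_orient p q t sg) dn0 Lt0.
have : \forall s \near t, `|lam s - l| < e.
  have /cvgrPdist_lt/(_ _ e0) := clam t; rewrite lamt.
  by apply: filterS => s; rewrite distrC.
move=> /nbhs_ballP[e2 /= e20 H2].
pose eta := Num.min (Num.min (e1 / 2) (e2 / 2)) (Num.min ((t - a) / 2) ((b - t) / 2)).
have eta0 : 0 < eta by rewrite !lt_min !divr_gt0// subr_gt0.
have [k1 k2 k3 k4] : [/\ eta <= e1 / 2, eta <= e2 / 2, eta <= (t - a) / 2
   & eta <= (b - t) / 2].
  by split; rewrite /eta !ge_min lexx ?orbT.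
(* The vertical gap between the line and the curve, multiplied by [s - t], has the sign of [K] near
   [t]; the parameters [t + eta] and [t - eta] then give the two sides. *)
pose K := - (det2 (q - p) (velocity g t) * (dot u q - dot u p) * det2 u v).
have K0 : K != 0 by rewrite oppr_eq0 !mulf_neq0.
have main s : s != t -> `|s - t| <= eta -> [/\ `|lam s - l| < e,
    f (dot u (z (lam s))) = dot v (g s) &
    0 < K * (dot v (z (lam s)) - dot v (g s)) * (s - t)].
  move=> st ste; split.
  - by apply: H2; rewrite /ball/= distrC; clear - ste k2 e20; lra.
  - rewrite uzlam gf// in_itv/=.
    by move: ste; clear - k3 k4 at_ tb; rewrite ler_norml => /andP[? ?]; apply/andP; split; lra.
  have := H1 s; rewrite /comp => /(_ _ st) h.
  have h1 : `|s - t| < e1 by clear - ste k1 e10; lra.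
  move: (h h1) => {}h.
  rewrite (_ : _ * _ = (det2 u v) ^+ 2 * (det2 (q - p) (velocity g t) *
    (orient p q (g s) * (s - t)))); first by rewrite mulr_gt0 ?exprn_even_gt0.
  have -> : dot v (z (lam s)) - dot v (g s) =
      - (det2 u v * orient p q (g s)) / (dot u q - dot u p).
    have lE : lam s * (dot u q - dot u p) = dot u (g s) - dot u p.
      by rewrite /lam; field.
    apply: (mulIf uqp0); rewrite mulfVK// dotz mulrBl mulrDl mulrAC lE.
    by rewrite /orient !det2E /det2 /dot /=; ring.
  by rewrite /K; field.
have [h1 h2 h3] : [/\ `|lam (t + eta) - l| < e,
    f (dot u (z (lam (t + eta)))) = dot v (g (t + eta)) &
    0 < K * (dot v (z (lam (t + eta))) - dot v (g (t + eta))) * (t + eta - t)].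
  by apply: main; [rewrite gt_eqF// ltrDl|rewrite addrC addKr gtr0_norm].
have [i1 i2 i3] : [/\ `|lam (t - eta) - l| < e,
    f (dot u (z (lam (t - eta)))) = dot v (g (t - eta)) &
    0 < K * (dot v (z (lam (t - eta))) - dot v (g (t - eta))) * (t - eta - t)].
  by apply: main; [rewrite lt_eqF// gtrBl|rewrite addrC addKr normrN gtr0_norm].
move: h3; rewrite (addrC t) addrK pmulr_lgt0// => h3.
move: i3; rewrite (addrC t) addrK nmulr_lgt0 ?oppr_lt0// => i3.
have [KN|KP|/eqP] := ltgtP K 0; last by rewrite (negbTE K0).
- exists (lam (t - eta)), (lam (t + eta)); split => //.
    by rewrite i2 -subr_gt0 -(nmulr_rlt0 _ KN) (addrC t).
  by rewrite h2 -subr_lt0 -(nmulr_rgt0 _ KN) (addrC t).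
- exists (lam (t + eta)), (lam (t - eta)); split => //.
    by rewrite h2 -subr_gt0 -(pmulr_rgt0 _ KP) (addrC t).
  by rewrite i2 -subr_lt0 -(pmulr_rlt0 _ KP) (addrC t).
Qed.

End EdgeCrossing.

(** * The fraction of an edge lying in a strip between two graphs *)

Section EdgeFractions.
Variable R : realType.
Implicit Types (u v w p q r z : plane R) (g h : R -> plane R) (a b t l k e : R).
Implicit Types (f : R -> R).

Lemma length_of_gt0 (A : set R) l e : measurable A -> 0 < l < 1 -> 0 < e ->
  (forall s, `|s - l| < e -> A s) -> 0 < length_of (`[0, 1]%classic `&` A).
Proof.
move=> mA /andP[l0 l1] e0 HA.
pose d := Num.min (e / 2) (1 - l).
have d0 : 0 < d by rewrite lt_min divr_gt0//= subr_gt0.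
have [d1 d2] : d <= e / 2 /\ d <= 1 - l by split; rewrite /d ge_min lexx ?orbT.
apply: (@lt_le_trans _ _ (length_of `]l, (l + d)[%classic)).
  by rewrite length_of_itv ?lerDl ?(ltW d0)// addrC addKr.
apply: le_length_of => //.
  by apply: bounded_measurableI => //; exact: bounded_measurable_itv.
move=> s /=; rewrite !in_itv/= => /andP[h1 h2]; split.
  by apply/andP; split; lra.
by apply: HA; rewrite ger0_norm; lra.
Qed.

Lemma continuous_edge f u v p q : continuous f ->
  continuous (fun l => dot v (seg p q l) - f (dot u (seg p q l))).
Proof.
move=> cf; have cd w : continuous (fun l => dot w (seg p q l)).
  move=> l; apply: cvgD.
    by apply: cvgM; [exact: cvg_cst|exact: continuous_seg1].
  by apply: cvgM; [exact: cvg_cst|exact: continuous_seg2].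
move=> l; apply: cvgB; first exact: cd.
by apply: continuous_comp; [exact: cd|exact: cf].
Qed.

Lemma frac_setE f u v p q : above f (frame u v p) (frame u v q) =
  length_of (`[0, 1]%classic `&`
    [set l | f (dot u (seg p q l)) < dot v (seg p q l)]).
Proof.
congr length_of; apply/seteqP; split => l [l01 h]; split => //; move: h;
  by rewrite /mkset !seg_frame.
Qed.

Lemma continuous_near_gt0 (F : R -> R) l : continuous F -> 0 < F l ->
  exists2 e, 0 < e & forall s, `|s - l| < e -> 0 < F s.
Proof.
move=> cF Fl; have /cvgrPdist_lt/(_ _ Fl) := cF l.
move=> /nbhs_ballP[e /= e0 He]; exists e => // s sl.
have := He s; rewrite /ball/= distrC => /(_ sl).
by rewrite ltr_norml => /andP[_]; rewrite ltrBlDr -ltrBlDl subrr.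
Qed.

Lemma measurable_edge f u v p q : continuous f ->
  measurable [set l | f (dot u (seg p q l)) < dot v (seg p q l)].
Proof.
move=> cf; rewrite (_ : [set _ | _] = [set l | cst 0 l <
    dot v (seg p q l) - f (dot u (seg p q l))]).
  by apply: measurable_lt; [move=> ?; exact: cvg_cst|exact: continuous_edge].
by apply/seteqP; split => l /=; rewrite subr_gt0.
Qed.

(* If the lower or the upper curve crosses the edge transversally at [l], then
   the edge is neither contained in nor disjoint from the strip. *)
Lemma fraction_between f f' u v p q l : continuous f -> continuous f' ->
  0 < l < 1 -> (forall s, 0 <= s <= 1 -> f (dot u (seg p q s)) < f' (dot u (seg p q s))) ->
  (exists j, [/\ j = f \/ j = f', j (dot u (seg p q l)) = dot v (seg p q l) &
   forall e, 0 < e -> exists l1 l2, [/\ `|l1 - l| < e, `|l2 - l| < e,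
    j (dot u (seg p q l1)) < dot v (seg p q l1) &
    dot v (seg p q l2) < j (dot u (seg p q l2))]]) ->
  0 < above f (frame u v p) (frame u v q) - above f' (frame u v p) (frame u v q) < 1.
Proof.
move=> cf cf' l01 ff' [j [jf jl sides]].
pose z := seg p q; pose I : set R := `[0, 1]%classic.
pose A f := [set l | f (dot u (z l)) < dot v (z l)].
have mA i : continuous i -> measurable (A i) by move=> ?; exact: measurable_edge.
rewrite !frac_setE -/(A f) -/(A f').
have sub : I `&` A f' `<=` I `&` A f.
  move=> s [Is h]; split => //; apply: lt_trans h; apply: ff'.
  by move: Is; rewrite /I/= in_itv.
have bI B : measurable B -> bounded_measurable (I `&` B).
  by move=> mB; apply: bounded_measurableI => //; exact: bounded_measurable_itv.
rewrite -length_ofD//; last 2 first.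
- by apply: measurableI => //; exact: mA.
- by apply: bI; exact: mA.
have := l01 => /andP[l0 l1].
have nearl (F : R -> R) : continuous F -> 0 < F l ->
    exists2 e, 0 < e & forall s, `|s - l| < e -> 0 < s < 1 /\ 0 < F s.
  move=> cF Fl; have [e e0 He] := continuous_near_gt0 cF Fl.
  exists (Num.min e (Num.min l (1 - l))).
    by rewrite !lt_min e0 l0 subr_gt0.
  move=> s; rewrite !lt_min => /and3P[/He Fs h1 h2]; split => //.
  move: h1 h2; rewrite !ltr_norml => /andP[h1 h2] /andP[h3 h4].
  by apply/andP; split; lra.
have ff'l : f (dot u (z l)) < f' (dot u (z l)) by apply: ff'; rewrite !ltW.
pose B := A f `\` A f'; have mB : measurable B.
  by apply: measurableD; exact: mA.
have cE i : continuous i -> continuous (fun l => dot v (z l) - i (dot u (z l))).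
  by move=> ?; exact: continuous_edge.
have cE' i : continuous i -> continuous (fun l => i (dot u (z l)) - dot v (z l)).
  move=> ci s; rewrite (_ : (fun l => _) = (fun l => - (dot v (z l) - i (dot u (z l))))).
    by apply: cvgN; exact: cE.
  by apply/funext => x; rewrite opprB.
pose nearB (C : set R) s := exists2 e, 0 < e & forall x, `|x - s| < e -> C x.
have inB s : f (dot u (z s)) < dot v (z s) -> dot v (z s) < f' (dot u (z s)) ->
    nearB B s.
  rewrite -subr_gt0 => h1; rewrite -subr_gt0 => h2.
  have [e1 e10 H1] := continuous_near_gt0 (cE _ cf) h1.
  have [e2 e20 H2] := continuous_near_gt0 (cE' _ cf') h2.
  exists (Num.min e1 e2); first by rewrite lt_min e10.
  move=> x; rewrite lt_min => /andP[/H1 + /H2]; rewrite !subr_gt0 => h3 h4.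
  by split=> //; rewrite /A /= => /lt_trans /(_ h4); rewrite ltxx.
have outB1 s : dot v (z s) < f (dot u (z s)) -> nearB (~` B) s.
  rewrite -subr_gt0 => h1; have [e1 e10 H1] := continuous_near_gt0 (cE' _ cf) h1.
  exists e1 => // x /H1; rewrite subr_gt0 => h3 [h4 _].
  by have := lt_trans h3 h4; rewrite ltxx.
have outB2 s : f' (dot u (z s)) < dot v (z s) -> nearB (~` B) s.
  rewrite -subr_gt0 => h1; have [e1 e10 H1] := continuous_near_gt0 (cE _ cf') h1.
  by exists e1 => // x /H1; rewrite subr_gt0 => h3 [_]; apply.
(* The strict gap between the graphs keeps the side points chosen near [l] away from the other
   graph. One of them has a neighbourhood in the strip, making the fraction positive; the other has
   one outside, making it less than [1]. *)
have [[s1 s1_01 [e1 e10 H1]] [s2 s2_01 [e2 e20 H2]]] :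
    (exists2 s, 0 < s < 1 & nearB B s) /\ (exists2 s, 0 < s < 1 & nearB (~` B) s).
  case: jf jl sides => ->; rewrite -/z => jl sides.
    have [|e e0 He] := nearl _ (cE' _ cf'); first by rewrite subr_gt0 -jl.
    have [l1' [l2' [/He[h1 h1'] /He[h2 h2'] h3 h4]]] := sides _ e0.
    split; [exists l1' => //|exists l2' => //]; last exact: outB1.
    by apply: inB => //; rewrite -subr_gt0.
  have [|e e0 He] := nearl _ (cE _ cf); first by rewrite subr_gt0 -jl.
  have [l1' [l2' [/He[h1 h1'] /He[h2 h2'] h3 h4]]] := sides _ e0.
  split; [exists l2' => //|exists l1' => //]; last exact: outB2.
  by apply: inB => //; rewrite -subr_gt0.
have -> : (I `&` A f) `\` (I `&` A f') = I `&` B.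
  apply/seteqP; split => s /=.
    by move=> [[Is h] h']; split => //; split => // h''; apply: h'.
  by move=> [Is [h h']]; split => // -[_].
apply/andP; split; first exact: (length_of_gt0 mB s1_01 e10 H1).
have -> : length_of (I `&` B) = 1 - length_of (I `&` ~` B).
  have <- : I `\` (I `&` B) = I `&` ~` B.
    by rewrite setDE setCI setIUr setICr set0U.
  rewrite length_ofD; last 3 first.
  - by apply: measurableI => //; exact: measurable_itv.
  - exact: bounded_measurable_itv.
  - by move=> ? [].
  by rewrite /I length_of_itv// subr0; ring.
rewrite gtrBl; apply: (length_of_gt0 _ s2_01 e20 H2).
exact: measurableC.
Qed.

(** By the intermediate value theorem, the height of the edge over the graph keeps one sign. *)
Lemma above_uncrossed f u v p q : continuous f ->
  (forall l, 0 <= l <= 1 -> f (dot u (seg p q l)) != dot v (seg p q l)) ->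
  above f (frame u v p) (frame u v q) = 0 \/
  above f (frame u v p) (frame u v q) = 1.
Proof.
move=> cf N; rewrite frac_setE.
pose F l := dot v (seg p q l) - f (dot u (seg p q l)).
have cF : continuous F by exact: continuous_edge.
have same s t : 0 <= s <= 1 -> 0 <= t <= 1 -> 0 < F s -> F t <= 0 -> False.
  move=> s01 t01 Fs Ft.
  have ivt x y : 0 <= x -> x <= y -> y <= 1 -> Num.min (F x) (F y) <= 0 ->
      0 <= Num.max (F x) (F y) -> False.
    move=> x0 xy y1 h1 h2.
    have [|c] := @IVT R F x y 0 xy (continuous_subspaceT cF); first by rewrite h1.
    rewrite in_itv/= => /andP[xc cy] /eqP; rewrite subr_eq0 eq_sym => e.
    by have := N c; rewrite e => /(_ _)/negP; apply => //; lra.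
  move: s01 t01 => /andP[s0 s1] /andP[t0 t1].
  have [st|/ltW ts] := leP s t.
    by apply: (ivt s t) => //; rewrite ?ge_min ?le_max ?Ft ?(ltW Fs) ?orbT.
  by apply: (ivt t s) => //; rewrite ?ge_min ?le_max ?Ft ?(ltW Fs) ?orbT.
have h0 : (0 : R) <= (0 : R) <= (1 : R) by lra.
have [F0|F0] := ltP 0 (F 0).
  right; rewrite (_ : _ `&` _ = `[0, 1]%classic); first by rewrite length_of_itv// subr0.
  apply/seteqP; split => l /=; first by case.
  move=> l01; split => //; rewrite -subr_gt0 ltNge; apply/negP => Fl.
  by apply: (same 0 l); rewrite // in_itv in l01.
left; rewrite (_ : _ `&` _ = set0); first by rewrite /length_of measure0.
apply/seteqP; split => l //= [l01]; rewrite -subr_gt0 => Fl.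
by apply: (same l 0); rewrite // in_itv in l01.
Qed.

End EdgeFractions.

(** * Hulls of vertex sets in barycentric coordinates *)

Section Hull.
Variable R : realType.
Implicit Types (u v w p q r x y z : plane R) (A T : {fset plane R}).
Local Open Scope fset_scope.
Local Open Scope ring_scope.

Lemma orient_neq0_distinct p q r : orient p q r != 0 -> [/\ p != q, q != r & p != r].
Proof.
move=> D0; split; apply: contra D0 => /eqP e; rewrite /orient det2E e; apply/eqP; ring.
Qed.

Lemma sum3 p q r (F : plane R -> R) : p != q -> q != r -> p != r ->
  \sum_(x <- [fset p; q; r]) F x = F p + F q + F r.
Proof.
move=> pq qr pr; rewrite fsetUC big_fsetU1; last first.
  by rewrite !inE negb_or eq_sym pr eq_sym qr.
by rewrite big_fsetU1 ?inE// big_seq_fset1/=; ring.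
Qed.

Lemma sum2 p q (F : plane R -> R) : p != q ->
  \sum_(x <- [fset p; q]) F x = F p + F q.
Proof. by move=> pq; rewrite big_fsetU1 ?inE// big_seq_fset1. Qed.

(** The vanishing clauses serve in contrapositive form: a nonzero coordinate at a vertex forces this
    vertex to belong to [A]. *)
Lemma hull_sub3 A p q r z : orient p q r != 0 -> A `<=` [fset p; q; r] -> hull A z ->
  exists a b c : R, [/\ 0 <= a, 0 <= b, 0 <= c, a + b + c = 1 &
    z = (a * p.1 + b * q.1 + c * r.1, a * p.2 + b * q.2 + c * r.2)] /\
  [/\ p \notin A -> a = 0, q \notin A -> b = 0 & r \notin A -> c = 0].
Proof.
move=> /orient_neq0_distinct[pq qr pr] AT [f [f0 f1 ->]].
pose F x := if x \in A then f x else 0.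
have F0 x : 0 <= F x by rewrite /F; case: ifPn => // /f0.
have E (G : plane R -> R) : \sum_(x <- A) f x * G x =
    F p * G p + F q * G q + F r * G r.
  rewrite -(@sum3 p q r (fun x => F x * G x))//.
  rewrite -(big_fset_incl _ AT); last by move=> x _ xA; rewrite /F (negbTE xA) mul0r.
  by apply: eq_big_seq => x xA; rewrite /F xA.
exists (F p), (F q), (F r); split.
  split => //.
    have := E (fun=> 1); rewrite !mulr1 => <-; rewrite -[RHS]f1.
    by apply: eq_bigr => x _; rewrite mulr1.
  by congr pair; exact: E.
by split; rewrite /F => /negbTE ->.
Qed.

Lemma hull3 p q r : orient p q r != 0 -> hull [fset p; q; r] = tri p q r.
Proof.
move=> D0; apply/seteqP; split => z.
  by move=> /(hull_sub3 D0 (fsubset_refl _))[a [b [c [h _]]]]; exists a, b, c.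
have [pq qr pr] := orient_neq0_distinct D0.
move=> [a [b [c [a0 b0 c0 abc ->]]]].
exists (fun x => if x == p then a else if x == q then b else c).
have e (G : plane R -> R) : \sum_(x <- [fset p; q; r])
    (if x == p then a else if x == q then b else c) * G x = a * G p + b * G q + c * G r.
  by rewrite sum3// !eqxx (eq_sym q) (negbTE pq) (eq_sym r p) (negbTE pr)
    (eq_sym r q) (negbTE qr).
split.
- by move=> x _; case: ifP => // _; case: ifP.
- have := e (fun=> 1); rewrite !mulr1 abc => <-.
  by apply: eq_bigr => x _; rewrite mulr1.
- by rewrite !e.
Qed.

Lemma hull2 p q l : p != q -> 0 <= l <= 1 -> hull [fset p; q] (seg p q l).
Proof.
move=> pq /andP[l0 l1]; exists (fun x => if x == p then 1 - l else l).
split; [|by rewrite sum2// eqxx eq_sym (negbTE pq); ring|].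
- by move=> x _; case: ifP => // _; rewrite subr_ge0.
- by rewrite !sum2// !eqxx !(eq_sym q) (negbTE pq) /seg; congr pair; ring.
Qed.

Lemma hull_vertex A p : p \in A -> hull A p.
Proof.
move=> pA; exists (fun x => (x == p)%:R); split => //.
- by rewrite (big_fsetD1 p)//= eqxx big1_fset ?addr0// => i; rewrite !inE => /andP[/negbTE -> _].
have e (G : plane R -> R) : \sum_(x <- A) (x == p)%:R * G x = G p.
  rewrite (big_fsetD1 p)//= eqxx mul1r big1_fset ?addr0// => i.
  by rewrite !inE => /andP[/negbTE -> _]; rewrite mul0r.
by rewrite !e -surjective_pairing.
Qed.

Lemma triangle_third T x y : is_triangle T -> x \in T -> y \in T -> x != y ->
  exists z, T = [fset x; y; z] /\ orient x y z != 0.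
Proof.
move=> [p [q [r [-> D0]]]]; rewrite -/(orient p q r) in D0.
have perm1 a b c : [fset a; b; c] = [fset b; a; c] :> {fset plane R}.
  by rewrite (fsetUC [fset a]).
have perm2 a b c : [fset a; b; c] = [fset a; c; b] :> {fset plane R}.
  by rewrite -!fsetUA (fsetUC [fset b]).
have s12 := orient_swap12; have s23 := orient_swap23.
rewrite !inE -!orbA => /or3P[] /eqP -> /or3P[] /eqP -> //; rewrite ?eqxx// => _.
- by exists r.
- by exists q; rewrite perm2 s23 oppr_eq0.
- by exists r; rewrite perm1 s12 oppr_eq0.
- by exists p; rewrite perm1 perm2 s23 s12 opprK.
- by exists q; rewrite perm2 perm1 s12 s23 opprK.
- by exists p; rewrite perm2 perm1 perm2 s23 s12 s23 !oppr_eq0.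
Qed.

End Hull.

(** * The neighbouring triangle across a crossed edge *)

Section Neighbour.
Variable R : realType.
Implicit Types (u v w p q r x y z : plane R) (T : {fset plane R}).
Implicit Types (M : {fset {fset plane R}}) (g h : R -> plane R) (t l e : R).

Lemma tri_closed_along g p q r t : smooth1 g -> orient p q r != 0 ->
  (forall e, 0 < e -> exists2 s, `|s - t| < e & tri p q r (g s)) ->
  tri p q r (g t).
Proof.
move=> sg D0 H.
have pos p' q' : (forall s, tri p q r (g s) ->
    0 <= orient p q r * orient p' q' (g s)) ->
    0 <= orient p q r * orient p' q' (g t).
  move=> K; rewrite leNgt; apply/negP; rewrite -oppr_gt0 => N.
  have [|e e0 He] := @continuous_near_gt0 _
    (fun s => - (orient p q r * orient p' q' (g s))) t _ N.
    move=> s; apply: cvgN; apply: cvgM; first exact: cvg_cst.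
    exact: continuous_orient.
  have [s /He st /K] := H _ e0.
  by rewrite -oppr_le0 leNgt st.
by apply/(tri_det _ D0); split; apply: pos => s /(tri_det _ D0) [].
Qed.

Lemma finite_min (I : eqType) (s : seq I) (P : I -> R -> Prop) :
  (forall i e e', P i e -> 0 < e' -> e' <= e -> P i e') ->
  (forall i, i \in s -> exists2 e, 0 < e & P i e) ->
  exists2 e, 0 < e & forall i, i \in s -> P i e.
Proof.
move=> mono; elim: s => [_|i s IH H]; first by exists 1.
have [e e0 He] := H i (mem_head _ _).
have [|e' e'0 He'] := IH; first by move=> j js; apply: H; rewrite inE js orbT.
exists (Num.min e e'); first by rewrite lt_min e0.
move=> j; rewrite inE => /predU1P[->|js].
  by apply: mono He _ _; rewrite ?lt_min ?e0// ge_min lexx.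
by apply: mono (He' _ js) _ _; rewrite ?lt_min ?e0// ge_min lexx orbT.
Qed.

Lemma tri_orient p q r (a b c : R) : a + b + c = 1 ->
  orient p q (a * p.1 + b * q.1 + c * r.1, a * p.2 + b * q.2 + c * r.2) =
  c * orient p q r.
Proof.
move=> abc; have -> : a = 1 - b - c by lra.
by rewrite /orient !det2E/=; ring.
Qed.

Lemma tri_orient2 p q r (a b c : R) : a + b + c = 1 ->
  orient q r (a * p.1 + b * q.1 + c * r.1, a * p.2 + b * q.2 + c * r.2) =
  a * orient p q r.
Proof.
move=> abc; have -> : a = 1 - b - c by lra.
by rewrite /orient !det2E/=; ring.
Qed.

Lemma tri_orient3 p q r (a b c : R) : a + b + c = 1 ->
  orient r p (a * p.1 + b * q.1 + c * r.1, a * p.2 + b * q.2 + c * r.2) =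
  b * orient p q r.
Proof.
move=> abc; have -> : a = 1 - b - c by lra.
by rewrite /orient !det2E/=; ring.
Qed.

(** The mesh may have a boundary, so the neighbour has to come from the curve: just beyond the
    crossed edge the curve is still covered. A triangle containing such points arbitrarily close to
    the crossing contains the crossing itself, and conformity makes it share the whole edge. *)
Lemma neighbour M g x y z t l : is_mesh M -> covers_curve M g -> smooth1 g ->
  [fset x; y; z]%fset \in M -> orient x y z != 0 -> 0 < l < 1 ->
  g t = seg x y l -> det2 (y - x) (velocity g t) != 0 ->
  exists2 z', [fset x; y; z']%fset \in M & orient x y z * orient x y z' < 0.
Proof.
move=> [triM meshM] cov sg TM D0 /andP[l0 l1] gt tr.
have Lt0 : orient x y (g t) = 0 by rewrite gt orient_seg.
have [e0 e00 side] := derive_neq0_sign (is_derive_orient x y t sg) tr Lt0.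
pose D := orient x y z; pose dl := det2 (y - x) (velocity g t).
have Ddl : D * dl != 0 by rewrite mulf_neq0.
have outside e : 0 < e -> exists2 s, `|s - t| < e & D * orient x y (g s) < 0.
  move=> e_gt0; pose e1 := Num.min e e0 / 2.
  have m0 : 0 < Num.min e e0 by rewrite lt_min e_gt0.
  have e10 : 0 < e1 by rewrite divr_gt0.
  have e1m : e1 < Num.min e e0 by rewrite ltr_pdivrMr// ltr_pMr// ltr1n.
  move: e1m; rewrite lt_min => /andP[e1e e1e0].
  (* The sign of the displacement is chosen to move away from [z]. *)
  pose n := - Num.sg (D * dl) * e1.
  have nn : `|n| = e1.
    by rewrite /n normrM normrN normr_sg Ddl mul1r gtr0_norm.
  have n0 : n != 0 by rewrite -normr_eq0 nn gt_eqF.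
  exists (t + n); first by rewrite addrC addKr nn.
  have := side (t + n); rewrite addrC addKr nn => /(_ e1e0).
  have tn : t + n != t by rewrite -subr_eq0 addrAC subrr add0r.
  move=> /(_ tn); rewrite -/dl /= => h.
  have h2 : 0 < - (D * dl) * n.
    by rewrite /n mulrA mulrNN mulrC mulr_gt0// mulrC -normrEsg normr_gt0.
  have h3 : 0 < (dl * (orient x y (g (t + n)) * n)) * (- (D * dl) * n).
    by rewrite mulr_gt0.
  move: h3; rewrite (_ : _ * _ = (dl * n) ^+ 2 * - (D * orient x y (g (t + n)))).
    rewrite pmulr_rgt0 ?oppr_gt0// exprn_even_gt0// mulf_neq0//.
  by ring.
(* The mesh is finite: if each triangle avoided the points beyond the edge within some radius of
   [t], the least radius would leave such a point uncovered. *)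
have [T' T'M acc] : exists2 T', T' \in M & forall e, 0 < e ->
    exists s, [/\ `|s - t| < e, D * orient x y (g s) < 0 & hull T' (g s)].
  apply: contrapT => N.
  have [||e e_gt0 He] := @finite_min _ (enum_fset M) (fun T' e => forall s,
      `|s - t| < e -> D * orient x y (g s) < 0 -> ~ hull T' (g s)).
  - by move=> T' e e' He _ e'e s st; apply: He; exact: lt_le_trans st e'e.
  - move=> T' T'M; apply: contrapT => N'; apply: N; exists T' => // e e_gt0.
    apply: contrapT => N''; apply: N'; exists e => // s st Ds Ts; apply: N''.
    by exists s.
  have [s st Ds] := outside e e_gt0; have [T' T'M] := cov s.
  exact: (He T' T'M s st Ds).
have [p [q [r [T'E D'0]]]] := triM _ T'M; rewrite -/(orient p q r) in D'0.
have T'gt : hull T' (g t).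
  rewrite T'E hull3//; apply: tri_closed_along => // e /acc[s [st _]].
  by rewrite T'E hull3//; exists s.
have [xy yz xz] := orient_neq0_distinct D0.
have Tgt : hull [fset x; y; z]%fset (g t).
  rewrite hull3// gt; exists (1 - l), l, 0; split => //; rewrite ?subr_ge0 ?ltW//.
    by ring.
  by rewrite /seg; congr pair; ring.
(* Conformity: the crossing lies in the hull of the common vertices. Its coordinates [1 - l] and [l]
   at [x] and [y] are nonzero, so both are common vertices. *)
have : hull ([fset x; y; z] `&` T')%fset (g t) by rewrite -meshM.
move=> /(hull_sub3 D0 (fsubsetIl _ _)) [a [b [c [[a0 b0 c0 abc gE] [xA yA _]]]]].
have eb : b = l.
  apply: (mulIf D0); rewrite -(tri_orient3 x y z abc) -gE gt.
  by rewrite /seg /orient !det2E/=; ring.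
have ea : a = 1 - l.
  apply: (mulIf D0); rewrite -(tri_orient2 x y z abc) -gE gt.
  by rewrite /seg /orient !det2E/=; ring.
have xT' : x \in T'.
  have : x \in ([fset x; y; z] `&` T')%fset.
    by apply: contraT => /xA; rewrite ea => h; move: l1; rewrite -subr_gt0 h ltxx.
  by rewrite inE => /andP[].
have yT' : y \in T'.
  have : y \in ([fset x; y; z] `&` T')%fset.
    by apply: contraT => /yA; rewrite eb => h; move: l0; rewrite h ltxx.
  by rewrite inE => /andP[].
have [z' [T'E' D''0]] := triangle_third (triM _ T'M) xT' yT' xy.
exists z'; first by rewrite -T'E'.
have [s [_ Ds]] := acc _ ltr01; rewrite T'E' hull3//.
move=> [a' [b' [c' [a'0 b'0 c'0 abc' gs]]]]; move: Ds; rewrite gs tri_orient//.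
by rewrite mulrCA -/D; move: c'0; rewrite le_eqVlt => /predU1P[<-|c'0];
  rewrite ?mul0r ?ltxx// pmulr_rlt0.
Qed.

End Neighbour.

(** * Separated graphs cross every edge of a triangle they meet *)

Section ArcsMeet.
Variable R : realType.
Implicit Types (u v w p q r x y z : plane R) (T : {fset plane R}).
Implicit Types (M : {fset {fset plane R}}) (g h i : R -> plane R).
Implicit Types (a b t l k e : R) (f : R -> R).

Lemma in_range_seg g a b u p q l : 0 <= l <= 1 -> in_range g a b u p ->
  in_range g a b u q -> in_range g a b u (seg p q l).
Proof.
move=> l01 hp hq.
have := seg_range (p := frame u u p) (q := frame u u q) l01 hp hq.
by rewrite seg_frame.
Qed.

Definition triangle_edge p q r x y : Prop :=
  [\/ x = p /\ y = q, x = q /\ y = r | x = r /\ y = p].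

(** The range hypothesis places the end of the arc beyond the triangle, so the arc must leave it
    after [t]; as vertices are avoided, it does so at an interior point of an edge. *)
Lemma arc_crosses_edge i a b u v f p q r t : smooth1 i -> det2 u v != 0 ->
  is_arc i a b u -> is_graph i a b u v f -> orient p q r != 0 ->
  (forall x, [\/ x = p, x = q | x = r] -> in_range i a b u x) ->
  (forall x y, triangle_edge p q r x y -> transverse i x y) ->
  (forall x s, [\/ x = p, x = q | x = r] -> i s <> x) ->
  t \in `[a, b] -> tri p q r (i t) ->
  exists x y l, [/\ triangle_edge p q r x y, 0 < l < 1,
    f (dot u (seg x y l)) = dot v (seg x y l) &
   forall e, 0 < e -> exists l1 l2, [/\ `|l1 - l| < e, `|l2 - l| < e,
    f (dot u (seg x y l1)) < dot v (seg x y l1) &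
    dot v (seg x y l2) < f (dot u (seg x y l2))]].
Proof.
move=> si D0 ai gi T0 range tr avoid tab Tt.
have xp : [\/ p = p, p = q | p = r] by constructor 1.
have xq : [\/ q = p, q = q | q = r] by constructor 2.
have xr : [\/ r = p, r = q | r = r] by constructor 3.
have Tb : ~ tri p q r (i b).
  move=> Tb; have Tb' := Tb; rewrite -(tri_frame _ _ _ _ D0) in Tb'.
  have /andP[_] := tri_range Tb' (range _ xp) (range _ xq) (range _ xr).
  by rewrite ltxx.
have [at_ tb] : a <= t /\ t <= b by move: tab; rewrite in_itv/= => /andP[].
have [s /andP[ts sb] [l [l01 Hl]]] := arc_exits si tb T0 Tt Tb.
have [x [y [exy isE]]] : exists x y, triangle_edge p q r x y /\ i s = seg x y l.
  case: Hl => E; [exists p, q|exists q, r|exists r, p]; split => //;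
    [constructor 1|constructor 2|constructor 3]; by [].
have [vx vy] : [\/ x = p, x = q | x = r] /\ [\/ y = p, y = q | y = r].
  by case: exy => -[-> ->].
have l0 : l != 0.
  apply/eqP => l00; apply: (avoid x s vx).
  by rewrite isE l00 /seg !mul0r !addr0 -surjective_pairing.
have l1 : l != 1.
  apply/eqP => l11; apply: (avoid y s vy).
  by rewrite isE l11 /seg !mul1r !(addrC _ (_ - _)) !subrK -surjective_pairing.
have l01' : 0 < l < 1 by move: l01 => /andP[h1 h2]; rewrite !lt_neqAle eq_sym l0 h1 l1.
have /andP[r1 r2] := in_range_seg l01 (range _ vx) (range _ vy).
rewrite -isE in r1 r2.
have as_ : a < s.
  rewrite lt_neqAle (le_trans at_ ts) andbT; apply/eqP => e.
  by move: r1; rewrite e ltxx.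
have sb' : s < b.
  rewrite lt_neqAle sb andbT; apply/eqP => e.
  by move: r2; rewrite e ltxx.
exists x, y, l; split => //.
  by rewrite -isE; have [_] := gi; apply; rewrite in_itv/= !ltW.
move=> e e0; apply: (crossing_sides si D0 gi _ l01' isE (tr _ _ exy) e0).
by rewrite as_.
Qed.

(** For an uncrossed edge both terms of [fraction] are [0] or [1], so their difference cannot lie
    strictly between [0] and [1]. But it does so on the edge through which an arc leaves, hence on
    all three by equality. *)
Lemma edge_crossed g h a b a' b' u v f f' p q r (X Y : R) :
  smooth1 g -> smooth1 h -> det2 u v != 0 ->
  is_arc g a b u -> is_arc h a' b' u ->
  is_graph g a b u v f -> is_graph h a' b' u v f' -> orient p q r != 0 ->
  (forall x, [\/ x = p, x = q | x = r] ->
    [/\ in_range g a b u x, in_range h a' b' u x & X < dot u x < Y]) ->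
  (forall c, X < c < Y -> f c < f' c) ->
  (forall i, i = g \/ i = h ->
    (forall x y, triangle_edge p q r x y -> transverse i x y) /\
    (forall x s, [\/ x = p, x = q | x = r] -> i s <> x)) ->
  (let fraction x y := above f (frame u v x) (frame u v y)
     - above f' (frame u v x) (frame u v y) in
  fraction p q = fraction q r /\ fraction q r = fraction r p) ->
  (exists2 t, t \in `[a, b] & tri p q r (g t)) \/
  (exists2 t, t \in `[a', b'] & tri p q r (h t)) ->
  exists2 l, 0 <= l <= 1 & (exists2 t, t \in `[a, b] & g t = seg p q l) \/
    (exists2 t, t \in `[a', b'] & h t = seg p q l).
Proof.
move=> sg sh D0 ga ha gf hf T0 range ff' gp.
set fraction := (fun x y => _); move=> [] fr1 fr2 meets.
have [cf _] := gf; have [cf' _] := hf.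
have [trg avg] := gp _ (or_introl erefl); have [trh avh] := gp _ (or_intror erefl).
have XY x y l : triangle_edge p q r x y -> 0 <= l <= 1 -> X < dot u (seg x y l) < Y.
  move=> exy l01.
  have [vx vy] : [\/ x = p, x = q | x = r] /\ [\/ y = p, y = q | y = r].
    by case: exy => -[-> ->]; split; try (by constructor 1); try (by constructor 2);
      try (by constructor 3).
  have [_ _ hx] := range _ vx; have [_ _ hy] := range _ vy.
  have := seg_range (p := frame u u x) (q := frame u u y) l01 hx hy.
  by rewrite seg_frame.
have [x [y [exy fxy]]] : exists x y, triangle_edge p q r x y /\ 0 < fraction x y < 1.
  case: meets => -[t tab Tt].
    have [//|x [y [l [exy l01 fl sides]]]] := arc_crosses_edge sg D0 ga gf T0 _ trg avg tab Tt.
      by move=> x /range[].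
    exists x, y; split => //; apply: (@fraction_between _ f f' u v x y l) => //.
      by move=> s s01; apply: ff'; exact: XY.
    by exists f; split => //; left.
  have [//|x [y [l [exy l01 fl sides]]]] := arc_crosses_edge sh D0 ha hf T0 _ trh avh tab Tt.
    by move=> x /range[].
  exists x, y; split => //; apply: (@fraction_between _ f f' u v x y l) => //.
    by move=> s s01; apply: ff'; exact: XY.
  by exists f'; split => //; right.
have fpq : 0 < fraction p q < 1.
  by case: exy => -[ex ey]; move: fxy; rewrite ex ey ?fr1 ?fr2.
have xp : [\/ p = p, p = q | p = r] by constructor 1.
have xq : [\/ q = p, q = q | q = r] by constructor 2.
have [rgp rhp _] := range _ xp; have [rgq rhq _] := range _ xq.
have onarc i c d j l : smooth1 i -> is_arc i c d u -> is_graph i c d u v j ->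
    in_range i c d u p -> in_range i c d u q -> 0 <= l <= 1 ->
    j (dot u (seg p q l)) = dot v (seg p q l) ->
    exists2 t, t \in `[c, d] & i t = seg p q l.
  move=> si ai gi rp rq l01 jl.
  have [t [tcd ut jt]] := graph_below si ai gi (in_range_seg l01 rp rq).
  by exists t => //; apply: (frame_inj D0); rewrite /frame ut -jt jl.
apply: contrapT => N; move: fpq; rewrite /fraction.
have [|->|->] := @above_uncrossed _ f u v p q cf.
- move=> l l01; apply/eqP => fl; apply: N; exists l => //; left.
  exact: (onarc g a b f).
- have [|->|->] := @above_uncrossed _ f' u v p q cf'.
  + move=> l l01; apply/eqP => fl; apply: N; exists l => //; right.
    exact: (onarc h a' b' f').
  + by rewrite subrr ltxx.
  + by rewrite sub0r oppr_gt0 ltNge ler01.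
- have [|->|->] := @above_uncrossed _ f' u v p q cf'.
  + move=> l l01; apply/eqP => fl; apply: N; exists l => //; right.
    exact: (onarc h a' b' f').
  + by rewrite subr0 ltxx andbF.
  + by rewrite subrr ltxx.
Qed.

End ArcsMeet.

(** * Two arcs with the same data meet *)

Section Meet.
Variable R : realType.
Implicit Types (u v w p q r x y z : plane R) (T : {fset plane R}).
Implicit Types (M : {fset {fset plane R}}) (g h i : R -> plane R).
Implicit Types (a b t l k e : R) (f : R -> R).

Lemma seq_max (I : eqType) (s : seq I) (F : I -> R) : s != [::] ->
  exists2 i, i \in s & forall j, j \in s -> F j <= F i.
Proof.
elim: s => // i [_ _|j s IH _].
  by exists i; [rewrite inE|move=> j; rewrite inE => /eqP ->].
have [//|m ms Hm] := IH; have [im|mi] := leP (F i) (F m).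
  exists m; first by rewrite inE ms orbT.
  by move=> n; rewrite inE => /predU1P[->//|/Hm].
exists i; first by rewrite mem_head.
by move=> n; rewrite inE => /predU1P[->//|/Hm /le_trans]; apply; exact: ltW.
Qed.

Lemma avoid_seq (s : seq R) (a b : R) : a < b ->
  exists2 c, a < c < b & c \notin s.
Proof.
move=> ab; suff [c [d [ac cd db H]]] : exists c d, [/\ a < c, c < d, d < b &
    forall t, c < t < d -> t \notin s].
  exists ((c + d) / 2); first by apply/andP; split; lra.
  by apply: H; apply/andP; split; lra.
elim: s => [|t s [c [d [ac cd db H]]]].
  exists (a + (b - a) / 3), (a + (b - a) / 2); split => //; lra.
have [xc|cx] := leP t c.
  exists c, d; split => // y cyd; rewrite inE negb_or H// andbT.
  by move: cyd => /andP[cy _]; rewrite gt_eqF// (le_lt_trans xc cy).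
have [xd|dx] := ltP t d.
  exists c, t; split => //; first exact: lt_trans db.
  move=> y /andP[cy yx]; rewrite inE negb_or lt_eqF//= H// cy.
  exact: lt_trans xd.
exists c, d; split => // y cyd; rewrite inE negb_or H// andbT.
by move: cyd => /andP[_ yd]; rewrite lt_eqF// (lt_le_trans yd dx).
Qed.

Lemma line_diff p q r c : p.1 != q.1 -> p.1 != r.1 ->
  line p q c - line p r c =
  - orient p q r * ((c - p.1) / ((q.1 - p.1) * (r.1 - p.1))).
Proof.
move=> pq pr; rewrite /line /orient det2E; field.
by rewrite !subr_eq0 !(eq_sym _ p.1) pq pr.
Qed.

(** Positive orientation puts [r] above the line [p q]; whichever of the edges [p r] and [r q] spans
    the abscissa [c] passes above it there. *)
Lemma line_higher p q r c : p.1 < c < q.1 -> 0 < orient p q r ->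
  r.1 != c -> (c < r.1 /\ line p q c < line p r c) \/
              (r.1 < c /\ line p q c < line r q c).
Proof.
move=> /andP[pc cq] D0; have pq := lt_trans pc cq.
have [rc _|cr _|//] := ltgtP r.1 c.
  right; split => //; have rq := lt_trans rc cq.
  rewrite line_sym ?lt_eqF// (@line_sym _ r) ?lt_eqF//.
  rewrite -subr_lt0 line_diff ?gt_eqF// orient_swap12 opprK pmulr_rlt0//.
  rewrite nmulr_rlt0 ?subr_lt0// invr_gt0 nmulr_rgt0 ?subr_lt0//.
left; split => //; have pr := lt_trans pc cr.
rewrite -subr_lt0 line_diff ?lt_eqF// mulNr oppr_lt0 mulr_gt0//.
by rewrite divr_gt0 ?mulr_gt0 ?subr_gt0.
Qed.

Lemma gp_transverse i M T x y : general_position i M -> T \in M ->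
  x \in T -> y \in T -> x != y -> transverse i x y.
Proof.
move=> [_ gp] TM xT yT xy t l l01 e; apply: (gp T x y t TM xT yT xy).
by rewrite e; exact: (hull2 xy l01).
Qed.

(** The highest edge crossing exists because the mesh is finite. No vertex lies on the line [s0], so
    every edge considered straddles it strictly. The family of triangles met by an arc is stable
    under passing to the neighbour, which contains the same crossing point of the common edge. *)
Lemma not_separated M g h a b a' b' u v f f' (s0 H : R) :
  smooth1 g -> smooth1 h -> det2 u v != 0 ->
  is_arc g a b u -> is_arc h a' b' u ->
  is_graph g a b u v f -> is_graph h a' b' u v f' ->
  is_mesh M -> covers_curve M g -> covers_curve M h ->
  general_position g M -> general_position h M -> 0 < H ->
  (forall T x y, T \in M -> x \in T -> y \in T -> `|dot u x - dot u y| <= H) ->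
  (forall T x, T \in M -> x \in T -> dot u x != s0) ->
  (forall z, `|dot u z - s0| < 2 * H -> in_range g a b u z /\ in_range h a' b' u z) ->
  (forall c, `|c - s0| < 2 * H -> f c < f' c) ->
  (forall p q r, [fset p; q; r]%fset \in M -> orient p q r != 0 ->
    (forall x, [\/ x = p, x = q | x = r] -> `|dot u x - s0| <= H) ->
    (exists2 t, t \in `[a, b] & tri p q r (g t)) \/
    (exists2 t, t \in `[a', b'] & tri p q r (h t)) ->
    let fraction x y := above f (frame u v x) (frame u v y)
     - above f' (frame u v x) (frame u v y) in
    fraction p q = fraction q r /\ fraction q r = fraction r p) -> False.
Proof.
move=> sg sh D0 ga ha gf hf mesh covg covh gpg gph H0 diamM avoid range ff' frac.
have triM := mesh.1.
pose meets T := (exists2 t, t \in `[a, b] & hull T (g t)) \/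
    (exists2 t, t \in `[a', b'] & hull T (h t)).
pose pairs T (xy : plane R * plane R) := [/\ T \in M, xy.1 \in T, xy.2 \in T,
  dot u xy.1 < s0 < dot u xy.2 & meets T].
(* every edge across the line [s0] is shared by two triangles of the family,
   one on each side *)
have both_sides T x y : pairs T (x, y) -> exists2 z,
    pairs [fset x; y; z]%fset (x, y) & 0 < det2 u v * orient x y z.
  move=> [/= TM xT yT /andP[xs sy] mT].
  have xy : x != y by apply: contraTN (lt_trans xs sy) => /eqP ->; rewrite ltxx.
  have [z [TE T0]] := triangle_third (triM _ TM) xT yT xy.
  have zT : z \in T by rewrite TE !inE eqxx !orbT.
  have near p : p \in T -> `|dot u p - s0| <= H.
    move=> pT; have := diamM _ _ _ TM pT xT; have := diamM _ _ _ TM pT yT.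
    by rewrite !ler_norml; clear - xs sy => /andP[h1 h2] /andP[h3 h4]; apply/andP; split; lra.
  have vT p : [\/ p = x, p = y | p = z] -> p \in T by case=> ->.
  have [xy' yz' xz'] := orient_neq0_distinct T0.
  have edgeT i : general_position i M -> (forall p q, triangle_edge x y z p q ->
      transverse i p q) /\ (forall p s, [\/ p = x, p = y | p = z] -> i s <> p).
    move=> gp; split.
      move=> p q e; apply: (gp_transverse gp TM).
      - by case: e => -[-> _].
      - by case: e => -[_ ->].
      - by case: e => -[-> ->] //; rewrite eq_sym.
    by move=> p s /vT pT e; have := gp.1 _ _ s TM pT; rewrite e eqxx.
  have meets_tri : (exists2 t, t \in `[a, b] & tri x y z (g t)) \/
      (exists2 t, t \in `[a', b'] & tri x y z (h t)).
    by case: mT => -[t tab]; rewrite TE hull3// => Tt; [left|right]; exists t.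
  have TM' : [fset x; y; z]%fset \in M by rewrite -TE.
  have [||||l l01 cross] := @edge_crossed _ g h a b a' b' u v f f' x y z
    (s0 - 2 * H) (s0 + 2 * H) sg sh D0 ga ha gf hf T0 _ _ _ _ meets_tri.
  - move=> p /vT/near pH; have pH' : `|dot u p - s0| < 2 * H.
      by apply: le_lt_trans pH _; lra.
    have [? ?] := range _ pH'; split => //.
    by clear - pH'; move: pH'; rewrite ltr_norml => /andP[? ?]; apply/andP; split; lra.
  - by move=> c /andP[h1 h2]; apply: ff'; clear - h1 h2; rewrite ltr_norml; apply/andP; split; lra.
  - by move=> i [->|->]; exact: edgeT.
  - by apply: frac => // p /vT/near.
  have nb i t c d : i = g \/ i = h -> t \in `[c, d] -> i t = seg x y l ->
      exists2 z', [fset x; y; z']%fset \in M & orient x y z * orient x y z' < 0.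
    move=> ii tcd it.
    have gp : general_position i M by case: ii => ->.
    have sm : smooth1 i by case: ii => ->.
    have cov : covers_curve M i by case: ii => ->.
    have [tr av] := edgeT _ gp.
    have txy : transverse i x y by apply: tr; constructor 1.
    apply: (@neighbour _ M i x y z t l) => //; last exact: txy l01 it.
    move: l01 => /andP[l0 l1]; rewrite !lt_neqAle l0 l1 !andbT.
    apply/andP; split.
      apply/eqP => e; apply: (av x t); first by constructor 1.
      by rewrite it -e /seg !mul0r !addr0 -surjective_pairing.
    apply/eqP => e; apply: (av y t); first by constructor 2.
    by rewrite it e /seg !mul1r !(addrC _ (_ - _)) !subrK -surjective_pairing.
  have [z' zM zz'] : exists2 z', [fset x; y; z']%fset \in M &
      orient x y z * orient x y z' < 0.
    by case: cross => -[t tcd it]; [apply: (nb g t a b)|apply: (nb h t a' b')] => //;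
      [left|right].
  have mz' : meets [fset x; y; z']%fset.
    have hl : hull [fset x; y; z']%fset (seg x y l).
      have Tz' : orient x y z' != 0.
        by apply/eqP => e; move: zz'; rewrite e mulr0 ltxx.
      rewrite hull3//; move: l01 => /andP[l0 l1].
      exists (1 - l), l, 0; split => //; rewrite ?subr_ge0//; first by ring.
      by rewrite /seg; congr pair; ring.
    by case: cross => -[t tcd it]; [left|right]; exists t => //; rewrite it.
  have inE3 p : [/\ x \in [fset x; y; p]%fset & y \in [fset x; y; p]%fset].
    by split; rewrite !inE eqxx ?orbT.
  (* The third vertices [z] and [z'] are on opposite sides of the edge; the triangle lying above it
     in the frame is kept. *)
  have [|neg|/eqP] := ltgtP 0 (det2 u v * orient x y z).
  - exists z => //; have [? ?] := inE3 z.
    by split => //=; [rewrite xs sy|rewrite -TE].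
  - exists z'; first by have [? ?] := inE3 z'; split => //=; rewrite xs sy.
    rewrite -(nmulr_rlt0 _ neg) mulrACA pmulr_rlt0//.
    by rewrite -expr2 exprn_even_gt0.
  - by rewrite eq_sym mulf_eq0 (negbTE D0) (negbTE T0).
pose V := flatten [seq enum_fset T | T <- enum_fset M].
have VP T x : T \in M -> x \in T -> x \in V.
  by move=> TM xT; apply/flattenP; exists (enum_fset T) => //; apply/mapP; exists T.
pose S := [seq xy <- [seq (x, y) | x <- V, y <- V] | `[< exists T, pairs T xy >]].
have SP T xy : pairs T xy -> xy \in S.
  move=> pT; rewrite mem_filter; apply/andP; split; first by apply/asboolP; exists T.
  case: pT => TM xT yT _ _; rewrite [xy]surjective_pairing.
  by apply/allpairsP; exists xy; split=> //; exact: VP TM _.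
pose F (xy : plane R * plane R) := line (frame u v xy.1) (frame u v xy.2) s0.
have S0 : S != [::].
  have n0 : u.1 ^+ 2 + u.2 ^+ 2 != 0.
    apply: contra D0 => /eqP e.
    have u1 : u.1 = 0.
      by apply/eqP; rewrite -sqrf_eq0; have := sqr_ge0 u.1; have := sqr_ge0 u.2; lra.
    have u2 : u.2 = 0.
      by apply/eqP; rewrite -sqrf_eq0; have := sqr_ge0 u.1; have := sqr_ge0 u.2; lra.
    by rewrite /det2 u1 u2 !mul0r subrr.
  (* A point with [u]-coordinate [s0], to which [range] applies: the arc [g] therefore reaches the
     line [s0], inside some triangle of the mesh. *)
  pose o : plane R := (s0 * u.1 / (u.1 ^+ 2 + u.2 ^+ 2), s0 * u.2 / (u.1 ^+ 2 + u.2 ^+ 2)).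
  have os0 : dot u o = s0 by rewrite /dot /o /=; field.
  have [ro _] : in_range g a b u o /\ in_range h a' b' u o.
    by apply: range; rewrite os0 subrr normr0; lra.
  have [t [tab ut _]] := graph_below sg ga gf ro; rewrite os0 in ut.
  have [T TM Tt] := covg t.
  have [p [q [r [TE T0]]]] := triM _ TM; rewrite -/(orient p q r) in T0.
  have Tt' := Tt; rewrite TE hull3// in Tt'.
  have vT x : [\/ x = p, x = q | x = r] -> x \in T.
    by rewrite TE !inE => -[] ->; rewrite eqxx ?orbT.
  have pT : p \in T by apply: vT; constructor 1.
  have qT : q \in T by apply: vT; constructor 2.
  have rT : r \in T by apply: vT; constructor 3.
  have bd x : x \in T -> dot u p - (H + 1) < dot u x < dot u p + (H + 1).
    move=> xT; have := diamM _ _ _ TM xT pT; rewrite ler_norml; clear => /andP[? ?].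
    by apply/andP; split; lra.
  rewrite -(tri_frame _ _ _ _ D0) in Tt'.
  (* If all vertices were on one side of the line [s0], the whole triangle would be, by
     convexity. *)
  have [x xT xs] : exists2 x, x \in T & dot u x < s0.
    apply: contrapT => N.
    have lo x : x \in T -> s0 < dot u x < dot u p + (H + 1).
      move=> xT; have /andP[_ ->] := bd x xT; rewrite andbT.
      have := avoid _ _ TM xT; case: ltgtP => // xs _.
      by exfalso; apply: N; exists x.
    have := tri_range Tt' (lo p pT) (lo q qT) (lo r rT).
    by rewrite /= ut ltxx.
  have [y yT sy] : exists2 y, y \in T & s0 < dot u y.
    apply: contrapT => N.
    have hi x0 : x0 \in T -> dot u p - (H + 1) < dot u x0 < s0.
      move=> x0T; have /andP[-> _] := bd x0 x0T; rewrite /=.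
      have := avoid _ _ TM x0T; case: ltgtP => // x0s _.
      by exfalso; apply: N; exists x0.
    have := tri_range Tt' (hi p pT) (hi q qT) (hi r rT).
    by rewrite /= ut ltxx andbF.
  have : (x, y) \in S.
    by apply: (SP T); split => //=; [rewrite xs sy|left; exists t].
  by case: (S).
have [[x y] xyS maxF] := seq_max F S0.
have [T pT] : exists T, pairs T (x, y).
  by move: xyS; rewrite mem_filter => /andP[/asboolP].
have [z pz oz] := both_sides _ _ _ pT.
have [zM xT yT /andP[/= xs sy] mT] := pz.
have zT : z \in [fset x; y; z]%fset by rewrite !inE eqxx !orbT.
have [|||[sz lz]|[zs lz]] := @line_higher (frame u v x) (frame u v y) (frame u v z) s0.
- by rewrite /= xs sy.
- by rewrite orient_frame.
- exact: avoid zM zT.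
- have /SP/maxF : pairs [fset x; y; z]%fset (x, z) by split => //=; rewrite xs sz.
  by rewrite leNgt /F /= lz.
- have /SP/maxF : pairs [fset x; y; z]%fset (z, y) by split => //=; rewrite zs sy.
  by rewrite leNgt /F /= lz.
Qed.

Lemma arcs_meet M g h a b a' b' u v k (c0 H : R) :
  smooth1 g -> smooth1 h -> det2 u v != 0 -> 0 < k ->
  is_arc g a b u -> is_arc g a b (u + k *: v) ->
  is_arc h a' b' u -> is_arc h a' b' (u + k *: v) ->
  is_mesh M -> covers_curve M g -> covers_curve M h ->
  general_position g M -> general_position h M -> 0 < H ->
  (forall T x y, T \in M -> x \in T -> y \in T -> `|dot u x - dot u y| <= H) ->
  (forall z, `|dot u z - c0| < 3 * H -> in_range g a b u z /\ in_range h a' b' u z) ->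
  (forall T, T \in M -> (forall x, x \in T -> `|dot u x - c0| <= 2 * H) ->
    (exists2 t, t \in `[a, b] & hull T (g t)) \/
    (exists2 t, t \in `[a', b'] & hull T (h t)) ->
    (forall x, x \in T -> in_range g a b (u + k *: v) x /\
       in_range h a' b' (u + k *: v) x) /\
    (forall w, w = u \/ w = u + k *: v ->
   \int[@lebesgue_measure R]_(t in [set t | hull T (g t)] `&` `[a, b]%classic)
     dot w (velocity g t) =
   \int[@lebesgue_measure R]_(t in [set t | hull T (h t)] `&` `[a', b']%classic)
     dot w (velocity h t))) ->
  exists t s, [/\ t \in `[a, b], s \in `[a', b'], g t = h s &
    `|dot u (g t) - c0| < 3 * H].
Proof.
move=> sg sh D0 k0 ga ga' ha ha' mesh covg covh gpg gph H0 diamM range data.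
have [f [f' [gf hf frac]]] := equal_edge_fractions sg sh D0 k0 ga ga' ha ha'.
pose V := flatten [seq enum_fset T | T <- enum_fset M].
have VP T x : T \in M -> x \in T -> dot u x \in [seq dot u x | x <- V].
  move=> TM xT; apply: map_f; apply/flattenP; exists (enum_fset T) => //.
  by apply/mapP; exists T.
(* The line is moved off the finitely many vertex coordinates; a shift of less than [H] keeps the
   window of radius [2 * H] about [s0] inside that of radius [3 * H] about [c0]. *)
have [|s0 /andP[s01 s02] s0V] := @avoid_seq [seq dot u x | x <- V] c0 (c0 + H).
  by rewrite ltrDl.
have n0 : u.1 ^+ 2 + u.2 ^+ 2 != 0.
  apply: contra D0 => /eqP e.
  have u1 : u.1 = 0.
    by apply/eqP; rewrite -sqrf_eq0; have := sqr_ge0 u.1; have := sqr_ge0 u.2; lra.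
  have u2 : u.2 = 0.
    by apply/eqP; rewrite -sqrf_eq0; have := sqr_ge0 u.1; have := sqr_ge0 u.2; lra.
  by rewrite /det2 u1 u2 !mul0r subrr.
pose o c : plane R := (c * u.1 / (u.1 ^+ 2 + u.2 ^+ 2), c * u.2 / (u.1 ^+ 2 + u.2 ^+ 2)).
have oE c : dot u (o c) = c by rewrite /dot /o /=; field.
have near3 c : `|c - s0| < 2 * H -> `|c - c0| < 3 * H.
  by rewrite !ltr_norml; clear - s01 s02 => /andP[? ?]; apply/andP; split; lra.
apply: contrapT => N.
have ff' c : `|c - s0| < 2 * H -> f c != f' c.
  move=> /near3 cc; apply/eqP => e; have := range (o c); rewrite oE => /(_ cc)[rg rh].
  have [t [tab ut ft]] := graph_below sg ga gf rg.
  have [s [sab us fs]] := graph_below sh ha hf rh.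
  rewrite !oE in ut us ft fs.
  apply: N; exists t, s; split => //; last by rewrite ut.
  by apply: (frame_inj D0); rewrite /frame ut us -ft -fs e.
have avoid T x : T \in M -> x \in T -> dot u x != s0.
  by move=> TM xT; apply: contraNneq s0V => <-; exact: VP TM xT.
have range2 z : `|dot u z - s0| < 2 * H -> in_range g a b u z /\ in_range h a' b' u z.
  by move=> /near3; exact: range.
have key p q r : [fset p; q; r]%fset \in M -> orient p q r != 0 ->
    (forall x, [\/ x = p, x = q | x = r] -> `|dot u x - s0| <= H) ->
    (exists2 t, t \in `[a, b] & tri p q r (g t)) \/
    (exists2 t, t \in `[a', b'] & tri p q r (h t)) ->
    let fraction x y := above f (frame u v x) (frame u v y)
     - above f' (frame u v x) (frame u v y) in
    fraction p q = fraction q r /\ fraction q r = fraction r p.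
  move=> TM T0 near meets.
  have xT x : x \in [fset p; q; r]%fset -> [\/ x = p, x = q | x = r].
    by rewrite !inE -orbA => /or3P[] /eqP ->; [constructor 1|constructor 2|constructor 3].
  have Tx x : [\/ x = p, x = q | x = r] -> x \in [fset p; q; r]%fset.
    by rewrite !inE => -[] ->; rewrite eqxx ?orbT.
  have [||rg2 ints] := data _ TM.
  - move=> x /xT/near; clear - s01 s02; rewrite !ler_norml => /andP[? ?]; apply/andP; split; lra.
  - by rewrite hull3.
  have [pq qr pr] := orient_neq0_distinct T0.
  have rg3 x w : [\/ x = p, x = q | x = r] -> w = u \/ w = u + k *: v ->
      in_range g a b w x /\ in_range h a' b' w x.
    move=> xv [->|->]; last exact/rg2/Tx.
    by apply: range2; apply: le_lt_trans (near _ xv) _; clear - H0; lra.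
  have pT : p \in [fset p; q; r]%fset by apply: Tx; constructor 1.
  have qT : q \in [fset p; q; r]%fset by apply: Tx; constructor 2.
  have rT : r \in [fset p; q; r]%fset by apply: Tx; constructor 3.
  have rp : r != p by rewrite eq_sym.
  have trs i : i = g \/ i = h ->
      [/\ transverse i p q, transverse i q r & transverse i r p].
    by move=> [->|->]; split; apply: (gp_transverse _ TM).
  have ints' w : w = u \/ w = u + k *: v ->
   \int[@lebesgue_measure R]_(t in [set t | tri p q r (g t)] `&` `[a, b]%classic)
     dot w (velocity g t) =
   \int[@lebesgue_measure R]_(t in [set t | tri p q r (h t)] `&` `[a', b']%classic)
     dot w (velocity h t).
    by move=> hw; have := ints w hw; rewrite hull3.
  apply: (frac _ _ _ T0 _ trs ints') => x w xv; apply: rg3.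
  by case: xv => [->|[->|->]]; [constructor 1|constructor 2|constructor 3].
have [cf _] := gf; have [cf' _] := hf.
have sign : (forall c, `|c - s0| < 2 * H -> f c < f' c) \/
    (forall c, `|c - s0| < 2 * H -> f' c < f c).
  pose d c := f' c - f c.
  have cd : continuous d by move=> c; apply: cvgB; [exact: cf'|exact: cf].
  have z0 : `|s0 - s0| < 2 * H by rewrite subrr normr0; clear - H0; lra.
  have d0 c : `|c - s0| < 2 * H -> d c != 0 by move=> /ff'; rewrite subr_eq0 eq_sym.
  have ivt (x y : R) : `|x - s0| < 2 * H -> `|y - s0| < 2 * H -> x <= y ->
      Num.min (d x) (d y) <= 0 <= Num.max (d x) (d y) -> False.
    move=> xs ys xy h1.
    have [c] := @IVT R d x y 0 xy (continuous_subspaceT cd) h1.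
    rewrite in_itv/= => /andP[xc cy] /eqP; apply/negP/d0.
    move: xs ys; rewrite !ltr_norml; clear - xc cy => /andP[? ?] /andP[? ?].
    by apply/andP; split; lra.
  have same c : `|c - s0| < 2 * H -> 0 < d c * d s0.
    move=> cs; have dc := d0 _ cs; have ds := d0 _ z0.
    rewrite lt_neqAle eq_sym mulf_neq0//= leNgt; apply/negP => neg.
    have [/ltW hc|hc] := ltP 0 (d c).
      have h2 : d s0 <= 0.
        have hc' : 0 < d c by rewrite lt_neqAle eq_sym dc.
        by move: neg; rewrite pmulr_rlt0// => /ltW.
      have [le|/ltW le] := leP c s0.
        by apply: (ivt c s0) => //; rewrite ge_min le_max hc h2 orbT.
      by apply: (ivt s0 c) => //; rewrite ge_min le_max hc h2 orbT.
    have h2 : 0 <= d s0.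
      have hc' : d c < 0 by rewrite lt_neqAle dc.
      by move: neg; rewrite nmulr_rlt0// => /ltW.
    have [le|/ltW le] := leP c s0.
      by apply: (ivt c s0) => //; rewrite ge_min le_max hc h2 orbT.
    by apply: (ivt s0 c) => //; rewrite ge_min le_max hc h2 orbT.
  have [ds|ds|/eqP] := ltgtP 0 (d s0); last by rewrite eq_sym (negbTE (d0 _ z0)).
    by left=> c /same; rewrite pmulr_lgt0// subr_gt0.
  by right=> c /same; rewrite nmulr_lgt0// subr_lt0.
case: sign => lt.
  exact: (not_separated sg sh D0 ga ha gf hf mesh covg covh gpg gph H0 diamM
    avoid range2 lt key).
(* When [f'] is the lower graph the arcs exchange roles, and all fractions change sign. *)
apply: (not_separated sh sg D0 ha ga hf gf mesh covh covg gph gpg H0 diamM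
    avoid _ lt _).
  by move=> z /range2[].
move=> p q r TM T0 near meets fraction.
have [e1 e2] := key p q r TM T0 near (proj1 (or_comm _ _) meets).
by rewrite /fraction; split; apply: oppr_inj; rewrite !opprB.
Qed.

End Meet.

(** * Interpolation error with respect to a coordinate along the curve *)

Section Interpolation.
Variable R : realType.
Implicit Types (f g xi dxi : R -> R) (a b t s B C K W : R) (n : nat).

(* [f] has [n] derivatives with respect to the variable [xi], the last one
   bounded by [B]; [dxi] is the derivative of [xi]. *)
Fixpoint tower n B a b dxi f : Prop := match n with
  | 0 => forall t, t \in `[a, b] -> `|f t| <= B
  | n'.+1 => exists2 g, (forall t, t \in `[a, b] -> is_derive t 1 f (g t * dxi t))
      & tower n' B a b dxi g
  end.

Lemma itv_sub a b s t c : s \in `[a, b] -> t \in `[a, b] -> c \in `]s, t[ ->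
  c \in `[a, b].
Proof.
rewrite !in_itv/= => /andP[h1 _] /andP[_ h2] /andP[h3 h4].
by rewrite (le_trans h1 (ltW h3)) (le_trans (ltW h4) h2).
Qed.

(** The mean value theorem applied to [f - K xi], whose derivative is [(g - K) dxi]. *)
Lemma MVT_le f g xi dxi a b K s t :
  (forall t, t \in `[a, b] -> is_derive t 1 xi (dxi t)) ->
  (forall t, t \in `[a, b] -> 0 < dxi t) ->
  (forall t, t \in `[a, b] -> is_derive t 1 f (g t * dxi t)) ->
  (forall t, t \in `[a, b] -> g t <= K) ->
  s \in `[a, b] -> t \in `[a, b] -> s <= t ->
  f t - f s <= K * (xi t - xi s).
Proof.
move=> dX X0 df gK sab tab; rewrite le_eqVlt => /predU1P[->|st].
  by rewrite !subrr mulr0.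
pose F := f - (K *: xi).
have dF c : c \in `[a, b] -> is_derive c 1 F (g c * dxi c - K *: dxi c).
  by move=> cab; have := df _ cab; have := dX _ cab => ? ?; apply: is_deriveB.
have [|c cst] := MVT st (fun c cst => dF c (itv_sub sab tab cst)).
  apply: derivable_within_continuous => c cst.
  have cab : c \in `[a, b].
    move: sab tab cst; rewrite !in_itv/= => /andP[h1 _] /andP[_ h2] /andP[h3 h4].
    by rewrite (le_trans h1 h3) (le_trans h4 h2).
  by have [] := dF _ cab.
have cab := itv_sub sab tab cst.
rewrite (_ : F t - F s = f t - f s - K * (xi t - xi s)); last first.
  by rewrite /F !fctE /GRing.scale/=; ring.
move=> e; rewrite -subr_le0 e /GRing.scale/= -mulrBl.
rewrite mulr_le0_ge0 ?subr_ge0 ?(ltW st)//.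
by rewrite mulr_le0_ge0 ?subr_le0 ?gK// ltW// X0.
Qed.

(** Rolle's theorem: since [dxi] does not vanish, [n] zeros of [f] give [n - 1] zeros of its
    derivative with respect to [xi], and so on down the tower. Coming back, each integration from a
    zero costs a factor [W]. *)
Lemma tower_zeros n B a b xi dxi W f (z : nat -> R) :
  (forall t, t \in `[a, b] -> is_derive t 1 xi (dxi t)) ->
  (forall t, t \in `[a, b] -> 0 < dxi t) ->
  (forall s t, s \in `[a, b] -> t \in `[a, b] -> `|xi t - xi s| <= W) ->
  0 <= B -> 0 <= W ->
  tower n B a b dxi f ->
  (forall i, (i < n)%N -> z i \in `[a, b] /\ f (z i) = 0) ->
  (forall i, (i.+1 < n)%N -> z i < z i.+1) ->
  forall t, t \in `[a, b] -> `|f t| <= B * W ^+ n.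
Proof.
move=> dX X0 XW B0 W0; elim: n f z => [|n IH] f z /=.
  by move=> H _ _ t /H; rewrite expr0 mulr1.
move=> [g df tg] Hz zi.
(* The new zero of index [i] lies between the zeros of index [i] and [i.+1]; past the last gap the
   value is an arbitrary [0]. *)
have /choice[z' Hz'] : forall i, exists c, (i.+1 < n.+1)%N ->
    (c \in `]z i, z i.+1[) /\ g c = 0.
  move=> i; have [lti|] := boolP (i.+1 < n.+1)%N; last by exists 0.
  have [ziab fzi] := Hz i (ltn_trans (ltnSn _) lti).
  have [ziab' fzi'] := Hz _ lti.
  have [||||c cz] := @Rolle _ f (z i) (z i.+1).
  - exact: zi.
  - by move=> c cz; have [] := df _ (itv_sub ziab ziab' cz).
  - apply: derivable_within_continuous => c cst.
    have cab : c \in `[a, b].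
      move: ziab ziab' cst; rewrite !in_itv/= => /andP[h1 _] /andP[_ h2] /andP[h3 h4].
      by rewrite (le_trans h1 h3) (le_trans h4 h2).
    by have [] := df _ cab.
  - by rewrite fzi fzi'.
  move=> d0; exists c => _; split => //.
  have cab := itv_sub ziab ziab' cz.
  have /eqP : g c * dxi c = 0.
    have [_ <-] := df _ cab; by have [_ <-] := d0.
  by rewrite mulf_eq0 (gt_eqF (X0 _ cab)) orbF => /eqP.
have gB := IH g z' tg.
have {}gB t : t \in `[a, b] -> `|g t| <= B * W ^+ n.
  apply: gB => i lti.
    have [zc gc] := Hz' i lti; split => //.
    have [h1 _] := Hz i (leqW lti); have [h2 _] := Hz i.+1 lti.
    exact: itv_sub h1 h2 zc.
  have [] := Hz' i (ltnW lti); have [] := Hz' i.+1 lti.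
  rewrite !in_itv/= => /andP[h1 _] _ /andP[_ h2] _; exact: lt_trans h2 h1.
move=> t tab; have [z0ab fz0] := Hz 0 isT.
pose K := B * W ^+ n.
have K0 : 0 <= K by rewrite mulr_ge0// exprn_ge0.
have up s' t' : s' \in `[a, b] -> t' \in `[a, b] -> s' <= t' ->
    `|f t' - f s'| <= K * (xi t' - xi s').
  move=> s'ab t'ab st; rewrite ler_norml; apply/andP; split; last first.
    apply: (MVT_le dX X0 df _ s'ab t'ab st) => c /gB.
    by rewrite ler_norml => /andP[].
  rewrite lerNl.
  have dN c : c \in `[a, b] -> is_derive c 1 (- f) (- g c * dxi c).
    by move=> cab; have := df _ cab => ?; rewrite mulNr; apply: is_deriveN.
  have := MVT_le dX X0 dN _ s'ab t'ab st; rewrite !fctE => /(_ K).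
  rewrite (_ : - f t' - - f s' = - (f t' - f s')); last by ring.
  by apply=> c /gB; rewrite ler_norml lerNl => /andP[].
have bnd : `|f t - f (z 0)| <= K * W.
  have [le|/ltW le] := leP (z 0) t.
    apply: le_trans (up _ _ z0ab tab le) _; rewrite ler_wpM2l//.
    exact: le_trans (ler_norm _) (XW _ _ z0ab tab).
  rewrite distrC; apply: le_trans (up _ _ tab z0ab le) _; rewrite ler_wpM2l//.
  exact: le_trans (ler_norm _) (XW _ _ tab z0ab).
by rewrite fz0 subr0 in bnd; rewrite exprSr mulrA.
Qed.

(** Newton's scheme: the last node is corrected by a multiple of the polynomial [Q] vanishing at the
    earlier ones. *)
Lemma poly_interpolation n (x y : nat -> R) :
  (forall i j, (i < j)%N -> (j < n)%N -> x i != x j) ->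
  exists2 P : {poly R}, (size P <= n)%N & forall i, (i < n)%N -> P.[x i] = y i.
Proof.
elim: n => [_|n IH H]; first by exists 0; rewrite ?size_poly0.
have [|P sP PE] := IH; first by move=> i j ij jn; apply: H => //; exact: ltnW.
pose Q : {poly R} := \prod_(i < n) ('X - (x i)%:P).
have Q0 i : (i < n)%N -> Q.[x i] = 0.
  move=> lti; rewrite horner_prod (bigD1 (Ordinal lti))//=.
  by rewrite !hornerE subrr mul0r.
have Qn : Q.[x n] != 0.
  rewrite horner_prod; apply/prodf_neq0 => i _; rewrite !hornerE subr_eq0 eq_sym.
  exact: H.
exists (P + ((y n - P.[x n]) / Q.[x n]) *: Q).
  rewrite (leq_trans (size_polyD _ _))// geq_max (leq_trans sP)//=.
  rewrite (leq_trans (size_scale_leq _ _))// size_prod_XsubC.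
  by rewrite /index_enum -enumT size_enum_ord.
move=> i; rewrite ltnS leq_eqVlt => /predU1P[->|lti]; rewrite hornerD hornerZ.
  by rewrite divfK// addrC subrK.
by rewrite PE// (Q0 i)// mulr0 addr0.
Qed.

(** Each differentiation with respect to [xi] lowers the size of the polynomial, so after [n] of
    them it has vanished and the bound [B] is unchanged. *)
Lemma tower_subr_poly n B a b xi dxi f (P : {poly R}) :
  (forall t, t \in `[a, b] -> is_derive t 1 xi (dxi t)) ->
  (size P <= n)%N -> tower n B a b dxi f ->
  tower n B a b dxi (fun t => f t - P.[xi t]).
Proof.
move=> dX; elim: n f P => [|n IH] f P /=.
  by rewrite leqn0 size_poly_eq0 => /eqP -> H t /H; rewrite horner0 subr0.
move=> sP [g df tg]; exists (fun t => g t - P^`().[xi t]).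
  move=> t tab; rewrite mulrBl; have dft := df _ tab.
  apply: is_deriveB.
  have dP : is_derive (xi t) 1 (horner P) (P^`().[xi t]).
    by apply: DeriveDef; [exact: derivable_horner|rewrite -derive1E -derivE].
  have dXt := dX _ tab.
  have := is_derive1_comp (f := horner P) (g := xi) (x := t) dP dXt.
  by rewrite /GRing.scale/= /comp.
apply: IH tg; have [->|P0] := eqVneq P 0; first by rewrite linear0 size_poly0.
by rewrite -ltnS (leq_trans (lt_size_deriv P0)).
Qed.

End Interpolation.

(** * Uniform bounds on derivatives of products and inverses *)

Section BoundedDerivatives.
Variable R : realType.
Implicit Types (f g xi dxi : R -> R) (a b t s B C K W : R) (n : nat).

(** Here the derivatives are taken in the parameter and all of them are bounded, whereas [tower]
    differentiates with respect to [xi] and bounds the last one only. *)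
Fixpoint bounded_derivatives n B a b f : Prop :=
  (forall t, t \in `[a, b] -> `|f t| <= B) /\
  match n with
  | 0 => True
  | n'.+1 => exists2 g, (forall t, t \in `[a, b] -> is_derive t 1 f (g t))
      & bounded_derivatives n' B a b g
  end.

Lemma bounded_derivatives_le n B C a b f : B <= C ->
  bounded_derivatives n B a b f -> bounded_derivatives n C a b f.
Proof.
move=> BC; elim: n f => [|n IH] f [fB h]; split => //.
- by move=> t /fB /le_trans; apply.
- by move=> t /fB /le_trans; apply.
- by case: h => g dg /IH; exists g.
Qed.

Lemma bounded_derivatives_pred n B a b f :
  bounded_derivatives n.+1 B a b f -> bounded_derivatives n B a b f.
Proof.
elim: n f => [|n IH] f [fB [g dg hg]]; split => //.
by exists g => //; exact: IH.
Qed.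

Lemma bounded_derivatives_bound n B a b f t : bounded_derivatives n B a b f ->
  t \in `[a, b] -> `|f t| <= B.
Proof. by case: n => [|n] [fB _]; exact: fB. Qed.

Lemma bounded_derivativesD n B C a b f g : bounded_derivatives n B a b f ->
  bounded_derivatives n C a b g ->
  bounded_derivatives n (B + C) a b (fun t => f t + g t).
Proof.
elim: n f g => [|n IH] f g [fB hf] [gC hg]; split => //.
- by move=> t tab; rewrite (le_trans (ler_normD _ _))// lerD ?fB ?gC.
- by move=> t tab; rewrite (le_trans (ler_normD _ _))// lerD ?fB ?gC.
case: hf hg => f' df hf [g' dg hg]; exists (fun t => f' t + g' t).
  by move=> t tab; have := df _ tab; have := dg _ tab => ? ?; exact: is_deriveD.
exact: IH.
Qed.

Lemma bounded_derivativesZ n B k a b f : bounded_derivatives n B a b f ->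
  bounded_derivatives n (`|k| * B) a b (fun t => k * f t).
Proof.
elim: n f => [|n IH] f [fB hf]; split => //.
- by move=> t tab; rewrite normrM ler_wpM2l// fB.
- by move=> t tab; rewrite normrM ler_wpM2l// fB.
case: hf => f' df hf; exists (fun t => k * f' t); last exact: IH.
by move=> t tab; have := df _ tab => ?; exact: (is_deriveZ k).
Qed.

Lemma bounded_derivativesM n B C : 0 <= B -> 0 <= C ->
  exists2 K, 0 <= K & forall a b f g, bounded_derivatives n B a b f ->
  bounded_derivatives n C a b g ->
  bounded_derivatives n K a b (fun t => f t * g t).
Proof.
move=> B0 C0; elim: n => [|n [K K0 IH]].
  exists (B * C); first exact: mulr_ge0.
  move=> a b f g [fB _] [gC _]; split => // t tab.
  by rewrite normrM ler_pM// ?fB ?gC.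
exists (B * C + (K + K)); first by rewrite addr_ge0 ?mulr_ge0// addr_ge0.
move=> a b f g hf hg; split.
  move=> t tab; rewrite (@le_trans _ _ (B * C))//; last by rewrite lerDl addr_ge0.
  by rewrite normrM ler_pM// (bounded_derivatives_bound hf, bounded_derivatives_bound hg).
have [fB [f' df hf']] := hf; have [gC [g' dg hg']] := hg.
exists (fun t => f t * g' t + g t * f' t).
  by move=> t tab; have := df _ tab; have := dg _ tab => ? ?; exact: is_deriveM.
apply: (@bounded_derivatives_le _ (K + K)); first by rewrite lerDr mulr_ge0.
apply: bounded_derivativesD.
  by apply: IH => //; exact: bounded_derivatives_pred.
rewrite (_ : (fun _ => _) = (fun t => f' t * g t)).
  by apply: IH => //; exact: bounded_derivatives_pred.
by apply/funext => t; rewrite mulrC.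
Qed.

Lemma bounded_derivativesV n B C : 0 <= B -> 0 <= C ->
  exists2 K, 0 <= K & forall a b f, bounded_derivatives n B a b f ->
  (forall t, t \in `[a, b] -> f t != 0 /\ `|(f t)^-1| <= C) ->
  bounded_derivatives n K a b (fun t => (f t)^-1).
Proof.
move=> B0 C0; elim: n => [|n [K K0 IH]].
  by exists C => // a b f _ H; split => // t /H[].
have [K1 K10 H1] := bounded_derivativesM n K0 K0.
have [K2 K20 H2] := bounded_derivativesM n B0 K10.
exists (C + K2); first exact: addr_ge0.
move=> a b f hf H; split.
  by move=> t /H[_ h]; rewrite (le_trans h)// lerDl.
have [fB [f' df hf']] := hf.
exists (fun t => -1 * (f' t * ((f t)^-1 * (f t)^-1))).
  move=> t tab; have dft := df _ tab; have [f0 _] := H _ tab.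
  have := is_deriveV f0 dft.
  by congr is_derive; rewrite /GRing.scale/= expr2 invfM; ring.
apply: (@bounded_derivatives_le _ (`|-1| * K2)).
  by rewrite normrN1 mul1r lerDr.
apply: bounded_derivativesZ; apply: H2 => //.
by apply: H1; apply: IH => //; exact: bounded_derivatives_pred.
Qed.

(** Differentiation with respect to [xi] is [f' / dxi]. The constant is fixed before the functions,
    which makes the estimate uniform over all tame curves with the same [N]. *)
Lemma tower_bounded n B C : 0 <= B -> 0 <= C ->
  exists2 K, 0 <= K & forall a b dxi f, bounded_derivatives n B a b f ->
  bounded_derivatives n.-1 B a b dxi ->
  (forall t, t \in `[a, b] -> dxi t != 0 /\ `|(dxi t)^-1| <= C) ->
  tower n K a b dxi f.
Proof.
elim: n B => [|n IH] B B0 C0.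
  by exists B => // a b dxi f [fB _].
have [K1 K10 H1] := bounded_derivativesV n B0 C0.
have [K2 K20 H2] := bounded_derivativesM n B0 K10.
have [|K K0 HK] := IH (B + K2) _ C0; first exact: addr_ge0.
exists K => // a b dxi f hf hX HC.
have [fB [f' df hf']] := hf.
exists (fun t => f' t * (dxi t)^-1).
  move=> t tab; have := df _ tab; congr is_derive.
  by rewrite mulfVK//; have [] := HC _ tab.
apply: HK => //.
  apply: (@bounded_derivatives_le _ K2); first by rewrite lerDr.
  by apply: H2 => //; exact: H1.
apply: (@bounded_derivatives_le _ B); first by rewrite lerDl.
case: n {IH H1 H2 hf hf'} hX => // n; exact: bounded_derivatives_pred.
Qed.

End BoundedDerivatives.

(** * Tame curves: smooth embeddings with quantitative constants *)

Section Tame.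
Variable R : realType.
Implicit Types (phi : R -> plane R) (f : R -> R) (a b t s d : R) (n N : nat).

Lemma periodic_int (T : Type) (F : R -> T) : (forall t, F (t + 1) = F t) ->
  forall (z : int) t, F (t + z%:~R) = F t.
Proof.
move=> per; have pn n t : F (t + n%:R) = F t.
  elim: n t => [|n IH] t; first by rewrite addr0.
  by rewrite -addn1 natrD addrA per IH.
case=> n t; first exact: pn.
by rewrite NegzE mulrNz -[in RHS](subrK n.+1%:R t) pn.
Qed.

Lemma periodic_derive1 f : (forall t, f (t + 1) = f t) ->
  forall t, f^`()%classic (t + 1) = f^`()%classic t.
Proof.
move=> per t; rewrite /derive1.
have -> // : (fun h : R => h^-1 *: (f (h + (t + 1)) - f (t + 1))) =
    (fun h => h^-1 *: (f (h + t) - f t)).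
by apply/funext => h; rewrite addrA !per.
Qed.

Lemma periodic_derive1n f n : (forall t, f (t + 1) = f t) ->
  forall t, f^`(n)%classic (t + 1) = f^`(n)%classic t.
Proof. by move=> per; elim: n => // n IH t; rewrite !derive1nS periodic_derive1. Qed.

Lemma to_unit_interval t : exists z : int, 0 <= t - z%:~R < 1.
Proof.
exists (Num.floor t); have /andP[h1 h2] := floor_itv t.
by rewrite subr_ge0 h1/= ltrBlDl -[1]/(1%:~R) -intrD.
Qed.

Lemma bounded_periodic f : continuous f -> (forall t, f (t + 1) = f t) ->
  exists B : nat, forall t, `|f t| <= B%:R.
Proof.
move=> cf per.
have cn : continuous (fun t => `|f t|).
  by move=> t; apply: cvg_norm; exact: cf.
have [c _ Hc] := EVT_max ler01 (continuous_subspaceT cn).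
exists (Num.truncn `|f c|).+1 => t; have [z /andP[h1 h2]] := to_unit_interval t.
rewrite -(subrK z%:~R t) (periodic_int per).
apply: le_trans (Hc _ _) _; first by rewrite in_itv/= h1 ltW.
exact/ltW/truncnS_gt.
Qed.

Lemma derive_lipschitz f (g : R -> R) K : (forall t, is_derive (t : R) 1 f (g t)) ->
  (forall t, `|g t| <= K) -> forall s t, `|f s - f t| <= K * `|s - t|.
Proof.
move=> df gK.
have cf : continuous f.
  by move=> t; apply/differentiable_continuous/derivable1_diffP; have [] := df t.
have lt_case s t : s < t -> `|f t - f s| <= K * `|t - s|.
  move=> st; have [c _ ->] := MVT st (fun c _ => df c) (continuous_subspaceT cf).
  by rewrite normrM ler_wpM2r.
move=> s t; have [st|ts|->] := ltgtP s t; last by rewrite !subrr normr0 mulr0.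
  by rewrite distrC (distrC s); exact: lt_case.
exact: lt_case.
Qed.

(** The last clause is quantitative injectivity on the circle of length [1], where
    [|s - t| <= 1 / 2] is the distance between the parameters. The constant is a natural number so
    that a least one exists. *)
Definition tame N phi : Prop :=
  [/\ periodic1 phi,
    forall i t, (i < 5)%N -> derivable (fst \o phi)^`(i)%classic t 1 /\
                             derivable (snd \o phi)^`(i)%classic t 1,
    forall i t, (i <= 5)%N -> `|(fst \o phi)^`(i)%classic t| <= N%:R /\
                              `|(snd \o phi)^`(i)%classic t| <= N%:R,
    forall t, 1 <= N%:R * `|(velocity phi t).1| \/
              1 <= N%:R * `|(velocity phi t).2|
  & forall s t, `|s - t| <= 1 / 2 ->
      `|s - t| <= N%:R * (`|(phi s).1 - (phi t).1| + `|(phi s).2 - (phi t).2|)].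

Lemma tame_le N N' phi : (N <= N')%N -> tame N phi -> tame N' phi.
Proof.
move=> NN' [per dphi bd vel sep]; have NR : N%:R <= N'%:R :> R by rewrite ler_nat.
split => //.
- by move=> i t /(bd i t) [h1 h2]; split; exact: le_trans NR.
- by move=> t; have [h|h] := vel t; [left|right]; apply: le_trans h _; rewrite ler_wpM2r.
- by move=> s t /sep /le_trans; apply; rewrite ler_wpM2r// addr_ge0.
Qed.

Lemma tame_smooth1 N phi : tame N phi -> smooth1 phi.
Proof.
move=> [_ dphi _ _ _]; split.
- move=> t; have [d _] := dphi 0%N t isT; apply: DeriveDef; first exact: d.
  by rewrite /velocity/= derive1E.
- move=> t; have [_ d] := dphi 0%N t isT; apply: DeriveDef; first exact: d.
  by rewrite /velocity/= derive1E.
- move=> t; have [d _] := dphi 1%N t isT.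
  exact/differentiable_continuous/derivable1_diffP.
- move=> t; have [_ d] := dphi 1%N t isT.
  exact/differentiable_continuous/derivable1_diffP.
Qed.

Lemma smooth1_continuous1 phi : smooth1 phi -> continuous (fst \o phi).
Proof.
move=> [d _ _ _] t.
by apply/differentiable_continuous/derivable1_diffP; have [] := d t.
Qed.

Lemma smooth1_continuous2 phi : smooth1 phi -> continuous (snd \o phi).
Proof.
move=> [_ d _ _] t.
by apply/differentiable_continuous/derivable1_diffP; have [] := d t.
Qed.

Lemma derive2_lipschitz f K : (forall t, derivable f^`()%classic t 1) ->
  (forall t, `|f^`(2)%classic t| <= K) ->
  forall s t, `|f^`()%classic s - f^`()%classic t| <= K * `|s - t|.
Proof.
move=> df bf.
have dd t : is_derive t 1 f^`()%classic (f^`(2)%classic t).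
  by apply: DeriveDef; [exact: df|rewrite derive1nS derive1E derive1n1].
exact: (derive_lipschitz dd bf).
Qed.

Lemma tame_velocity_lipschitz N phi : tame N phi -> forall s t,
  `|(velocity phi s).1 - (velocity phi t).1| <= N%:R * `|s - t| /\
  `|(velocity phi s).2 - (velocity phi t).2| <= N%:R * `|s - t|.
Proof.
move=> [_ dphi bd _ _] s t; split.
  apply: (@derive2_lipschitz (fst \o phi) N%:R) => r.
    by have [] := dphi 1%N r isT; rewrite derive1n1.
  by have [] := bd 2%N r isT.
apply: (@derive2_lipschitz (snd \o phi) N%:R) => r.
  by have [] := dphi 1%N r isT; rewrite derive1n1.
by have [] := bd 2%N r isT.
Qed.

Lemma tame_lipschitz N phi : tame N phi -> forall s t,
  `|(phi s).1 - (phi t).1| <= N%:R * `|s - t| /\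
  `|(phi s).2 - (phi t).2| <= N%:R * `|s - t|.
Proof.
move=> tphi s t; have [d1 d2 _ _] := tame_smooth1 tphi; have [_ _ bd _ _] := tphi.
split.
  by apply: (@derive_lipschitz (fst \o phi) _ _ d1) => r; have [] := bd 1%N r isT.
by apply: (@derive_lipschitz (snd \o phi) _ _ d2) => r; have [] := bd 1%N r isT.
Qed.

Lemma derive1n_bounded n f a b B :
  (forall i t, (i < n)%N -> derivable f^`(i)%classic t 1) ->
  (forall i t, (i <= n)%N -> `|f^`(i)%classic t| <= B) ->
  forall j m, (m + j <= n)%N -> bounded_derivatives m B a b f^`(j)%classic.
Proof.
move=> df bf j m; elim: m j => [|m IH] j mj.
  by split => // t _; exact: bf.
split; first by move=> t _; apply: bf; rewrite (leq_trans (leq_addl _ _) mj).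
exists f^`(j.+1)%classic; last by apply: IH; rewrite addnS.
move=> t _; apply: DeriveDef; last by rewrite derive1nS derive1E.
by apply: df; rewrite (leq_trans _ mj)// addSn ltnS leq_addl.
Qed.

Section ExistsTame.
Variable phi : R -> plane R.
Hypothesis phiE : smooth_embedding 5 phi.

Let per : periodic1 phi. Proof. by case: phiE. Qed.

Let per1 t : (fst \o phi) (t + 1) = (fst \o phi) t.
Proof. by rewrite /= per. Qed.

Let per2 t : (snd \o phi) (t + 1) = (snd \o phi) t.
Proof. by rewrite /= per. Qed.

Let class_continuous f i : class_C 5 f -> (i <= 5)%N -> continuous f^`(i)%classic.
Proof.
move=> [df cf]; rewrite leq_eqVlt => /predU1P[->//|i5] t.
exact/differentiable_continuous/derivable1_diffP/df.
Qed.

Let embedding_bound : exists B : nat, forall i t, (i <= 5)%N ->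
  `|(fst \o phi)^`(i)%classic t| <= B%:R /\ `|(snd \o phi)^`(i)%classic t| <= B%:R.
Proof.
have [_ [C1 C2] _ _] := phiE.
have bd f : class_C 5 f -> (forall t, f (t + 1) = f t) ->
    forall k, (k <= 6)%N -> exists B : nat, forall i t, (i < k)%N -> `|f^`(i)%classic t| <= B%:R.
  move=> Cf perf; elim=> [|k IH] k6; first by exists 0.
  have [|B HB] := IH; first exact: ltnW.
  have [B' HB'] := bounded_periodic (class_continuous Cf k6) (periodic_derive1n k perf).
  exists (maxn B B') => i t; rewrite ltnS leq_eqVlt => /predU1P[->|ik].
    by rewrite (le_trans (HB' t))// ler_nat leq_maxr.
  by rewrite (le_trans (HB i t ik))// ler_nat leq_maxl.
have [B1 H1] := bd _ C1 per1 6 (leqnn _); have [B2 H2] := bd _ C2 per2 6 (leqnn _).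
exists (maxn B1 B2) => i t i5; split.
  by rewrite (le_trans (H1 i t i5))// ler_nat leq_maxl.
by rewrite (le_trans (H2 i t i5))// ler_nat leq_maxr.
Qed.

Let embedding_smooth1 : smooth1 phi.
Proof.
have [_ [C1 C2] _ _] := phiE; split.
- move=> t; apply: DeriveDef; first exact: (C1.1 0%N t).
  by rewrite /velocity/= derive1E.
- move=> t; apply: DeriveDef; first exact: (C2.1 0%N t).
  by rewrite /velocity/= derive1E.
- exact: (class_continuous C1 (isT : 1 <= 5)%N).
- exact: (class_continuous C2 (isT : 1 <= 5)%N).
Qed.

Let per_int (z : int) t : phi (t + z%:~R) = phi t.
Proof. exact: periodic_int. Qed.

Let velocity_int (z : int) t : velocity phi (t + z%:~R) = velocity phi t.
Proof.
apply: periodic_int => s; rewrite /velocity.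
by rewrite (periodic_derive1 per1) (periodic_derive1 per2).
Qed.

Let embedding_velocity : exists B : nat, forall t,
  1 <= B%:R * `|(velocity phi t).1| \/ 1 <= B%:R * `|(velocity phi t).2|.
Proof.
have [_ _ _ v0] := phiE; have [_ _ c1 c2] := embedding_smooth1.
pose F t := `|(velocity phi t).1| + `|(velocity phi t).2|.
have cF : continuous F.
  by move=> t; apply: cvgD; apply: cvg_norm; [exact: c1|exact: c2].
have [c _ Hc] := EVT_min ler01 (continuous_subspaceT cF).
have Fc : 0 < F c.
  rewrite lt_neqAle eq_sym addr_ge0// andbT; apply/eqP => e.
  have := v0 c; rewrite [velocity phi c]surjective_pairing => /negP; apply.
  apply/eqP; congr pair; apply/eqP; rewrite -normr_eq0; apply/eqP.
    by have := normr_ge0 (velocity phi c).1; have := normr_ge0 (velocity phi c).2;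
      rewrite /F in e; lra.
  by have := normr_ge0 (velocity phi c).1; have := normr_ge0 (velocity phi c).2;
    rewrite /F in e; lra.
pose B := (Num.truncn (2 / F c)).+1; exists B => t.
have BF : 2 <= B%:R * F c by rewrite -ler_pdivrMr//; exact/ltW/truncnS_gt.
have [z /andP[h1 h2]] := to_unit_interval t.
have FcFt : F c <= F t.
  rewrite -(subrK z%:~R t) /F velocity_int; apply: Hc.
  by rewrite in_itv/= h1 ltW.
have : 2 <= B%:R * F t by rewrite (le_trans BF)// ler_wpM2l.
rewrite /F mulrDr => h.
have [h3|h3] := leP 1 (B%:R * `|(velocity phi t).1|); first by left.
by right; lra.
Qed.

Let embedding_inj t d : 0 < d < 1 -> phi (t + d) <> phi t.
Proof.
have [_ _ inj _] := phiE => /andP[d0 d1].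
have [z /andP[h1 h2]] := to_unit_interval t; set s := t - z%:~R in h1 h2.
have -> : t + d = s + d + z%:~R by rewrite /s; ring.
have -> : t = s + z%:~R by rewrite /s; ring.
rewrite !per_int; have [sd|sd] := ltP (s + d) 1.
  move/inj; rewrite !in_itv/= h1 h2 sd addr_ge0 ?(ltW d0)//= => /(_ isT isT).
  lra.
have -> : phi (s + d) = phi (s + d - 1) by rewrite -[in LHS](subrK 1 (s + d)) per.
have sd1 : s + d - 1 \in `[0, 1[ by rewrite in_itv/=; apply/andP; split; lra.
move/inj => /(_ sd1); rewrite in_itv/= h1 h2 => /(_ isT); lra.
Qed.

(** Compactness of the circle makes the smoothness, the speed bound and the injectivity uniform. In
    the final constant, [2 * B] serves the pairs at distance at most [r] and [K] the remaining
    ones. *)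
Lemma exists_tame : exists N, tame N phi.
Proof.
have [B1 HB1] := embedding_bound; have [B2 HB2] := embedding_velocity.
have [_ [C1 C2] _ _] := phiE.
pose B := (maxn B1 B2).+1.
have BR : 0 < B%:R :> R by rewrite ltr0n.
have bd i t : (i <= 5)%N -> `|(fst \o phi)^`(i)%classic t| <= B%:R /\
    `|(snd \o phi)^`(i)%classic t| <= B%:R.
  move=> i5; have [h1 h2] := HB1 i t i5.
  have le : B1%:R <= B%:R :> R by rewrite ler_nat ltnW// ltnS leq_maxl.
  by split; exact: le_trans le.
have vel t : 1 <= B%:R * `|(velocity phi t).1| \/ 1 <= B%:R * `|(velocity phi t).2|.
  have le : B2%:R <= B%:R :> R by rewrite ler_nat ltnW// ltnS leq_maxr.
  by have [h|h] := HB2 t; [left|right]; apply: le_trans h _; rewrite ler_wpM2r.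
have [d1 d2 _ _] := embedding_smooth1.
(* Chosen so that [B * (B * r) = 1 / 2]: over a distance [r], the large component of the velocity
   keeps at least half of its lower bound. *)
pose r : R := (2 * B%:R ^+ 2)^-1.
have r0 : 0 < r by rewrite invr_gt0 mulr_gt0// exprn_gt0.
(* Separation of phi s and phi t follows from the mean value theorem if |s - t| <= r,
   and from injectivity and compactness otherwise. *)
have close (f g : R -> R) (t d : R) : (forall t, is_derive (t : R) 1 f (g t)) ->
    (forall s t, `|g s - g t| <= B%:R * `|s - t|) ->
    1 <= B%:R * `|g t| -> 0 < d <= r -> d <= 2 * B%:R * `|f (t + d) - f t|.
  move=> df lip gt1 /andP[d0 dr].
  have cf : continuous f.
    by move=> s; apply/differentiable_continuous/derivable1_diffP; have [] := df s.
  have td : t < t + d by rewrite ltrDl.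
  have [c ctd ->] := MVT td (fun c _ => df c) (continuous_subspaceT cf).
  rewrite addrAC subrr add0r normrM (gtr0_norm d0) mulrA -[leLHS]mul1r.
  rewrite ler_wpM2r ?(ltW d0)//.
  have ctd' : `|c - t| <= r.
    move: ctd; rewrite in_itv/= => /andP[h1 h2]; rewrite ger0_norm; lra.
  have h1 : `|g t| <= `|g c| + B%:R * r.
    rewrite -[g t](subrK (g c)) (le_trans (ler_normD _ _))// addrC lerD2l distrC.
    by apply: le_trans (lip _ _) _; rewrite ler_wpM2l.
  have h2 : B%:R * (B%:R * r) = 1 / 2 by rewrite /r; field; rewrite gt_eqF.
  have h3 : B%:R * `|g t| <= B%:R * `|g c| + 1 / 2.
    by rewrite -h2 -mulrDr ler_wpM2l.
  rewrite -mulrA; lra.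
have lip2 f : class_C 5 f -> (forall i t, (i <= 5)%N -> `|f^`(i)%classic t| <= B%:R) ->
    forall s t, `|f^`()%classic s - f^`()%classic t| <= B%:R * `|s - t|.
  move=> Cf bf; apply: derive2_lipschitz => t; last exact: bf.
  by have := Cf.1 1%N t isT; rewrite derive1n1.
have lipx := lip2 _ C1 (fun i t h => proj1 (bd i t h)).
have lipy := lip2 _ C2 (fun i t h => proj2 (bd i t h)).
pose G (p : R * R) := `|(phi (p.1 + p.2)).1 - (phi p.1).1| +
  `|(phi (p.1 + p.2)).2 - (phi p.1).2|.
have cG : continuous G.
  have c1 := smooth1_continuous1 embedding_smooth1.
  have c2 := smooth1_continuous2 embedding_smooth1.
  have cs : continuous (fun p : R * R => p.1 + p.2).
    by move=> p; apply: cvgD; [exact: cvg_fst|exact: cvg_snd].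
  have cf : continuous (fun p : R * R => p.1) by move=> p; exact: cvg_fst.
  move=> p; apply: cvgD; apply: cvg_norm; apply: cvgB.
  - exact: (@continuous_comp _ _ _ (fun p : R * R => p.1 + p.2) (fst \o phi) p (cs p) (c1 _)).
  - exact: (@continuous_comp _ _ _ (fun p : R * R => p.1) (fst \o phi) p (cf p) (c1 _)).
  - exact: (@continuous_comp _ _ _ (fun p : R * R => p.1 + p.2) (snd \o phi) p (cs p) (c2 _)).
  - exact: (@continuous_comp _ _ _ (fun p : R * R => p.1) (snd \o phi) p (cf p) (c2 _)).
(* A compact set of pairs [(t, d)], with [d] away from [0] and from a full period; injectivity makes
   [G] positive on it. *)
pose A : set (R * R) := `[0, 1]%classic `*` `[r, 1 / 2]%classic.
have far : exists K : nat, forall p, A p -> 1 / 2 <= K%:R * G p.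
  have [A0|A0] := pselect (A !=set0); last by exists 0%N => p Ap; exfalso; apply: A0; exists p.
  have cA : compact A by apply: compact_setX; exact: segment_compact.
  have [c Ac Hc] := compact_EVT_min A0 cA (continuous_subspaceT cG).
  have Gc : 0 < G c.
    rewrite lt_neqAle eq_sym addr_ge0// andbT; apply/eqP => e.
    move: Ac; rewrite inE => -[_] /=; rewrite in_itv/= => /andP[h1 h2].
    have : phi (c.1 + c.2) <> phi c.1 by apply: embedding_inj; apply/andP; split; lra.
    apply; rewrite [LHS]surjective_pairing [RHS]surjective_pairing.
    have n1 := normr_ge0 ((phi (c.1 + c.2)).1 - (phi c.1).1).
    have n2 := normr_ge0 ((phi (c.1 + c.2)).2 - (phi c.1).2).
    congr pair; apply/eqP; rewrite -subr_eq0 -normr_eq0; apply/eqP; rewrite /G in e; lra.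
  exists (Num.truncn (2^-1 / G c)).+1 => p Ap.
  apply: (@le_trans _ _ ((Num.truncn (2^-1 / G c)).+1%:R * G c)).
    by rewrite mul1r -ler_pdivrMr//; exact/ltW/truncnS_gt.
  by rewrite ler_wpM2l// Hc// inE.
have [K HK] := far.
exists (2 * B + K)%N.
have BN : B%:R <= (2 * B + K)%:R :> R.
  by rewrite ler_nat mul2n -addnn -addnA leq_addr.
split => //.
- by move=> i t i5; split; [exact: C1.1|exact: C2.1].
- by move=> i t /(bd i t)[h1 h2]; split; exact: le_trans BN.
- by move=> t; have [h|h] := vel t; [left|right]; apply: le_trans h _; rewrite ler_wpM2r.
have main t d : 0 <= d <= 1 / 2 -> d <= (2 * B + K)%:R * G (t, d).
  move=> /andP[d0 d12].
  have G0 : 0 <= G (t, d) by rewrite addr_ge0.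
  move: d0; rewrite le_eqVlt => /predU1P[<-|d0].
    by rewrite mulr_ge0// addr_ge0.
  have [dr|rd] := leP d r.
    apply: (@le_trans _ _ (2 * B%:R * G (t, d))); last first.
      by rewrite ler_wpM2r// natrD natrM lerDl.
    rewrite /G mulrDr; have [h|h] := vel t.
      apply: (@le_trans _ _ (2 * B%:R * `|(fst \o phi) (t + d) - (fst \o phi) t|)).
        apply: (close _ (fst \o phi)^`()%classic) => //.
        by apply/andP.
      by rewrite lerDl mulr_ge0// mulr_ge0.
    apply: (@le_trans _ _ (2 * B%:R * `|(snd \o phi) (t + d) - (snd \o phi) t|)).
      apply: (close _ (snd \o phi)^`()%classic) => //.
      by apply/andP.
    by rewrite lerDr mulr_ge0// mulr_ge0.
  have [z /andP[h1 h2]] := to_unit_interval t.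
  have GE : G (t, d) = G (t - z%:~R, d).
    rewrite /G/= -(per_int z (t - z%:~R + d)) -(per_int z (t - z%:~R)).
    by rewrite (addrAC _ d) subrK.
  have /HK h : A (t - z%:~R, d) by split; rewrite /= in_itv/= ?h1 ?(ltW h2)// (ltW rd).
  rewrite GE (le_trans d12)// (le_trans h)// ler_wpM2r ?addr_ge0//.
  by rewrite ler_nat leq_addl.
move=> s t st; have [le|/ltW le] := leP s t.
  have d0 : 0 <= t - s by rewrite subr_ge0.
  rewrite distrC ger0_norm//; rewrite distrC ger0_norm// in st.
  have := main s (t - s); rewrite d0 st => /(_ isT); rewrite /G/= (addrC s) subrK.
  by rewrite (distrC (phi t).1) (distrC (phi t).2).
have d0 : 0 <= s - t by rewrite subr_ge0.
rewrite ger0_norm//; rewrite ger0_norm// in st.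
by have := main t (s - t); rewrite d0 st => /(_ isT); rewrite /G/= (addrC t) subrK.
Qed.

End ExistsTame.

End Tame.

(** * The l1 norm and the mesh size *)

Section MeshSize.
Variable R : realType.
Implicit Types (p q r z w : plane R) (T : {fset plane R}) (M : {fset {fset plane R}}).

(** This norm dominates the Euclidean distance, and swaps and sign changes of the coordinates
    preserve it. *)
Definition l1 z : R := `|z.1| + `|z.2|.

Lemma l1_ge0 z : 0 <= l1 z. Proof. by rewrite addr_ge0. Qed.

Lemma l1D z w : l1 (z + w) <= l1 z + l1 w.
Proof.
by rewrite /l1 /= addrACA lerD// ler_normD.
Qed.

Lemma l1N z : l1 (- z) = l1 z. Proof. by rewrite /l1 /= !normrN. Qed.

Lemma l1_dist p q r : l1 (p - r) <= l1 (p - q) + l1 (q - r).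
Proof. by rewrite (le_trans _ (l1D _ _))// addrA subrK. Qed.

Lemma l1_sym p q : l1 (p - q) = l1 (q - p).
Proof. by rewrite -l1N opprB. Qed.

Lemma eucl_le_l1 p q : eucl_dist p q <= l1 (p - q).
Proof.
rewrite /eucl_dist -[leRHS]ger0_norm ?l1_ge0// -sqrtr_sqr ler_sqrt ?sqr_ge0//.
rewrite /l1 /=; set a := p.1 - q.1; set b := p.2 - q.2.
rewrite -(real_normK (num_real a)) -(real_normK (num_real b)).
by have := mulr_ge0 (normr_ge0 a) (normr_ge0 b); rewrite !expr2; nra.
Qed.

Lemma coord_le_eucl p q : `|p.1 - q.1| <= eucl_dist p q /\ `|p.2 - q.2| <= eucl_dist p q.
Proof.
rewrite /eucl_dist -!sqrtr_sqr; split; rewrite ler_sqrt ?addr_ge0 ?sqr_ge0//.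
  by rewrite lerDl sqr_ge0.
by rewrite lerDr sqr_ge0.
Qed.

(** [diam] is a supremum, so the distances inside the triangle must first be bounded; the norms of
    the vertices do this. *)
Lemma hull_diam T z w : is_triangle T -> hull T z -> hull T w ->
  eucl_dist z w <= diam (hull T).
Proof.
move=> [p [q [r [-> D0]]]]; rewrite -/(orient p q r) in D0.
rewrite hull3// => Tz Tw; apply: sup_upper_bound; last by exists (z, w).
split; first by exists (eucl_dist z w); exists (z, w).
pose B : R := l1 p + l1 q + l1 r.
have bd x : tri p q r x -> l1 x <= B.
  move=> [a [b [c [a0 b0 c0 abc ->]]]].
  have one (e : R) : 0 <= e -> e <= 1 -> forall y : R, `|e * y| <= `|y|.
    by move=> e0 e1 y; rewrite normrM ger0_norm// ler_piMl.
  rewrite /l1 /= /B /l1.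
  have n3 (x1 x2 x3 : R) : `|a * x1 + b * x2 + c * x3| <= `|x1| + `|x2| + `|x3|.
    rewrite (le_trans (ler_normD _ _))// lerD//; last by apply: one; lra.
    by rewrite (le_trans (ler_normD _ _))// lerD//; apply: one; lra.
  have h1 := n3 p.1 q.1 r.1; have h2 := n3 p.2 q.2 r.2; lra.
exists (B + B) => _ [[x y] [/= Tx Ty] <-].
rewrite (le_trans (eucl_le_l1 _ _))// (le_trans (l1D _ _))// l1N lerD// bd//.
Qed.

Lemma le_mesh_size M T : T \in M -> diam (hull T) <= mesh_size M.
Proof. 
by move=> TM; apply: (@le_bigmax_seq _ _ _ _ _ T xpredT (fun T => diam (hull T))).
Qed.

Lemma mesh_size_l1 M T z w : is_mesh M -> T \in M -> hull T z -> hull T w ->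
  l1 (z - w) <= 2 * mesh_size M.
Proof.
move=> [triM _] TM Tz Tw; have h := hull_diam (triM _ TM) Tz Tw.
have [h1 h2] := coord_le_eucl z w; have h3 := le_mesh_size TM.
by rewrite /l1 /=; lra.
Qed.

Lemma mesh_size_gt0 M T : is_mesh M -> T \in M -> 0 < mesh_size M.
Proof.
move=> mesh TM; have [p [q [r [TE D0]]]] := mesh.1 _ TM.
rewrite -/(orient p q r) in D0; have [pq _ _] := orient_neq0_distinct D0.
have pT : p \in T by rewrite TE !inE eqxx.
have qT : q \in T by rewrite TE !inE eqxx orbT.
have := mesh_size_l1 mesh TM (hull_vertex pT) (hull_vertex qT).
have : 0 < l1 (p - q).
  rewrite lt_neqAle l1_ge0 andbT eq_sym; apply: contra pq => /eqP.
  rewrite /l1 /= => e; have n1 := normr_ge0 (p.1 - q.1); have n2 := normr_ge0 (p.2 - q.2).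
  rewrite [p]surjective_pairing [q]surjective_pairing; apply/eqP; congr pair;
    by apply/eqP; rewrite -subr_eq0 -normr_eq0; apply/eqP; lra.
by lra.
Qed.

End MeshSize.

(** * Localizing integrals of periodic functions *)

Section PeriodicIntegral.
Variable R : realType.
Local Notation mu := (@lebesgue_measure R).
Implicit Types (A B : set R) (f : R -> R) (t k : R).

Lemma measurable_translate k A : measurable A -> measurable [set t | A (t + k)].
Proof.
move=> mA; rewrite (_ : [set _ | _] = [set t | A (1 * t + k)]).
  exact: measurable_affine_preimage.
by apply/funext => t; rewrite /mkset mul1r.
Qed.

Lemma lebesgue_translate k A : measurable A -> mu [set t | A (t + k)] = mu A.
Proof.
move=> mA; have := lebesgue_affine k (oner_neq0 R) mA.
rewrite normr1 invr1 mul1e => <-; congr (mu _).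
by apply/funext => t; rewrite /mkset mul1r.
Qed.

Lemma Rintegral_translate k A f : measurable A -> continuous f ->
  (forall t, f (t + k) = f t) ->
  \int[mu]_(t in [set t | A (t + k)]) f t = \int[mu]_(t in A) f t.
Proof.
move=> mA cf per; congr fine.
have mf : measurable_fun [set: R] (fun t => (f t)%:E).
  by apply/measurable_EFinP; exact: continuous_measurable_fun.
have mk : measurable_fun [set: measurableTypeR R]
    (fun t : measurableTypeR R => t + k : measurableTypeR R).
  apply: continuous_measurable_fun => t.
  by apply: continuousD; [exact: cvg_id|exact: cvg_cst].
have push (F : R -> \bar R) : measurable_fun [set: R] F -> (forall t, (0 <= F t)%E) ->
    (forall t : R, F (t + k) = F t) ->
    (\int[mu]_(t in [set t | A (t + k)%R]) F t = \int[mu]_(t in A) F t)%E.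
  move=> mF F0 perF.
  have := @ge0_integral_pushforward _ _ (measurableTypeR R) (measurableTypeR R) R _ mk mu A F
    mA (measurable_funTS mF) (fun t _ => F0 t).
  rewrite (_ : _ \o _ = F); last by apply/funext => t /=; rewrite perF.
  move=> <-; apply: eq_measure_integral => B mB _.
  exact: (lebesgue_translate k mB).
rewrite integralE [RHS]integralE; congr (_ - _)%E.
  apply: push => //; first exact: measurable_funepos.
  by move=> t; rewrite !funeposE per.
apply: push => //; first exact: measurable_funeneg.
by move=> t; rewrite !funenegE per.
Qed.

Lemma continuous_integrable A f (x y : R) : measurable A -> continuous f ->
  A `<=` `[x, y]%classic -> mu.-integrable A (EFin \o f).
Proof.
move=> mA cf Axy; apply: (@integrableS _ _ _ mu `[x, y]%classic) => //.
apply: continuous_compact_integrable; first exact: segment_compact.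
exact: continuous_subspaceT.
Qed.

(** The part of [A] in one period and the part in the window are each cut into three pieces, which
    match under translation by [-1], [0] and [1]. *)
Lemma integral_localized A f t0 rho : measurable A -> continuous f ->
  (forall t, f (t + 1) = f t) -> (forall t, A (t + 1) <-> A t) ->
  0 <= t0 < 1 -> 0 < rho < 1 / 2 ->
  (forall t, 0 <= t < 1 -> A t -> exists z : int, `|t + z%:~R - t0| <= rho) ->
  \int[mu]_(t in A `&` `[0, 1[%classic) f t =
  \int[mu]_(t in A `&` `[t0 - rho, t0 + rho]%classic) f t.
Proof.
move=> mA cf perf perA /andP[t00 t01] /andP[rho0 rho1] near.
have perf' t : f (t + -1) = f t by rewrite -[in RHS](subrK 1 t) perf.
have perA' t : A (t + -1) <-> A t by rewrite -{2}(subrK 1 t) perA.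
pose J : set R := `[t0 - rho, t0 + rho]%classic.
pose Bm := A `&` J `&` `[-1, 0[%classic.
pose B0 := A `&` J `&` `[0, 1[%classic.
pose Bp := A `&` J `&` `[1, 2[%classic.
have mJ : measurable (A `&` J) by exact: (measurableI _ _ mA (measurable_itv _)).
have mBm : measurable Bm by exact: (measurableI _ _ mJ (measurable_itv _)).
have mB0 : measurable B0 by exact: (measurableI _ _ mJ (measurable_itv _)).
have mBp : measurable Bp by exact: (measurableI _ _ mJ (measurable_itv _)).
pose Cm := [set t | Bm (t + -1)]; pose Cp := [set t | Bp (t + 1)].
have mCm : measurable Cm by exact: measurable_translate.
have mCp : measurable Cp by exact: measurable_translate.
have split3 (X Y Z : set R) : measurable X -> measurable Y -> measurable Z ->
    X `<=` `[-1, 2]%classic -> Y `<=` `[-1, 2]%classic -> Z `<=` `[-1, 2]%classic ->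
    X `&` Y = set0 -> (X `|` Y) `&` Z = set0 ->
    \int[mu]_(t in X `|` Y `|` Z) f t =
    \int[mu]_(t in X) f t + \int[mu]_(t in Y) f t + \int[mu]_(t in Z) f t.
  move=> mX mY mZ sX sY sZ XY XYZ.
  have sXY : X `|` Y `<=` `[-1, 2]%classic by move=> t [/sX|/sY].
  have sXYZ : X `|` Y `|` Z `<=` `[-1, 2]%classic by move=> t [/sXY|/sZ].
  rewrite Rintegral_setU//; last 3 first.
  - exact: measurableU.
  - by apply: (continuous_integrable _ cf sXYZ); apply: measurableU => //; exact: measurableU.
  - by apply/disj_set2P.
  rewrite Rintegral_setU//.
    by apply: (continuous_integrable _ cf sXY); exact: measurableU.
  by apply/disj_set2P.
have -> : A `&` `[t0 - rho, t0 + rho]%classic = Bm `|` B0 `|` Bp.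
  apply/seteqP; split => t.
    move=> [At]; rewrite /= in_itv/= => /andP[h1 h2].
    have Jt : J t by rewrite /J /= in_itv/= h1.
    have [tn|tp] := ltP t 0.
      by left; left; split => //; rewrite /= in_itv/= tn andbT; clear - h1 t00 rho1; lra.
    have [t1|t1] := ltP t 1.
      by left; right; split => //; rewrite /= in_itv/= tp.
    by right; split => //; rewrite /= in_itv/= t1; clear - h2 t01 rho1; lra.
  by move=> [[|]|] [[At Jt] _].
have -> : A `&` `[0, 1[%classic = Cm `|` B0 `|` Cp.
  apply/seteqP; split => t.
    move=> [At]; rewrite /= in_itv/= => t01'; have /andP[h1 h2] := t01'.
    have [z] := near t t01' At; rewrite ler_norml => /andP[h3 h4].
    (* Both [t] and [t0] lie in [[0, 1[] and [rho < 1 / 2], so [|z| < 3 / 2]. *)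
    have zlo : (- 2 < z)%R.
      by rewrite -(ltr_int R) mulrNz; clear - h1 h2 h3 h4 t00 t01 rho1; lra.
    have zhi : (z < 2)%R by rewrite -(ltr_int R); clear - h1 h2 h3 h4 t00 t01 rho1; lra.
    have [e|[e|e]] : z = -1 \/ z = 0 \/ z = 1 by clear - zlo zhi; lia.
    - rewrite e mulrNz in h3 h4; left; left; split; last first.
        by rewrite /= in_itv/=; clear - h1 h2 h3 h4 t00 t01 rho0 rho1; apply/andP; split; lra.
      split; first exact/perA'.
      by rewrite /J /= in_itv/=; clear - h1 h2 h3 h4 t00 t01 rho0 rho1; apply/andP; split; lra.
    - rewrite e in h3 h4; left; right; split => //; split => //.
      by rewrite /J /= in_itv/=; clear - h1 h2 h3 h4 t00 t01 rho0 rho1; apply/andP; split; lra.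
    - rewrite e in h3 h4; right; split; last first.
        by rewrite /= in_itv/=; clear - h1 h2 h3 h4 t00 t01 rho0 rho1; apply/andP; split; lra.
      split; first exact/perA.
      by rewrite /J /= in_itv/=; clear - h1 h2 h3 h4 t00 t01 rho0 rho1; apply/andP; split; lra.
  move=> [[|]|].
  - move=> [[At Jt]]; rewrite /= !in_itv/= => /andP[h1 h2]; split; first exact/perA'.
    move: Jt; rewrite /J /= in_itv/=; clear - h1 h2 t00 t01 rho0 rho1 => /andP[? ?].
    by apply/andP; split; lra.
  - by move=> [[At Jt]].
  - move=> [[At Jt]]; rewrite /= !in_itv/= => /andP[h1 h2]; split; first exact/perA.
    move: Jt; rewrite /J /= in_itv/=; clear - h1 h2 t00 t01 rho0 rho1 => /andP[? ?].
    by apply/andP; split; lra.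
rewrite split3//; last 5 first.
- by move=> t [_]; rewrite /= !in_itv/= => /andP[h1 h2]; clear - h1 h2; apply/andP; split; lra.
- by move=> t [_]; rewrite /= !in_itv/= => /andP[h1 h2]; clear - h1 h2; apply/andP; split; lra.
- by move=> t [_]; rewrite /= !in_itv/= => /andP[h1 h2]; clear - h1 h2; apply/andP; split; lra.
- apply/seteqP; split => // t [[_ +] [_ +]]; rewrite /= !in_itv/=.
  by clear - t00 t01 rho0 rho1 => /andP[? ?] /andP[? ?]; lra.
- apply/seteqP; split => // t [[|] [_ +] [_ +]]; rewrite /= !in_itv/=.
    by clear - t00 t01 rho0 rho1 => /andP[? ?] /andP[? ?]; lra.
  by clear - t00 t01 rho0 rho1 => /andP[? ?] /andP[? ?]; lra.
rewrite split3//; last 5 first.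
- by move=> t [_]; rewrite /= !in_itv/= => /andP[h1 h2]; clear - h1 h2; apply/andP; split; lra.
- by move=> t [_]; rewrite /= !in_itv/= => /andP[h1 h2]; clear - h1 h2; apply/andP; split; lra.
- by move=> t [_]; rewrite /= !in_itv/= => /andP[h1 h2]; clear - h1 h2; apply/andP; split; lra.
- apply/seteqP; split => // t [[[_ +] _] [[_ +] _]]; rewrite /J /= !in_itv/=.
  by clear - t00 t01 rho0 rho1 => /andP[? ?] /andP[? ?]; lra.
- apply/seteqP; split => // t [[|] [[_ +] _] [[_ +] _]]; rewrite /J /= !in_itv/=.
    by clear - t00 t01 rho0 rho1 => /andP[? ?] /andP[? ?]; lra.
  by clear - t00 t01 rho0 rho1 => /andP[? ?] /andP[? ?]; lra.
by rewrite /Cm /Cp !Rintegral_translate.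
Qed.

Lemma Rintegral_dot A (phi : R -> plane R) (w : plane R) (x y : R) :
  measurable A -> A `<=` `[x, y]%classic -> smooth1 phi ->
  \int[mu]_(t in A) dot w (velocity phi t) =
  w.1 * \int[mu]_(t in A) (velocity phi t).1 +
  w.2 * \int[mu]_(t in A) (velocity phi t).2.
Proof.
move=> mA Axy [_ _ c1 c2].
have i1 := continuous_integrable mA c1 Axy; have i2 := continuous_integrable mA c2 Axy.
rewrite RintegralD//; last 2 first.
- apply: (continuous_integrable mA _ Axy) => t.
  by apply: cvgM; [exact: cvg_cst|exact: c1].
- apply: (continuous_integrable mA _ Axy) => t.
  by apply: cvgM; [exact: cvg_cst|exact: c2].
by rewrite !RintegralZl.
Qed.

End PeriodicIntegral.

(** * Metric consequences of tameness *)

Section TameGeometry.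
Variable R : realType.
Local Notation mu := (@lebesgue_measure R).
Implicit Types (u v w p q r z : plane R) (T : {fset plane R}).
Implicit Types (M : {fset {fset plane R}}) (phi psi g : R -> plane R) (s t e d : R).

Lemma dotB u z w : dot u (z - w) = dot u z - dot u w.
Proof. by rewrite /dot/=; ring. Qed.

(** Linear isometries of the [l1] norm; those chosen below are coordinate swaps and sign changes. *)
Definition axis_frame u v : Prop :=
  det2 u v != 0 /\ forall z, l1 z = `|dot u z| + `|dot v z|.

(** The dominant coordinate of [z], with its sign, becomes the abscissa. *)
Lemma choose_frame z : exists u v, axis_frame u v /\ `|dot v z| <= dot u z.
Proof.
have dE (a b : R) x : dot (a, b) x = a * x.1 + b * x.2 by [].
have [h|h] := leP `|z.2| `|z.1|; [have [z0|z0] := leP 0 z.1|have [z0|z0] := leP 0 z.2].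
- exists (1, 0), (0, 1); split; [split|].
  + by rewrite /det2/= !mul1r mul0r subr0 oner_neq0.
  + by move=> x; rewrite !dE !mul0r !mul1r addr0 add0r.
  + rewrite !dE !mul0r !mul1r addr0 add0r; rewrite (ger0_norm z0) in h; exact: h.
- exists (-1, 0), (0, 1); split; [split|].
  + by rewrite /det2/= mulr1 mul0r subr0 oppr_eq0 oner_neq0.
  + by move=> x; rewrite !dE !mul0r !mul1r addr0 add0r mulN1r normrN.
  + rewrite !dE !mul0r !mul1r addr0 add0r mulN1r; rewrite (ltr0_norm z0) in h; exact: h.
- exists (0, 1), (1, 0); split; [split|].
  + by rewrite /det2/= mul0r mul1r sub0r oppr_eq0 oner_neq0.
  + by move=> x; rewrite !dE !mul0r !mul1r addr0 add0r addrC.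
  + by rewrite !dE !mul0r !mul1r addr0 add0r; rewrite (ger0_norm z0) in h; exact: ltW.
- exists (0, -1), (1, 0); split; [split|].
  + by rewrite /det2/= mul0r mulr1 sub0r opprK oner_neq0.
  + by move=> x; rewrite !dE !mul0r !mul1r addr0 add0r mulN1r normrN addrC.
  + rewrite !dE !mul0r !mul1r addr0 add0r mulN1r; rewrite (ltr0_norm z0) in h; exact: ltW.
Qed.

Lemma dot_le_l1 u v z : axis_frame u v -> `|dot u z| <= l1 z /\ `|dot v z| <= l1 z.
Proof. by move=> [_ ->]; rewrite lerDl lerDr. Qed.

Lemma nearest_int s t : exists z : int, `|s + z%:~R - t| <= 1 / 2.
Proof.
have [z /andP[h1 h2]] := to_unit_interval (s - t + 1 / 2).
exists (- z); rewrite mulrNz ler_norml; apply/andP; split; lra.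
Qed.

Lemma tame_periodic_int N phi (z : int) t : tame N phi ->
  phi (t + z%:~R) = phi t /\ velocity phi (t + z%:~R) = velocity phi t.
Proof.
move=> [per _ _ _ _]; split; first exact: periodic_int.
apply: periodic_int => s; rewrite /velocity; congr pair; apply: periodic_derive1 => x;
  by rewrite /= per.
Qed.

Lemma tame_ge1 N phi : tame N phi -> (1 : R) <= N%:R.
Proof.
move=> [_ _ _ vel _]; rewrite ler1n lt0n; apply/negP => /eqP N0.
by have [] := vel 0; rewrite N0 mul0r ler10.
Qed.

Lemma tame_l1_lipschitz N phi s t : tame N phi ->
  l1 (phi s - phi t) <= 2 * N%:R * `|s - t| /\
  l1 (velocity phi s - velocity phi t) <= 2 * N%:R * `|s - t|.
Proof.
move=> tphi; have [h1 h2] := tame_lipschitz tphi s t.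
have [h3 h4] := tame_velocity_lipschitz tphi s t.
rewrite -mulrA [2 * _]mulr_natl mulr2n; split; exact: lerD.
Qed.

Lemma tame_l1_velocity N phi t : tame N phi -> 1 <= N%:R * l1 (velocity phi t).
Proof.
move=> [_ _ _ vel _]; rewrite /l1 mulrDr.
by have [h|h] := vel t; apply: le_trans h _; rewrite ?lerDl ?lerDr mulr_ge0.
Qed.

(** An integer first brings [s] within [1 / 2] of [t], where the last clause of [tame] applies. *)
Lemma tame_separation N phi s t d : tame N phi -> l1 (phi s - phi t) <= d ->
  exists z : int, `|s + z%:~R - t| <= N%:R * d.
Proof.
move=> tphi sd; have [z hz] := nearest_int s t; exists z.
have [_ _ _ _ sep] := tphi; apply: le_trans (sep _ _ hz) _.
by rewrite ler_wpM2l//; have [-> _] := tame_periodic_int z s tphi.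
Qed.

Lemma null_subset (A B : set R) : measurable A -> measurable B -> A `<=` B ->
  mu B = 0%E -> mu A = 0%E.
Proof.
move=> mA mB AB B0.
exact: (@subset_measure0 _ _ _ mu A B mA mB AB B0).
Qed.

Lemma null_finite_cover (I : eqType) (s : seq I) (A : I -> set R) (B : set R) :
  (forall i, i \in s -> measurable (A i) /\ mu (A i) = 0%E) -> measurable B ->
  (forall t, B t -> exists2 i, i \in s & A i t) -> mu B = 0%E.
Proof.
elim: s B => [|i s IH] B H mB cov.
  by rewrite (_ : B = set0) ?measure0//; apply/seteqP; split => // t /cov[].
have [mAi Ai0] := H i (mem_head _ _).
have BD : mu (B `\` A i) = 0%E.
  apply: IH => //.
  - by move=> j js; apply: H; rewrite inE js orbT.
  - exact: measurableD.
  - move=> t [/cov[j]]; rewrite inE => /predU1P[-> //|js Aj _]; by exists j.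
have BI : mu (B `&` A i) = 0%E.
  by apply: (@null_subset _ (A i)) => //; exact: measurableI.
have -> : mu B = (mu (B `&` A i) + mu (B `\` A i))%E.
  rewrite -[in LHS](setUIDK B (A i)); apply: measureU.
  - exact: measurableI.
  - exact: measurableD.
  - by rewrite setDE setIACA setICr !setI0.
by rewrite BI BD adde0.
Qed.

Lemma measurable_hull_preimage T g : smooth1 g -> is_triangle T ->
  measurable [set t | hull T (g t)].
Proof.
move=> sg [p [q [r [-> D0]]]]; rewrite -/(orient p q r) in D0.
by rewrite hull3//; exact: measurable_tri_preimage.
Qed.

(** Finitely many triangles cover an interval of positive length, so the curve spends positive time
    in one of them during it. An arbitrary triangle through [g t0] could be met for a negligible
    time only. *)
Lemma positive_triangle M g t0 e : smooth1 g -> is_mesh M -> covers_curve M g ->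
  0 < e -> exists2 T, T \in M &
    (0 < mu ([set t | hull T (g t)] `&` `[t0, (t0 + e)%R]%classic))%E.
Proof.
move=> sg mesh cov e0; apply: contrapT => N.
have : mu `[t0, (t0 + e)]%classic = 0%E.
  apply: (@null_finite_cover _ (enum_fset M)
    (fun T => [set t | hull T (g t)] `&` `[t0, (t0 + e)]%classic)) => //.
    move=> T TM; split.
      apply: measurableI => //; exact: measurable_hull_preimage (mesh.1 _ TM).
    apply/eqP; rewrite eq_le measure_ge0 andbT leNgt; apply/negP => h.
    by apply: N; exists T.
  by move=> t tI; have [T TM Tt] := cov t; exists T.
rewrite lebesgue_measure_itv/= lte_fin ltrDl e0 => /eqP.
by rewrite -EFinB addrAC subrr add0r eqe gt_eqF.
Qed.

Lemma Rintegral_gt0_exists A B (f h : R -> R) (x y c : R) :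
  measurable A -> measurable B -> A `<=` `[x, y]%classic -> B `<=` `[x, y]%classic ->
  continuous f -> continuous h -> (0 < mu A)%E -> 0 < c ->
  (forall t, A t -> c <= f t) -> \int[mu]_(t in A) f t = \int[mu]_(t in B) h t ->
  exists2 t, B t & 0 < h t.
Proof.
move=> mA mB Axy Bxy cf ch A0 c0 fc e; apply: contrapT => N.
have i1 := continuous_integrable mA cf Axy; have i2 := continuous_integrable mB ch Bxy.
have icst D k : measurable D -> D `<=` `[x, y]%classic -> mu.-integrable D (EFin \o cst k).
  by move=> mD Dxy; apply: (continuous_integrable mD _ Dxy) => ?; exact: cvg_cst.
have : \int[mu]_(t in B) h t <= \int[mu]_(t in B) 0.
  apply: le_Rintegral => //; first exact: icst.
  by move=> t Bt; rewrite leNgt; apply/negP => ht; apply: N; exists t.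
have : \int[mu]_(t in A) c <= \int[mu]_(t in A) f t.
  by apply: le_Rintegral => //; exact: icst.
rewrite -e !Rintegral_cst// mul0r => h1 h2.
have : 0 < c * fine (mu A).
  rewrite mulr_gt0// fine_gt0// A0/= -ge0_fin_numE ?measure_ge0//.
  by apply: bounded_measurable_fin; split => //; exists x, y.
by move=> h3; have := lt_le_trans h3 (le_trans h1 h2); rewrite ltxx.
Qed.

End TameGeometry.

(** * Transferring the direction of one curve to the other *)

Section DirectionTransfer.
Variable R : realType.
Local Notation mu := (@lebesgue_measure R).
Implicit Types (u v w p q r z : plane R) (T : {fset plane R}).
Implicit Types (M : {fset {fset plane R}}) (phi psi g : R -> plane R) (s t e d h : R).

Lemma pow_le (K h : R) (i j : nat) : 1 <= K -> 0 <= h -> (i <= j)%N ->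
  K ^+ i * h <= K ^+ j * h.
Proof. by move=> K1 h0 ij; rewrite ler_wpM2r// ler_weXn2l. Qed.

Lemma shear_dot u v z : dot (u + (1 / 4) *: v) z = dot u z + dot v z / 4.
Proof. by rewrite /dot /= /GRing.scale/=; field. Qed.

(** Multiplied by [N], the components of the velocity vary by at most [1 / 50] over the window. With
    slope at most about [2], adding a quarter of [dot v] removes at most about half of [dot u], so
    both abscissas increase. *)
Lemma tame_arc N g t0 u v h rho : tame N g -> axis_frame u v -> 0 < h ->
  N%:R ^+ 3 * h <= 1 / 1000 -> N%:R ^+ 2 * rho <= 1 / 100 ->
  1 <= 4 * N%:R * dot u (velocity g t0) ->
  `|dot v (velocity g t0)| <= 2 * dot u (velocity g t0) + 12 * (N%:R ^+ 2 * h) ->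
  forall t, `|t - t0| <= rho ->
  1 <= 8 * N%:R * dot u (velocity g t) /\
  1 <= 16 * N%:R * dot (u + (1 / 4) *: v) (velocity g t).
Proof.
move=> tg uv h0 hK rK du dv t tt0.
have K1 := tame_ge1 tg; set K : R := N%:R in hK rK du dv K1 *.
have K0 : 0 < K by apply: lt_le_trans K1.
have [_ vl] := tame_l1_lipschitz t t0 tg.
have vl' : K * l1 (velocity g t - velocity g t0) <= 1 / 50.
  have : K * l1 (velocity g t - velocity g t0) <= K * (2 * K * rho).
    by rewrite ler_wpM2l ?(ltW K0)// (le_trans vl)// ler_wpM2l// mulr_ge0.
  have -> : K * (2 * K * rho) = 2 * (K ^+ 2 * rho) by ring.
  by move=> /le_trans; apply; lra.
have [] := dot_le_l1 (velocity g t - velocity g t0) uv.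
rewrite !dotB => h1 h2.
have {}h1 : `|K * (dot u (velocity g t) - dot u (velocity g t0))| <= 1 / 50.
  by rewrite normrM (gtr0_norm K0); apply: le_trans (ler_wpM2l (ltW K0) h1) _.
have {}h2 : `|K * (dot v (velocity g t) - dot v (velocity g t0))| <= 1 / 50.
  by rewrite normrM (gtr0_norm K0); apply: le_trans (ler_wpM2l (ltW K0) h2) _.
have {}dv : `|K * dot v (velocity g t0)| <= 2 * (K * dot u (velocity g t0)) + 12 * (K ^+ 3 * h).
  rewrite normrM (gtr0_norm K0); apply: le_trans (ler_wpM2l (ltW K0) dv) _.
  by rewrite le_eqVlt; apply/orP; left; apply/eqP; ring.
rewrite shear_dot; move: h1 h2 dv; rewrite !ler_norml => /andP[a1 a2] /andP[b1 b2] /andP[c1 c2].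
move: hK du a1 a2 b1 b2 c1 c2; clear; do 4!move: (dot _ _) => ?; by move=> *; split; lra.
Qed.

Lemma derive_lower_bound (F f : R -> R) (a b s t c : R) :
  (forall x : R, is_derive x 1 F (f x)) ->
  (forall x, x \in `[a, b] -> c <= f x) -> s \in `[a, b] -> t \in `[a, b] -> s <= t ->
  c * (t - s) <= F t - F s.
Proof.
move=> dF cf sab tab; rewrite le_eqVlt => /predU1P[->|st]; first by rewrite !subrr mulr0.
have cF : continuous F.
  by move=> x; apply/differentiable_continuous/derivable1_diffP; have [] := dF x.
have [x xst ->] := MVT st (fun x _ => dF x) (continuous_subspaceT cF).
rewrite ler_wpM2r ?subr_ge0 ?(ltW st)//; apply: cf; exact: itv_sub sab tab xst.
Qed.

Lemma arc_expanding g t0 u rho c : smooth1 g -> 0 < rho -> 0 < c ->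
  (forall t, `|t - t0| <= rho -> c <= dot u (velocity g t)) ->
  [/\ is_arc g (t0 - rho) (t0 + rho) u,
    forall t, `|t - t0| <= rho -> c * `|t - t0| <= `|dot u (g t) - dot u (g t0)| &
    forall z, `|dot u z - dot u (g t0)| < c * rho ->
      in_range g (t0 - rho) (t0 + rho) u z].
Proof.
move=> sg rho0 c0 lo.
pose a := t0 - rho; pose b := t0 + rho.
have inab x : x \in `[a, b] = (`|x - t0| <= rho).
  rewrite in_itv/= ler_norml /a /b; apply/andP/andP => -[? ?]; split; lra.
have lo' x : x \in `[a, b] -> c <= dot u (velocity g x) by rewrite inab => /lo.
have t0ab : t0 \in `[a, b] by rewrite inab subrr normr0 ltW.
have aab : a \in `[a, b] by rewrite in_itv/=; apply/andP; split; rewrite /a /b; lra.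
have bab : b \in `[a, b] by rewrite in_itv/=; apply/andP; split; rewrite /a /b; lra.
have D := derive_lower_bound (fun x => is_derive_dot u x sg) lo'.
split.
- split; first by rewrite -/a -/b /a /b; lra.
  by move=> x /lo'; exact: lt_le_trans.
- move=> t; rewrite -inab => tab; have [le|/ltW le] := leP t0 t.
    rewrite ger0_norm ?subr_ge0//; apply: le_trans (D _ _ t0ab tab le) _.
    exact: ler_norm.
  rewrite distrC ger0_norm ?subr_ge0// distrC; apply: le_trans (D _ _ tab t0ab le) _.
  exact: ler_norm.
- move=> z; rewrite ltr_norml => /andP[h1 h2].
  have := D _ _ t0ab bab; have := D _ _ aab t0ab.
  rewrite /a /b => /(_ _) d1 /(_ _) d2.
  have {}d1 : c * rho <= dot u (g t0) - dot u (g (t0 - rho)).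
    by have := d1; rewrite (_ : t0 - (t0 - rho) = rho); [apply; lra|ring].
  have {}d2 : c * rho <= dot u (g (t0 + rho)) - dot u (g t0).
    by have := d2; rewrite (_ : t0 + rho - t0 = rho); [apply; lra|ring].
  by rewrite /in_range; apply/andP; split; lra.
Qed.

Lemma frame_coord u v : axis_frame u v ->
  [/\ `|u.1| <= 1, `|u.2| <= 1, `|v.1| <= 1 & `|v.2| <= 1].
Proof.
move=> [_ E].
have e1 := E (1, 0); have e2 := E (0, 1).
rewrite /l1 /dot /= !mulr1 !mulr0 !addr0 normr1 normr0 addr0 in e1.
rewrite /l1 /dot /= !mulr1 !mulr0 !add0r normr1 normr0 add0r in e2.
have p1 := normr_ge0 u.1; have p2 := normr_ge0 u.2.
have p3 := normr_ge0 v.1; have p4 := normr_ge0 v.2.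
by split; lra.
Qed.

(* The vector data of a triangle fix the direction of the curve inside it up to
   O(h), orientation included. *)
Lemma direction_transfer N phi psi M t0 u v (h : R) :
  tame N phi -> tame N psi -> is_mesh M -> covers_curve M phi ->
  h = mesh_size M -> 0 < h -> N%:R ^+ 3 * h <= 1 / 1000 ->
  (forall T w, T \in M ->
    \int[mu]_(t in [set t | hull T (phi t)] `&` `[0, 1[%classic) dot w (velocity phi t) =
    \int[mu]_(t in [set t | hull T (psi t)] `&` `[0, 1[%classic) dot w (velocity psi t)) ->
  0 <= t0 < 1 -> axis_frame u v -> `|dot v (velocity phi t0)| <= dot u (velocity phi t0) ->
  exists s0, [/\ 0 <= s0 < 1, l1 (psi s0 - phi t0) <= 4 * N%:R * h,
    1 <= 4 * N%:R * dot u (velocity psi s0) &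
    `|dot v (velocity psi s0)| <= 2 * dot u (velocity psi s0) + 12 * (N%:R ^+ 2 * h)].
Proof.
move=> tphi tpsi mesh cov hE h0 hK data /andP[t00 t01] uv dv0.
have K1 := tame_ge1 tphi; set K : R := N%:R in hK K1 *.
have K0 : 0 < K by apply: lt_le_trans K1.
have sphi := tame_smooth1 tphi; have spsi := tame_smooth1 tpsi.
(* Keeps [[t0, t0 + e]] inside [[0, 1[] and within [h] of [t0]. *)
pose e := Num.min h ((1 - t0) / 2).
have e0 : 0 < e by rewrite lt_min h0 divr_gt0// subr_gt0.
have [eh e1] : e <= h /\ e <= (1 - t0) / 2 by split; rewrite /e ge_min lexx ?orbT.
have [T TM posT] := positive_triangle t0 sphi mesh cov e0.
pose A := [set t | hull T (phi t)] `&` `[0, 1[%classic.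
pose B := [set t | hull T (psi t)] `&` `[0, 1[%classic.
have triT := mesh.1 _ TM.
have mA : measurable A by apply: measurableI => //; exact: measurable_hull_preimage.
have mB : measurable B by apply: measurableI => //; exact: measurable_hull_preimage.
have muA : (0 < mu A)%E.
  apply: lt_le_trans posT _; apply: le_measure; rewrite ?inE//.
    by apply: measurableI => //; exact: measurable_hull_preimage.
  move=> t [Tt]; rewrite /= in_itv/= => /andP[h1 h2]; split => //=.
  by clear - h1 h2 t00 t01 e1; rewrite in_itv/=; apply/andP; split; lra.
have [t1 [Tt1 t1I]] : exists t1, hull T (phi t1) /\ `|t1 - t0| <= h.
  have : [set t | hull T (phi t)] `&` `[t0, (t0 + e)]%classic !=set0.
    apply/set0P/eqP => E; move: posT; rewrite E measure0 ltxx//.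
  move=> [t1 [Tt1]]; rewrite /= in_itv/= => /andP[h1 h2]; exists t1; split => //.
  by clear - h1 h2 eh; rewrite ger0_norm; lra.
have A01 : A `<=` `[0, 1]%classic.
  by move=> t [_]; rewrite /= !in_itv/= => /andP[-> /ltW].
have B01 : B `<=` `[0, 1]%classic.
  by move=> t [_]; rewrite /= !in_itv/= => /andP[-> /ltW].
have two g s t : tame N g -> hull T (g s) -> hull T (g t) ->
    exists z : int, `|s + z%:~R - t| <= 2 * (K * h).
  move=> tg Ts Tt; have := mesh_size_l1 mesh TM Ts Tt; rewrite -hE.
  by move=> /(tame_separation tg)[z]; exists z; rewrite mulrCA.
have velo g s t d : tame N g -> `|s - t| <= d ->
    `|dot u (velocity g s) - dot u (velocity g t)| <= 2 * (K * d) /\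
    `|dot v (velocity g s) - dot v (velocity g t)| <= 2 * (K * d).
  move=> tg st; have [_ vl] := tame_l1_lipschitz s t tg.
  have le : 2 * K * `|s - t| <= 2 * (K * d).
    by rewrite -mulrA ler_wpM2l// ler_wpM2l// ltW.
  have [] := dot_le_l1 (velocity g s - velocity g t) uv; rewrite !dotB => h1 h2.
  by split; [apply: le_trans h1 _|apply: le_trans h2 _]; exact: le_trans vl le.
have vel0 := tame_l1_velocity t0 tphi; rewrite uv.2 in vel0.
have u0 : 0 <= dot u (velocity phi t0) by apply: le_trans dv0.
rewrite (ger0_norm u0) -/K in vel0.
have h26 := pow_le K1 (ltW h0) (isT : (2 <= 3)%N).
have h12 := pow_le K1 (ltW h0) (isT : (1 <= 2)%N).
have h01 := pow_le K1 (ltW h0) (isT : (0 <= 1)%N).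
rewrite expr0 mul1r expr1 in h01; rewrite expr1 in h12.
(* A lower bound for both integrands along [phi]: at [t0] the choice of the frame gives
   [K * dot u >= 1 / 2], and the variation inside the triangle is a small multiple of
   [K ^+ 3 * h]. *)
pose c := (K * 8)^-1.
have c0 : 0 < c by rewrite invr_gt0 mulr_gt0.
(* The forms [2 u + v] and [2 u - v] have positive integrals along phi, hence along psi. *)
have sign (sg : R) : sg = 1 \/ sg = -1 ->
    exists2 s, B s & 0 < dot (2 *: u + sg *: v) (velocity psi s).
  move=> sg1.
  have dotE z : dot (2 *: u + sg *: v) z = 2 * dot u z + sg * dot v z.
    by rewrite /dot /= /GRing.scale/=; ring.
  apply: (@Rintegral_gt0_exists _ A B _ _ 0 1 c mA mB A01 B01 _ _ muA c0 _ (data T _ TM)).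
  - exact: continuous_dot_velocity.
  - exact: continuous_dot_velocity.
  move=> t [/= Tt _]; have [z hz] := two phi t t1 tphi Tt Tt1.
  have [_ <-] := tame_periodic_int z t tphi.
  have ht : `|t + z%:~R - t0| <= 3 * (K * h).
    have := ler_distD t1 (t + z%:~R) t0; clear - hz t1I h01 h12; lra.
  have [v1 v2] := velo phi _ _ _ tphi ht.
  have v1' : `|K * (dot u (velocity phi (t + z%:~R)) - dot u (velocity phi t0))| <=
      6 * (K ^+ 3 * h).
    rewrite normrM (gtr0_norm K0); apply: le_trans (ler_wpM2l (ltW K0) v1) _.
    by rewrite le_eqVlt; apply/orP; left; apply/eqP; ring.
  have v2' : `|K * (dot v (velocity phi (t + z%:~R)) - dot v (velocity phi t0))| <=
      6 * (K ^+ 3 * h).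
    rewrite normrM (gtr0_norm K0); apply: le_trans (ler_wpM2l (ltW K0) v2) _.
    by rewrite le_eqVlt; apply/orP; left; apply/eqP; ring.
  have dv0' : `|K * dot v (velocity phi t0)| <= K * dot u (velocity phi t0).
    by rewrite normrM (gtr0_norm K0) ler_wpM2l// ltW.
  rewrite /c -[leLHS]mul1r ler_pdivrMr ?mulr_gt0// dotE.
  move: v1' v2' dv0'; rewrite !ler_norml => /andP[a1 a2] /andP[b1 b2] /andP[c1 c2].
  have dv0K : K * `|dot v (velocity phi t0)| <= K * dot u (velocity phi t0).
    by rewrite ler_wpM2l// ltW.
  move: sg1 a1 a2 b1 b2 c1 c2 vel0 hK dv0K; clear; do 4!move: (dot _ _) => ?.
  by case=> -> *; lra.
have [s1 [/= Ts1 s1I] pos1] := sign 1 (or_introl erefl).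
have [s2 [/= Ts2 s2I] pos2] := sign (-1) (or_intror erefl).
(* The two positivity points may differ, but both lie in [T]. Moving the second inequality to [s1]
   changes each component by at most [4 * (K ^+ 2 * h)], whence [12 = 2 * 4 + 4]. *)
have [z hz] := two psi s2 s1 tpsi Ts2 Ts1.
rewrite -(proj2 (tame_periodic_int z s2 tpsi)) in pos2.
have dotE (sg : R) y : dot (2 *: u + sg *: v) y = 2 * dot u y + sg * dot v y.
  by rewrite /dot /= /GRing.scale/=; ring.
rewrite !dotE in pos1 pos2.
have [w1 w2] := velo psi _ _ _ tpsi hz.
have E2 : 2 * (K * (2 * (K * h))) = 4 * (K ^+ 2 * h) by ring.
rewrite E2 in w1 w2.
have dv1 : `|dot v (velocity psi s1)| <= 2 * dot u (velocity psi s1) + 12 * (K ^+ 2 * h).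
  move: w1 w2; rewrite !ler_norml => /andP[a1 a2] /andP[b1 b2].
  move: pos1 pos2 a1 a2 b1 b2; clear; do 4!move: (dot _ _) => ?.
  by move=> *; apply/andP; split; lra.
exists s1; split => //.
- have := mesh_size_l1 mesh TM Ts1 Tt1; rewrite -hE => m1.
  have [m2 _] := tame_l1_lipschitz t1 t0 tphi.
  have m3 : 2 * K * `|t1 - t0| <= 2 * (K * h).
    by rewrite -mulrA ler_wpM2l// ler_wpM2l// ltW.
  have := l1_dist (psi s1) (phi t1) (phi t0); clear - m1 m2 m3 t1I h01 h12; lra.
have vel1 := tame_l1_velocity s1 tpsi; rewrite uv.2 -/K in vel1.
have Kdv : K * `|dot v (velocity psi s1)| <= 2 * (K * dot u (velocity psi s1)) + 12 * (K ^+ 3 * h).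
  apply: le_trans (ler_wpM2l (ltW K0) dv1) _.
  by rewrite le_eqVlt; apply/orP; left; apply/eqP; ring.
have n1 : 0 <= K * `|dot v (velocity psi s1)| by rewrite mulr_ge0// ltW.
have [u1|u1] := leP 0 (dot u (velocity psi s1)).
  by rewrite (ger0_norm u1) in vel1; clear - vel1 Kdv hK; lra.
by rewrite (ltr0_norm u1) in vel1; clear - vel1 Kdv n1 hK; lra.
Qed.

End DirectionTransfer.

(** * Meeting points near a prescribed abscissa *)

Section Meeting.
Variable R : realType.
Local Notation mu := (@lebesgue_measure R).
Implicit Types (u v w p q r z : plane R) (T : {fset plane R}).
Implicit Types (M : {fset {fset plane R}}) (phi psi g : R -> plane R) (s t e d h : R).

(** The data run over a full period; quantitative injectivity confines every passage through [T],
    modulo [1], to the window. *)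
Lemma local_integrals N g T t0 w rho D : tame N g -> is_triangle T ->
  0 <= t0 < 1 -> 0 < rho < 1 / 2 ->
  (forall z, hull T z -> l1 (z - g t0) <= D) -> N%:R * D <= rho ->
  \int[mu]_(t in [set t | hull T (g t)] `&` `[0, 1[%classic) dot w (velocity g t) =
  \int[mu]_(t in [set t | hull T (g t)] `&` `[t0 - rho, t0 + rho]%classic)
    dot w (velocity g t).
Proof.
move=> tg triT t01 rho0 TD Drho; have sg := tame_smooth1 tg.
apply: integral_localized => //.
- exact: measurable_hull_preimage.
- exact: continuous_dot_velocity.
- by move=> t; have [_] := tame_periodic_int 1 t tg; rewrite mulr1z => ->.
- by move=> t; rewrite /=; have [+ _] := tame_periodic_int 1 t tg; rewrite mulr1z => ->.
- move=> t _ /= /TD /(tame_separation tg)[z hz]; exists z; exact: le_trans Drho.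
Qed.

(** [rho] is such that the arcs reach [2400 * (N%:R ^+ 3 * h)] in the coordinate [u] and
    [1200 * (N%:R ^+ 3 * h)] in the sheared one. This must exceed the distance from the base points
    to every triangle that can matter, including the drift between the parameters of the two curves.
    Edges have [l1] length at most [2 * h], so the window of radius [3 * H] becomes [6 * h]. *)
Lemma meeting_point N phi psi M t0 s0 u v h rho c :
  tame N phi -> tame N psi -> is_mesh M -> covers_curve M phi -> covers_curve M psi ->
  general_position phi M -> general_position psi M ->
  h = mesh_size M -> 0 < h ->
  rho = 16 * N%:R * (1200 * (N%:R ^+ 3 * h)) -> N%:R ^+ 2 * rho <= 1 / 100 ->
  (forall T w, T \in M ->
    \int[mu]_(t in [set t | hull T (phi t)] `&` `[0, 1[%classic) dot w (velocity phi t) =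
    \int[mu]_(t in [set t | hull T (psi t)] `&` `[0, 1[%classic) dot w (velocity psi t)) ->
  0 <= t0 < 1 -> 0 <= s0 < 1 -> l1 (psi s0 - phi t0) <= 4 * N%:R * h ->
  axis_frame u v ->
  (forall g t, g = phi /\ `|t - t0| <= rho \/ g = psi /\ `|t - s0| <= rho ->
    1 <= 8 * N%:R * dot u (velocity g t) /\
    1 <= 16 * N%:R * dot (u + (1 / 4) *: v) (velocity g t)) ->
  `|c| <= 48 * h ->
  exists t s, [/\ t \in `[t0 - rho, t0 + rho], s \in `[s0 - rho, s0 + rho],
    phi t = psi s & `|dot u (phi t) - (dot u (phi t0) + c)| < 6 * h].
Proof.
move=> tphi tpsi mesh cphi cpsi gphi gpsi hE h0 rhoE Krho data t01 s01 st0 uv lo ch.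
have K1 := tame_ge1 tphi; set K : R := N%:R in rhoE Krho st0 lo K1 *.
have K0 : 0 < K by apply: lt_le_trans K1.
have h01 := pow_le K1 (ltW h0) (isT : (0 <= 1)%N).
have h12 := pow_le K1 (ltW h0) (isT : (1 <= 2)%N).
have h23 := pow_le K1 (ltW h0) (isT : (2 <= 3)%N).
rewrite expr0 mul1r expr1 in h01; rewrite expr1 in h12.
have P3 : 0 < K ^+ 3 * h by rewrite mulr_gt0// exprn_gt0.
have P4 : 0 < K * (K ^+ 3 * h) by rewrite mulr_gt0.
have rho0 : 0 < rho by rewrite rhoE; clear - P4; lra.
have Krho1 : rho <= K ^+ 2 * rho.
  by have := pow_le K1 (ltW rho0) (isT : (0 <= 2)%N); rewrite expr0 mul1r.
have rho12 : 0 < rho < 1 / 2 by rewrite rho0/=; clear - Krho Krho1; lra.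
set u' := u + (1 / 4) *: v in lo *.
pose c8 := (8 * K)^-1; pose c16 := (16 * K)^-1.
have c80 : 0 < c8 by rewrite invr_gt0 mulr_gt0.
have c160 : 0 < c16 by rewrite invr_gt0 mulr_gt0.
have c8rho : c8 * rho = 2400 * (K ^+ 3 * h) by rewrite /c8 rhoE; field; rewrite gt_eqF.
have c16rho : c16 * rho = 1200 * (K ^+ 3 * h) by rewrite /c16 rhoE; field; rewrite gt_eqF.
(* [934 = 928 + 2 + 4]: the displacement along [psi], the size of a triangle, and the distance
   between the base points. The factor [5 / 4] bounds the sheared coordinate by the [l1] norm, and
   [5 / 4 * 934 < 1200]. *)
have [D [leD KD cD]] : exists D, [/\ forall x, x <= 934 * (K ^+ 3 * h) -> x <= D,
    K * D <= rho & 5 / 4 * D < c16 * rho].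
  exists (934 * (K ^+ 3 * h)); clear - c16rho rhoE P3 P4.
  by split => [//||]; rewrite ?c16rho ?rhoE; lra.
have c60 : 60 * (K ^+ 3 * h) < c8 * rho by rewrite c8rho; clear - P3; lra.
clear Krho Krho1 rhoE c8rho c16rho.
have sphi := tame_smooth1 tphi; have spsi := tame_smooth1 tpsi.
have lo8 g t : g = phi /\ `|t - t0| <= rho \/ g = psi /\ `|t - s0| <= rho ->
    c8 <= dot u (velocity g t).
  by move=> /lo[h1 _]; rewrite -(ler_pM2l (_ : 0 < 8 * K)) ?mulr_gt0// mulfV// gt_eqF// mulr_gt0.
have lo16 g t : g = phi /\ `|t - t0| <= rho \/ g = psi /\ `|t - s0| <= rho ->
    c16 <= dot u' (velocity g t).
  by move=> /lo[_ h1]; rewrite -(ler_pM2l (_ : 0 < 16 * K)) ?mulr_gt0// mulfV// gt_eqF// mulr_gt0.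
have [pa1 pe1 pr1] := arc_expanding sphi rho0 c80
  (fun t ht => lo8 phi t (or_introl (conj erefl ht))).
have [pa2 _ pr2] := arc_expanding sphi rho0 c160
  (fun t ht => lo16 phi t (or_introl (conj erefl ht))).
have [qa1 qe1 qr1] := arc_expanding spsi rho0 c80
  (fun t ht => lo8 psi t (or_intror (conj erefl ht))).
have [qa2 _ qr2] := arc_expanding spsi rho0 c160
  (fun t ht => lo16 psi t (or_intror (conj erefl ht))).
have dl z : `|dot u z| <= l1 z /\ `|dot u' z| <= 5 / 4 * l1 z.
  have [h1 h2] := dot_le_l1 z uv; split => //.
  rewrite /u' shear_dot (le_trans (ler_normD _ _))// normrM (gtr0_norm (_ : 0 < 4^-1))//.
  by clear - h1 h2; lra.
have ust0 : `|dot u (psi s0) - dot u (phi t0)| <= 4 * (K * h).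
  by have [+ _] := dl (psi s0 - phi t0); rewrite dotB; clear - st0; lra.
have inab x y : x \in `[y - rho, y + rho] -> `|x - y| <= rho.
  by clear; rewrite in_itv/= ler_norml => /andP[? ?]; apply/andP; split; lra.
have k0 : (0 : R) < 1 / 4 by clear; lra.
have h20 : 0 < 2 * h by rewrite mulr_gt0.
have -> : 6 * h = 3 * (2 * h) by ring.
apply: (@arcs_meet R M phi psi (t0 - rho) (t0 + rho) (s0 - rho) (s0 + rho) u v (1 / 4) _ (2 * h)
  sphi spsi uv.1 k0 pa1 pa2 qa1 qa2 mesh cphi cpsi gphi gpsi h20).
- move=> T x y TM xT yT.
  have := mesh_size_l1 mesh TM (hull_vertex xT) (hull_vertex yT); rewrite -hE => m1.
  by rewrite -dotB; have [d1 _] := dl (x - y); clear - m1 d1; lra.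
- move=> z; rewrite ltr_norml => /andP[h1 h2].
  move: ch ust0; rewrite !ler_norml => /andP[a1 a2] /andP[b1 b2].
  by split; [apply: pr1|apply: qr1]; apply: lt_trans c60;
    clear - h1 h2 a1 a2 b1 b2 h0 h01 h12 h23; rewrite ltr_norml; apply/andP; split; lra.
- move=> T TM Tc meet.
  have far z : hull T z -> l1 (z - phi t0) <= D /\ l1 (z - psi s0) <= D.
    move=> Tz; have [p [q [r [TE _]]]] := mesh.1 _ TM.
    have pT : p \in T by rewrite TE !inE eqxx.
    have pc := Tc _ pT; have Tp := hull_vertex pT.
    (* [54 = 48 + 4 + 2]: the offset [c], the window [2 * H] with [H = 2 * h], and the size of the
       triangle. *)
    have near y : hull T y -> `|dot u y - dot u (phi t0)| <= 54 * h.
      move=> Ty; have := mesh_size_l1 mesh TM Ty Tp; rewrite -hE => m1.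
      have [d1 _] := dl (y - p); rewrite dotB in d1.
      move: ch pc; rewrite !ler_norml => /andP[a1 a2] /andP[c1 c2].
      have {}d1 : `|dot u y - dot u p| <= 2 * h by clear - d1 m1; lra.
      move: d1; rewrite ler_norml; clear - a1 a2 c1 c2 => /andP[? ?].
      by apply/andP; split; lra.
    case: meet => -[t /inab tI Tt]; have nt := near _ Tt;
      have mz := mesh_size_l1 mesh TM Tz Tt; rewrite -hE in mz.
      have ht : `|t - t0| <= 432 * (K * h).
        have := le_trans (pe1 _ tI) nt; rewrite /c8 mulrC ler_pdivrMr ?mulr_gt0//.
        by move=> /le_trans; apply; rewrite le_eqVlt; apply/orP; left; apply/eqP; ring.
      have [lt _] := tame_l1_lipschitz t t0 tphi.
      have {}lt : l1 (phi t - phi t0) <= 864 * (K ^+ 2 * h).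
        have : 2 * K * `|t - t0| <= 2 * K * (432 * (K * h)) by rewrite ler_wpM2l// mulr_ge0// ltW.
        by move=> /(le_trans lt) /le_trans; apply; rewrite le_eqVlt;
          apply/orP; left; apply/eqP; ring.
      have d1 := l1_dist z (phi t) (phi t0).
      have d2 := l1_dist z (phi t0) (psi s0); rewrite (l1_sym (phi t0)) in d2.
      by split; apply: leD; clear - mz lt d1 d2 st0 h0 h01 h12 h23; lra.
    have ht : `|t - s0| <= 464 * (K ^+ 2 * h).
      have nt' : `|dot u (psi t) - dot u (psi s0)| <= 58 * (K * h).
        move: nt ust0; rewrite !ler_norml => /andP[a1 a2] /andP[b1 b2].
        by clear - a1 a2 b1 b2 h0 h01; apply/andP; split; lra.
      have := le_trans (qe1 _ tI) nt'; rewrite /c8 mulrC ler_pdivrMr ?mulr_gt0//.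
      by move=> /le_trans; apply; rewrite le_eqVlt; apply/orP; left; apply/eqP; ring.
    have [lt _] := tame_l1_lipschitz t s0 tpsi.
    have {}lt : l1 (psi t - psi s0) <= 928 * (K ^+ 3 * h).
      have : 2 * K * `|t - s0| <= 2 * K * (464 * (K ^+ 2 * h)).
        by rewrite ler_wpM2l// mulr_ge0// ltW.
      by move=> /(le_trans lt) /le_trans; apply; rewrite le_eqVlt;
        apply/orP; left; apply/eqP; ring.
    have d1 := l1_dist z (psi t) (psi s0).
    have d2 := l1_dist z (psi s0) (phi t0).
    by split; apply: leD; clear - mz lt d1 d2 st0 h0 h01 h12 h23; lra.
  split.
    move=> x xT; have [f1 f2] := far _ (hull_vertex xT).
    have [_ d1] := dl (x - phi t0); have [_ d2] := dl (x - psi s0).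
    by split; [apply: pr2|apply: qr2]; rewrite -dotB; apply: le_lt_trans cD;
      clear - f1 f2 d1 d2; lra.
  move=> w _; rewrite -(local_integrals w tphi (mesh.1 _ TM) t01 rho12 (fun z Tz => (far z Tz).1) KD).
  rewrite -(local_integrals w tpsi (mesh.1 _ TM) s01 rho12 (fun z Tz => (far z Tz).2) KD).
  exact: data.
Qed.

End Meeting.

(** * Stability of the curve under equality of the data *)

Section Stability.
Variable R : realType.
Local Notation mu := (@lebesgue_measure R).
Implicit Types (u v w p q r z : plane R) (T : {fset plane R}).
Implicit Types (M : {fset {fset plane R}}) (phi psi g : R -> plane R) (s t e d h : R).

Lemma tame_bounded_dot N g w a b : tame N g -> `|w.1| <= 1 -> `|w.2| <= 1 ->
  bounded_derivatives 5 (N%:R + N%:R) a b (fun t => dot w (g t)) /\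
  bounded_derivatives 4 (N%:R + N%:R) a b (fun t => dot w (velocity g t)).
Proof.
move=> [_ dg bg _ _] w1 w2.
have bd j m : (m + j <= 5)%N -> bounded_derivatives m (N%:R + N%:R) a b
    (fun t => w.1 * (fst \o g)^`(j)%classic t + w.2 * (snd \o g)^`(j)%classic t).
  move=> mj; apply: (@bounded_derivatives_le _ _ (`|w.1| * N%:R + `|w.2| * N%:R)).
    by rewrite lerD// ler_piMl.
  apply: bounded_derivativesD; apply: bounded_derivativesZ;
    apply: (derive1n_bounded _ _ _ _ mj) => i t i5.
  - by have [] := dg i t i5.
  - by have [] := bg i t i5.
  - by have [] := dg i t i5.
  - by have [] := bg i t i5.
by split; [exact: (bd 0%N 5%N isT)|exact: (bd 1%N 4%N isT)].
Qed.

(** [B] depends on [N] only, so it serves both curves. The abscissa varies by at most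
    [2 * N%:R * (2 * rho)] over the window, which is the [W] of [tower_zeros]. *)
Lemma graph_interpolation N : exists2 B : R, 0 <= B &
  forall g t0 u v rho (P : {poly R}) (z : nat -> R), tame N g -> axis_frame u v -> 0 < rho ->
  (forall t, `|t - t0| <= rho -> 1 <= 8 * N%:R * dot u (velocity g t)) ->
  (size P <= 5)%N ->
  (forall i, (i < 5)%N -> z i \in `[t0 - rho, t0 + rho] /\
    dot v (g (z i)) = P.[dot u (g (z i))]) ->
  (forall i, (i.+1 < 5)%N -> z i < z i.+1) ->
  forall t, t \in `[t0 - rho, t0 + rho] ->
  `|dot v (g t) - P.[dot u (g t)]| <= B * (4 * N%:R * rho) ^+ 5.
Proof.
have N0 : 0 <= N%:R :> R by [].
have [||B B0 HB] := @tower_bounded R 5 (N%:R + N%:R) (8 * N%:R).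
- exact: addr_ge0.
- by rewrite mulr_ge0.
exists B => // g t0 u v rho P z tg uv rho0 lo P5 Hz zi t tI.
have sg := tame_smooth1 tg; have [u1 u2 v1 v2] := frame_coord uv.
have K1 := tame_ge1 tg; have K0 : 0 < N%:R :> R by apply: lt_le_trans K1.
set a := t0 - rho in tI Hz *; set b := t0 + rho in tI Hz *.
have lo' x : x \in `[a, b] -> 1 <= 8 * N%:R * dot u (velocity g x).
  by rewrite in_itv/= /a /b => /andP[h1 h2]; apply: lo; rewrite ler_norml; apply/andP; split; lra.
have pos x : x \in `[a, b] -> 0 < dot u (velocity g x).
  move=> /lo' h1; have K8 : 0 < 8 * N%:R :> R by rewrite mulr_gt0.
  by rewrite -(pmulr_rgt0 _ K8); exact: lt_le_trans ltr01 h1.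
have dX x : x \in `[a, b] -> is_derive x 1 (fun t => dot u (g t)) (dot u (velocity g x)).
  by move=> _; exact: is_derive_dot.
have tw := HB a b _ _ (tame_bounded_dot a b tg v1 v2).1 (tame_bounded_dot a b tg u1 u2).2.
have {}tw : tower 5 B a b (fun t => dot u (velocity g t)) (fun t => dot v (g t)).
  apply: tw => x xI; have p := pos _ xI; split; first by rewrite gt_eqF.
  rewrite ger0_norm ?invr_ge0 ?(ltW p)// -[leLHS]mul1r ler_pdivrMr//; exact: lo'.
apply: (tower_zeros (z := z) dX pos _ B0 _ (tower_subr_poly dX P5 tw)) => //.
- move=> x y xI yI; rewrite -dotB.
  have [h1 _] := dot_le_l1 (g y - g x) uv; apply: le_trans h1 _.
  have [h2 _] := tame_l1_lipschitz y x tg; apply: le_trans h2 _.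
  have -> : 4 * N%:R * rho = 2 * N%:R * (2 * rho) by ring.
  rewrite ler_wpM2l ?mulr_ge0//.
  move: xI yI; rewrite !in_itv/= /a /b => /andP[? ?] /andP[? ?].
  by rewrite ler_norml; apply/andP; split; lra.
- by rewrite !mulr_ge0// ltW.
- by move=> i /Hz[zI E]; split => //; rewrite E subrr.
Qed.

Lemma increasing_nat n (z : nat -> R) : (forall i, (i.+1 < n)%N -> z i < z i.+1) ->
  forall i j, (i < j)%N -> (j < n)%N -> z i < z j.
Proof.
move=> zi i; elim=> // j IH; rewrite ltnS leq_eqVlt => /predU1P[->|ij] jn; first exact: zi.
by apply: lt_trans (zi _ jn); apply: IH => //; exact: ltnW.
Qed.

Lemma stability_local N : exists C h0 : R, 0 < h0 /\ forall phi psi M t0,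
  tame N phi -> tame N psi -> is_mesh M -> covers_curve M phi -> covers_curve M psi ->
  general_position phi M -> general_position psi M -> mesh_size M <= h0 ->
  (forall T w, T \in M ->
    \int[mu]_(t in [set t | hull T (phi t)] `&` `[0, 1[%classic) dot w (velocity phi t) =
    \int[mu]_(t in [set t | hull T (psi t)] `&` `[0, 1[%classic) dot w (velocity psi t)) ->
  0 <= t0 < 1 -> exists s, l1 (phi t0 - psi s) <= C * mesh_size M ^+ 5.
Proof.
have [B B0 HB] := graph_interpolation N.
pose K : R := N%:R; pose L := 16 * K * (1200 * K ^+ 3).
(* The first constant adds the interpolation errors of the two curves, with [rho = L * h]. The
   second enforces [K ^+ 2 * rho <= 1 / 100]; its [+ 1] keeps the denominator positive even for
   [N = 0]. *)
exists (2 * (B * (4 * K * L) ^+ 5)), (K ^+ 2 * L * 100 + 1)^-1.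
have K0 : 0 <= K by [].
have L0 : 0 <= L by have := exprn_ge0 3 K0; rewrite /L => h; have := mulr_ge0 K0 h; lra.
have D0 : 0 < K ^+ 2 * L * 100 + 1.
  by have := mulr_ge0 (exprn_ge0 2 K0) L0; lra.
split; first by rewrite invr_gt0.
move=> phi psi M t0 tphi tpsi mesh cphi cpsi gphi gpsi hM data t01.
pose h := mesh_size M; rewrite -/h in hM *.
have h0 : 0 < h by have [T TM _] := cphi 0; exact: mesh_size_gt0 TM.
pose rho := L * h.
have rhoE : rho = 16 * K * (1200 * (K ^+ 3 * h)) by rewrite /rho /L; ring.
have Krho : K ^+ 2 * rho <= 1 / 100.
  have : h * (K ^+ 2 * L * 100 + 1) <= 1 by rewrite -ler_pdivlMr// mul1r.
  rewrite /rho; have -> : h * (K ^+ 2 * L * 100 + 1) = 100 * (K ^+ 2 * (L * h)) + h by ring.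
  by lra.
have K1 : 1 <= K := tame_ge1 tphi.
have P3 : 0 < K ^+ 3 * h by rewrite mulr_gt0// exprn_gt0// (lt_le_trans _ K1).
have P4 : K ^+ 3 * h <= K * (K ^+ 3 * h) by rewrite ler_peMl// ltW.
have rho0 : 0 < rho by rewrite rhoE; clear - P3 P4; lra.
have h3 : K ^+ 3 * h <= 1 / 1000.
  have := ler_peMl (ltW rho0) (exprn_ege1 2 K1).
  move/le_trans => /(_ _ Krho); rewrite rhoE; clear - P4; lra.
have h13 := pow_le K1 (ltW h0) (isT : (1 <= 3)%N); rewrite expr1 in h13.
have [u [v [uv vu]]] := choose_frame (velocity phi t0).
have [s0 [s01 st0 us0 vs0]] := direction_transfer tphi tpsi mesh cphi erefl h0 h3 data t01 uv vu.
have ut0 : 1 <= 4 * N%:R * dot u (velocity phi t0).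
  have u0 : 0 <= dot u (velocity phi t0) by apply: le_trans vu.
  have := tame_l1_velocity t0 tphi; rewrite uv.2 (ger0_norm u0) -/K => h1.
  have h2 : K * `|dot v (velocity phi t0)| <= K * dot u (velocity phi t0) by rewrite ler_wpM2l.
  by have h4 := mulr_ge0 K0 u0; clear - h1 h2 h4; lra.
have vt0 : `|dot v (velocity phi t0)| <= 2 * dot u (velocity phi t0) + 12 * (N%:R ^+ 2 * h).
  have u0 : 0 <= dot u (velocity phi t0) by apply: le_trans vu.
  have h4 : 0 <= K ^+ 2 * h by rewrite mulr_ge0 ?exprn_ge0// ltW.
  by rewrite -/K; clear - vu u0 h4; lra.
have arc1 := tame_arc tphi uv h0 h3 Krho ut0 vt0.
have arc2 := tame_arc tpsi uv h0 h3 Krho us0 vs0.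
have arc g t : g = phi /\ `|t - t0| <= rho \/ g = psi /\ `|t - s0| <= rho ->
    1 <= 8 * N%:R * dot u (velocity g t) /\
    1 <= 16 * N%:R * dot (u + (1 / 4) *: v) (velocity g t).
  by case=> -[-> ht]; [exact: arc1|exact: arc2].
(* Five centres [12 * h] apart, symmetric about [phi t0]: the windows of radius [6 * h] are
   disjoint, so the meeting points have strictly increasing abscissas. *)
pose c (i : nat) := 12 * h * (i%:R - 2).
have /choice[ts Hts] : forall i : nat, exists ts : R * R, (i < 5)%N ->
    [/\ ts.1 \in `[t0 - rho, t0 + rho], ts.2 \in `[s0 - rho, s0 + rho],
    phi ts.1 = psi ts.2 & `|dot u (phi ts.1) - (dot u (phi t0) + c i)| < 6 * h].
  move=> i; have [i5|] := boolP (i < 5)%N; last by exists (0, 0).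
  have ci : `|c i| <= 48 * h.
    have i4 : i%:R <= 4 :> R by rewrite ler_nat.
    have i0 : 0 <= i%:R :> R by [].
    have h1 := mulr_ge0 (ltW h0) i0; have h2 := ler_wpM2l (ltW h0) i4.
    by clear - h1 h2 i0 i4 h0; rewrite /c ler_norml; apply/andP; split; lra.
  have [t [s Hts]] := meeting_point tphi tpsi mesh cphi cpsi gphi gpsi erefl h0 rhoE Krho
    data t01 s01 st0 uv arc ci.
  by exists (t, s) => _; exact: Hts.
have c4 : 4 * N%:R * h < (8 * K)^-1 * rho.
  have -> : (8 * K)^-1 * rho = 2400 * (K ^+ 3 * h).
    by rewrite rhoE; field; rewrite gt_eqF// (lt_le_trans ltr01).
  by rewrite -/K; clear - h13 P3; lra.
clear Krho rhoE data.
pose tt i := (ts i).1; pose ss i := (ts i).2.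
pose x i := dot u (phi (tt i)).
have xS i : (i.+1 < 5)%N -> x i < x i.+1.
  move=> i5; have [_ _ _] := Hts _ i5; have [_ _ _] := Hts _ (ltnW i5).
  rewrite -/(tt i) -/(tt i.+1) -/(x i) -/(x i.+1) /c -[i.+1]addn1 natrD !ltr_norml.
  by clear - h0 => /andP[? ?] /andP[? ?]; lra.
have xlt := increasing_nat xS.
have sphi := tame_smooth1 tphi; have spsi := tame_smooth1 tpsi.
have lo8 g y t : (forall t, `|t - y| <= rho -> 1 <= 8 * N%:R * dot u (velocity g t)) ->
    `|t - y| <= rho -> (8 * K)^-1 <= dot u (velocity g t).
  move=> H /H h1; have K8 : 0 < 8 * K by clear - K1; lra.
  by rewrite -(ler_pM2l K8) mulfV// gt_eqF.
have c80 : 0 < (8 * K)^-1 by rewrite invr_gt0; clear - K1; lra.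
have l1' t ht := (arc1 t ht).1; have l2' t ht := (arc2 t ht).1.
have [pa _ _] := arc_expanding sphi rho0 c80 (fun t => @lo8 phi t0 t l1').
have [qa _ qr] := arc_expanding spsi rho0 c80 (fun t => @lo8 psi s0 t l2').
have monoE g a b i j : smooth1 g -> is_arc g a b u -> i \in `[a, b] -> j \in `[a, b] ->
    dot u (g i) < dot u (g j) -> i < j.
  move=> sg ag iI jI; apply: contraTT; rewrite -!leNgt le_eqVlt => /predU1P[->//|ji].
  exact/ltW/(arc_increasing sg ag jI iI ji).
have ttS i : (i.+1 < 5)%N -> tt i < tt i.+1.
  move=> i5; have [h1 _ _ _] := Hts _ i5; have [h2 _ _ _] := Hts _ (ltnW i5).
  exact: monoE sphi pa h2 h1 (xS i i5).
have ssS i : (i.+1 < 5)%N -> ss i < ss i.+1.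
  move=> i5; have [_ h1 e1 _] := Hts _ i5; have [_ h2 e2 _] := Hts _ (ltnW i5).
  apply: monoE spsi qa h2 h1 _; rewrite -e1 -e2; exact: xS.
have xneq i j : (i < j)%N -> (j < 5)%N -> x i != x j.
  by move=> ij j5; rewrite lt_eqF// xlt.
have [P P5 PE] := poly_interpolation (fun i => dot v (phi (tt i))) xneq.
have t0I : t0 \in `[t0 - rho, t0 + rho].
  by rewrite in_itv/= gerBl lerDl (ltW rho0).
have e1 := HB phi t0 u v rho P tt tphi uv rho0 l1' P5.
have {}e1 := e1 (fun i i5 => conj (let: And4 h _ _ _ := Hts i i5 in h) (esym (PE i i5))) ttS t0 t0I.
have e2 := HB psi s0 u v rho P ss tpsi uv rho0 l2' P5.
have {}e2 := e2 _ ssS.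
(* The point of [psi] with the abscissa of [phi t0]: only the heights remain to be compared, both
   being close to the value of [P] there. *)
have [s sI sE] : exists2 s, s \in `[s0 - rho, s0 + rho] & dot u (psi s) = dot u (phi t0).
  have cX := continuous_dot (u := u) spsi.
  have rng : in_range psi (s0 - rho) (s0 + rho) u (phi t0).
    apply: qr; rewrite distrC; have [h1 _] := dot_le_l1 (psi s0 - phi t0) uv.
    rewrite dotB in h1; exact: le_lt_trans h1 (le_lt_trans st0 c4).
  move: rng => /andP[h1 h2].
  have ab : s0 - rho <= s0 + rho by clear - rho0; lra.
  have mid : Num.min (dot u (psi (s0 - rho))) (dot u (psi (s0 + rho))) <= dot u (phi t0) <=
      Num.max (dot u (psi (s0 - rho))) (dot u (psi (s0 + rho))).
    by rewrite ge_min le_max (ltW h1) (ltW h2) orbT.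
  have [s sI sE] := IVT ab (continuous_subspaceT cX) mid.
  by exists s.
exists s; rewrite uv.2 dotB sE subrr normr0 add0r dotB.
have {}e2 : `|dot v (psi s) - P.[dot u (psi s)]| <= B * (4 * N%:R * rho) ^+ 5.
  apply: e2 sI => i i5; have [_ hI E _] := Hts i i5; split => //.
  by rewrite /ss -E; apply/esym; exact: PE.
rewrite sE in e2.
have -> : 2 * (B * (4 * K * L) ^+ 5) * h ^+ 5 =
    B * (4 * N%:R * rho) ^+ 5 + B * (4 * N%:R * rho) ^+ 5.
  by rewrite /rho -/K; ring.
apply: le_trans (lerD e1 e2).
rewrite (distrC (dot v (psi s))).
have -> : dot v (phi t0) - dot v (psi s) = dot v (phi t0) - P.[dot u (phi t0)] +
  (P.[dot u (phi t0)] - dot v (psi s)) by ring.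
exact: ler_normD.
Qed.

End Stability.

(** * Reconstruction from the data *)

Section Reconstruction.
Variable R : realType.
Local Notation mu := (@lebesgue_measure R).
Implicit Types (M : {fset {fset plane R}}) (phi psi g : R -> plane R) (k N : nat).

Lemma stability N : exists C h0 : R, 0 < h0 /\ forall phi psi M,
  tame N phi -> tame N psi -> is_mesh M -> covers_curve M phi -> covers_curve M psi ->
  general_position phi M -> general_position psi M -> mesh_size M <= h0 ->
  (forall T w, T \in M ->
    \int[mu]_(t in [set t | hull T (phi t)] `&` `[0, 1[%classic) dot w (velocity phi t) =
    \int[mu]_(t in [set t | hull T (psi t)] `&` `[0, 1[%classic) dot w (velocity psi t)) ->
  forall t, exists s, eucl_dist (phi t) (psi s) <= C * mesh_size M ^+ 5.
Proof.
have [C [h0 [h00 H]]] := stability_local R N.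
exists C, h0; split => // phi psi M tphi tpsi mesh cphi cpsi gphi gpsi hM data t.
have [z tz] := to_unit_interval t.
have [s hs] := H phi psi M _ tphi tpsi mesh cphi cpsi gphi gpsi hM data tz.
exists s; apply: le_trans hs; apply: le_trans (eucl_le_l1 _ _) _.
by rewrite -mulrNz (tame_periodic_int _ _ tphi).1.
Qed.

(** The first two entries of the data are the integrals of [dx] and [dy], of which every [dot w] is
    a constant combination. *)
Lemma vector_data k phi psi M : (2 <= k)%N -> smooth1 phi -> smooth1 psi -> is_mesh M ->
  mesh_data k phi (M := M) = mesh_data k psi (M := M) -> forall T w, T \in M ->
  \int[mu]_(t in [set t | hull T (phi t)] `&` `[0, 1[%classic) dot w (velocity phi t) =
  \int[mu]_(t in [set t | hull T (psi t)] `&` `[0, 1[%classic) dot w (velocity psi t).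
Proof.
case: k => [|[|k]] k2; [discriminate k2|discriminate k2|] => sphi spsi mesh E T w TM.
have Ex : curve_integral phi T (fdx (fun=> 1)) = curve_integral psi T (fdx (fun=> 1)) :=
  congr1 (fun data => nth 0 (data [` TM]%fset).1 0) E.
have Ey : curve_integral phi T (fdy (fun=> 1)) = curve_integral psi T (fdy (fun=> 1)) :=
  congr1 (fun data => nth 0 (data [` TM]%fset).1 1) E.
clear E.
have domE g : [set t | 0 <= t < 1 /\ hull T (g t)] =
    [set t | hull T (g t)] `&` `[0, 1[%classic.
  by rewrite set_itvco; apply/seteqP; split => t [h1 h2]; exact: (conj h2 h1).
have dxE g : curve_integral g T (fdx (fun=> 1)) =
    \int[mu]_(t in [set t | hull T (g t)] `&` `[0, 1[%classic) (velocity g t).1.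
  rewrite /curve_integral domE; congr Rintegral; apply/funext => t /=.
  by rewrite mul1r mul0r addr0.
have dyE g : curve_integral g T (fdy (fun=> 1)) =
    \int[mu]_(t in [set t | hull T (g t)] `&` `[0, 1[%classic) (velocity g t).2.
  rewrite /curve_integral domE; congr Rintegral; apply/funext => t /=.
  by rewrite mul1r mul0r add0r.
have mg g : smooth1 g -> measurable ([set t | hull T (g t)] `&` `[0, 1[%classic).
  move=> sg; have mT := measurable_hull_preimage sg (mesh.1 _ TM).
  exact: (measurableI _ _ mT (measurable_itv _)).
have sub g : [set t | hull T (g t)] `&` `[0, 1[%classic `<=` `[0, 1]%classic.
  by move=> t [_]; rewrite /= !in_itv/= => /andP[-> /ltW].
rewrite (Rintegral_dot w (mg _ sphi) (sub phi) sphi).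
rewrite (Rintegral_dot w (mg _ spsi) (sub psi) spsi).
by rewrite -!dxE -!dyE Ex Ey.
Qed.

(** The properties that the stability estimate asks of both curves, so that any candidate is close
    to any other with the same [N]. *)
Definition candidate k N M (data : M -> seq R * seq R) psi : Prop :=
  [/\ tame N psi, covers_curve M psi, general_position psi M &
    mesh_data k psi (M := M) = data].

(* [N] is not part of the data; taking it minimal makes it no larger than the
   constant of any curve with these data. *)
Lemma best_candidate k M (data : M -> seq R * seq R) :
  exists psi, forall N phi, candidate k N data phi -> candidate k N data psi.
Proof.
have [[N0 [phi0 c0]]|none] := pselect (exists N phi, candidate k N data phi); last first.
  (* If no curve has these data, a constant map is a harmless default. *)
  by exists (fun=> 0) => N phi c; exfalso; apply: none; exists N, phi.
have ex : exists n, `[< exists phi, candidate k n data phi >].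
  by exists N0; apply/asboolP; exists phi0.
case: (ex_minnP ex) => n /asboolP[psi [tpsi cpsi gpsi E]] nmin.
exists psi => N phi c; split => //; apply: tame_le tpsi.
by apply: nmin; apply/asboolP; exists phi.
Qed.

End Reconstruction.

Theorem proposition9 (R : realType) :
  exists m : nat, forall k : nat, (2 <= k <= 5)%N ->
  exists reconstruct :
      forall M : {fset {fset plane R}}, (M -> seq R * seq R) -> R -> plane R,
  forall phi : R -> plane R, smooth_embedding m phi ->
  exists C h0 : R, 0 < h0 /\
  forall M : {fset {fset plane R}},
    is_mesh M -> covers_curve M phi -> general_position phi M ->
    mesh_size M <= h0 ->
    let psi := reconstruct M (mesh_data k phi (M := M)) in
    closed_curve psi /\ approximates (C * mesh_size M ^+ k) psi phi.
Proof.
exists 5%N => k /andP[k2 k5].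
exists (fun M data => projT1 (cid (best_candidate k data))) => phi /exists_tame[N tphi].
have [C [h0 [h00 stab]]] := stability R N.
(* Mesh size at most [1] gives [h ^+ 5 <= h ^+ k]; the absolute value is taken because [C] comes
   without a sign. *)
exists `|C|, (Num.min h0 1); split; first by rewrite lt_min h00 ltr01.
move=> M mesh cphi gphi; rewrite le_min => /andP[Mh0 M1].
case: cid => psi /= best.
have [|tpsi cpsi gpsi E] := best N phi; first by split.
have sphi := tame_smooth1 tphi; have spsi := tame_smooth1 tpsi.
have data := vector_data k2 spsi sphi mesh E.
clear E.
have M0 : 0 < mesh_size M by have [T TM _] := cphi 0; exact: mesh_size_gt0 TM.
have le : C * mesh_size M ^+ 5 <= `|C| * mesh_size M ^+ k.
  apply: le_trans (ler_norm _) _; rewrite normrM ler_wpM2l//.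
  by rewrite ger0_norm ?exprn_ge0 ?(ltW M0)// ler_wiXn2l// ltW.
split.
  split; last by case: tpsi.
  move=> t; rewrite (_ : psi = fun t => ((fst \o psi) t, (snd \o psi) t)); last first.
    by apply/funext => x; rewrite /= -surjective_pairing.
  exact: (cvg_pair (@smooth1_continuous1 _ _ spsi t) (@smooth1_continuous2 _ _ spsi t)).
(* The stability estimate is one-sided; applied in both orders it yields the two clauses. *)
split=> s.
  have [t h] := stab psi phi M tpsi tphi mesh cpsi cphi gpsi gphi Mh0 data s.
  by exists t; rewrite /eucl_dist -sqrrN opprB -[X in _ + X]sqrrN opprB; exact: le_trans le.
have [t h] := stab phi psi M tphi tpsi mesh cphi cpsi gphi gpsi Mh0
  (fun T w TM => esym (data T w TM)) s.
by exists t; exact: le_trans le.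
Qed.
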